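(* Let $\Omega\subset\mathbb{R}^n$ be a bounded open set, $p>1$, and let $a=a(x,\mathrm z)$ satisfy $$a\in C(\bar\Omega\times\mathbb{R}^n;\mathbb{R}^n)\cap C^1(\bar\Omega\times(\mathbb{R}^n\setminus\{0\});\mathbb{R}^n),\qquad a(x,0)=0\ \text{ for }x\in\Omega,$$ $$\langle D_{\mathrm z}a(x,\mathrm z)\xi,\xi\rangle\ge(p-1)|\mathrm z|^{p-2}|\xi|^2,\qquad |D_{\mathrm z}a(x,\mathrm z)|\le C|\mathrm z|^{p-2}\qquad\text{for }(x,\mathrm z)\in\Omega\times(\mathbb{R}^n\setminus\{0\}),\ \xi\in\mathbb{R}^n,$$ for some constant $C>0$. Let $f\in C^1(\mathbb{R})$ satisfy $|f(t)|\le c|t|^{q-1}+d$, with $0<q\le p$ and $c,d\ge0$. Let $w$ be a bounded solution of $$-\operatorname{div}(a(x,\nabla w))=f(w)\ \text{in }\Omega,\qquad w=0\ \text{on }\partial\Omega .$$ Let $\rho>1$. There are positive constants $C_1=C_1(n,p,q,\rho,c)$ and $C_2=C_2(n,p,\rho,d)$, depending only on the indicated quantities, such that the following hold. (i) If $p=q$ and $c<\lambda_p(\Omega)$, then $$\|w\|_\infty\le\max\left\{C_1\left(\frac{d}{\lambda_p(\Omega)-c}\right)^{\frac1{p-1}}|\Omega|^{\frac1p},\ C_2\left(\frac{d}{\lambda_p(\Omega)-c}\right)^{\frac{\kappa_1}{p-1}}|\Omega|^{\frac{\kappa_1}{p}}\right\},\qquad \kappa_1=\frac{p^2}{n(p-1)+p^2}.$$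 (ii) If $p>q$, then, with $r=p$, $$\|w\|_\infty\le\max\left\{C_1\tau^{\frac{rp}{n(p-q)+rp}},\ C_2\tau^{\frac{rp}{n(p-1)+rp}}\right\},$$ where $$\tau=|\Omega|^{1/p}\max\left\{\left(\frac{2c}{\lambda_p(\Omega)}\right)^{\frac1{p-q}},\left(\frac{2d}{\lambda_p(\Omega)}\right)^{\frac1{p-1}}\right\}.$$
   Context: Solutions are weak solutions in $W_0^{1,p}(\Omega)$. $\lambda_p(\Omega)$ is the first Dirichlet eigenvalue of $-\Delta_p$ in $\Omega$, $\Delta_pv=\operatorname{div}(|\nabla v|^{p-2}\nabla v)$. The constants $C_1,C_2$ are those for which $\|w\|_\infty\le\max\{C_1\|w\|_r^{rp/(n(p-q)+rp)},C_2\|w\|_r^{rp/(n(p-1)+rp)}\}$ holds for all bounded solutions $w$ with $r=p$; $\rho$ is an auxiliary parameter that may be fixed arbitrarily in $(1,\infty)$. *)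

(* Defs.v *)
From HB Require Import structures.
From mathcomp Require Import all_boot all_order all_algebra.
From mathcomp Require Import all_classical all_reals all_analysis.

Set Implicit Arguments.
Unset Strict Implicit.
Unset Printing Implicit Defensive.

Import Order.TTheory GRing.Theory Num.Theory.
Import numFieldNormedType.Exports.

Local Open Scope classical_set_scope.
Local Open Scope ring_scope.

(* The sigma-algebra on R^n generated by the coordinates, i.e. the product
   of the Borel sigma-algebras. *)
Definition rV_display : measure_display. Proof. exact: default_measure_display. Qed.

Section rV_measurable.
Context (R : realType) (n : nat).

Definition rV_coord (i : 'I_n) (x : 'rV[R]_n) : measurableTypeR R := x 0 i.

Definition rV_measurable : set (set 'rV[R]_n) := g_sigma_preimage rV_coord.

Let rV_set0 : rV_measurable set0.
Proof. exact: sigma_algebra0. Qed.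

Let rV_setC A : rV_measurable A -> rV_measurable (~` A).
Proof. exact: sigma_algebraC. Qed.

Let rV_bigcup (F : (set 'rV[R]_n)^nat) :
  (forall i, rV_measurable (F i)) -> rV_measurable (\bigcup_i (F i)).
Proof. exact: sigma_algebra_bigcup. Qed.

HB.instance Definition _ := @isMeasurable.Build rV_display 'rV[R]_n
  rV_measurable rV_set0 rV_setC rV_bigcup.

End rV_measurable.

Section rV_lebesgue_measure.
Context (R : realType).

Lemma measurable_rV_coord n (i : 'I_n) :
  measurable_fun [set: 'rV[R]_n] (@rV_coord R n i).
Proof.
move=> _ Y mY; rewrite setTI; apply: sub_sigma_algebra => /=.
rewrite -bigcup_seq/=; exists i => /=; first by rewrite mem_index_enum.
by exists Y => //; rewrite setTI.
Qed.

Lemma measurable_fun_rV d (T : measurableType d) n (f : T -> 'rV[R]_n) :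
  (forall i, measurable_fun [set: T] (@rV_coord R n i \o f)) ->
  measurable_fun [set: T] f.
Proof.
move=> mf _ Y; rewrite setTI; move: Y.
pose G : set (set 'rV[R]_n) := [set A | measurable (f @^-1` A)].
suff : @rV_measurable R n `<=` G by apply.
apply: smallest_sub.
  split => [|A|F]; rewrite /G/=.
  - by rewrite preimage_set0; exact: measurable0.
  - by move=> mA; rewrite setTD preimage_setC; exact: measurableC.
  - by move=> mF; rewrite preimage_bigcup; exact: bigcupT_measurable.
move=> A; rewrite -bigcup_seq/= => -[i _] [B mB <-]; rewrite /G/= setTI.
by rewrite -comp_preimage -[X in measurable X]setTI; exact: mf.
Qed.

Definition rV_cons n (t : measurableTypeR R * 'rV[R]_n) : 'rV[R]_n.+1 :=
  \row_i oapp (fun j => t.2 0 j) t.1 (unlift ord0 i).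

Definition rV_uncons n (x : 'rV[R]_n.+1) : measurableTypeR R * 'rV[R]_n :=
  (x 0 ord0, \row_j x 0 (lift ord0 j)).

Lemma rV_consK n : cancel (@rV_cons n) (@rV_uncons n).
Proof.
move=> [t x]; congr pair; first by rewrite mxE unlift_none.
by apply/rowP => j; rewrite !mxE liftK.
Qed.

Lemma measurable_rV_cons n : measurable_fun setT (@rV_cons n).
Proof.
apply: measurable_fun_rV => i.
have [j ->|->] := unliftP ord0 i.
- rewrite (_ : _ \o _ = @rV_coord R n j \o snd).
    by apply: measurableT_comp => //; exact: measurable_rV_coord.
  by apply/funext => t; rewrite /rV_coord/= mxE liftK.
- rewrite (_ : _ \o _ = fst)//.
  by apply/funext => t; rewrite /rV_coord/= mxE unlift_none.
Qed.

Lemma measurable_rV_uncons n : measurable_fun setT (@rV_uncons n).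
Proof.
apply/measurable_fun_pairP; split; first exact: (measurable_rV_coord ord0).
apply: measurable_fun_rV => i.
rewrite (_ : _ \o _ = rV_coord (lift ord0 i)).
  exact: measurable_rV_coord.
by apply/funext => x; rewrite /rV_coord/= mxE.
Qed.


Section rV_lebesgue_succ.
Context (n : nat) (mu : {sigma_finite_measure set 'rV[R]_n -> \bar R}).

Definition rV_lebesgue_succ : set 'rV[R]_n.+1 -> \bar R :=
  pushforward (lebesgue_measure \x mu)%E (@rV_cons n).

Let mcons := @measurable_rV_cons n.

Let succ0 : rV_lebesgue_succ set0 = 0%E.
Proof. exact: measure0. Qed.

Let succ_ge0 A : (0 <= rV_lebesgue_succ A)%E.
Proof. exact: measure_ge0. Qed.

Let succ_sigma_additive : semi_sigma_additive rV_lebesgue_succ.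
Proof. exact: measure_semi_sigma_additive. Qed.

HB.instance Definition _ := isMeasure.Build _ _ _ rV_lebesgue_succ
  succ0 succ_ge0 succ_sigma_additive.

Let succ_sigma_finite : sigma_finite setT rV_lebesgue_succ.
Proof.
have /sigma_finiteP[F [TF ndF Foo]] := sigma_finiteT (@lebesgue_measure R).
have /sigma_finiteP[G [TG ndG Goo]] := sigma_finiteT mu.
exists (fun k => @rV_uncons n @^-1` (F k `*` G k)).
  rewrite -preimage_bigcup (_ : \bigcup_k _ = setT) ?preimage_setT//.
  apply/seteqP; split=> // -[x y] _.
  have [k _ Fkx] : (\bigcup_k F k) x by rewrite -TF.
  have [l _ Gly] : (\bigcup_k G k) y by rewrite -TG.
  exists (maxn k l) => //; split.
  - by move: x Fkx; exact/subsetPset/ndF/leq_maxl.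
  - by move: y Gly; exact/subsetPset/ndG/leq_maxr.
move=> k; have [mF Fk] := Foo k; have [mG Gk] := Goo k; split.
  rewrite -[X in measurable X]setTI; apply: measurable_rV_uncons => //.
  exact: measurableX.
rewrite /rV_lebesgue_succ /pushforward -comp_preimage.
rewrite (_ : _ \o _ = id); last by apply/funext => t /=; rewrite rV_consK.
by rewrite preimage_id product_measure1E// lte_mul_pinfty// ge0_fin_numE.
Qed.

HB.instance Definition _ := Measure_isSigmaFinite.Build _ _ _ rV_lebesgue_succ
  succ_sigma_finite.

End rV_lebesgue_succ.

Fixpoint rV_lebesgue_measure (n : nat) :
    {sigma_finite_measure set 'rV[R]_n -> \bar R} :=
  if n is n'.+1 then rV_lebesgue_succ (rV_lebesgue_measure n')
  else dirac (0 : 'rV[R]_0).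

End rV_lebesgue_measure.

Section euclidean.
Context (R : realType) (n : nat).
Implicit Types u v z : 'rV[R]_n.

Definition dotrV u v : R := \sum_i u 0 i * v 0 i.

(* The library norm of 'rV[R]_n is the max norm; this is the Euclidean one. *)
Definition enorm z : R := Num.sqrt (dotrV z z).

Definition grad (phi : 'rV[R]_n -> R) (x : 'rV[R]_n) : 'rV[R]_n :=
  \row_i 'D_(delta_mx 0 i) phi x.

Fixpoint iter_partial (s : seq 'I_n) (phi : 'rV[R]_n -> R) : 'rV[R]_n -> R :=
  if s is i :: s' then fun x => 'D_(delta_mx 0 i) (iter_partial s' phi) x
  else phi.

Definition smooth (phi : 'rV[R]_n -> R) : Prop :=
  forall s x, differentiable (iter_partial s phi) x.

(* phi is in C_c^oo(Omega), extended by zero to the whole space *)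
Definition test_function (Omega : set 'rV[R]_n) (phi : 'rV[R]_n -> R) : Prop :=
  smooth phi /\
  exists K, [/\ compact K, K `<=` Omega & forall x, ~ K x -> phi x = 0].

End euclidean.

(* f is C^1 on the open set D, and its first derivatives extend continuously
   to E, where D `<=` E `<=` closure D; this is the meaning of f \in C^1(E). *)
Definition C1_upto (R : realType) (V W : normedModType R) (D E : set V)
    (f : V -> W) : Prop :=
  (forall x, D x -> differentiable f x) /\
  forall v, exists g : V -> W,
    {within E, continuous g} /\ forall x, D x -> 'D_v f x = g x.

(* In this section functions on Omega are represented by total functions whose
   values outside Omega are irrelevant. *)
Section sobolev.
Context (R : realType) (n : nat) (Omega : set 'rV[R]_n) (p : R).
Implicit Types (u phi : 'rV[R]_n -> R) (G : 'rV[R]_n -> 'rV[R]_n).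

Local Notation mu := (rV_lebesgue_measure R n).

Definition weak_gradient u G : Prop :=
  forall phi, test_function Omega phi -> forall i,
    \int[mu]_(x in Omega) (u x * 'D_(delta_mx 0 i) phi x) =
    - \int[mu]_(x in Omega) (G x 0 i * phi x).

(* u is in W^{1,p}(Omega), with weak gradient G *)
Definition sobolev_W1p u G : Prop :=
  [/\ measurable_fun Omega u,
      mu.-integrable Omega (fun x => (`|u x| `^ p)%:E),
      measurable_fun Omega G,
      mu.-integrable Omega (fun x => (enorm (G x) `^ p)%:E)
    & weak_gradient u G].

(* u is in W_0^{1,p}(Omega), the closure of C_c^oo(Omega) in W^{1,p}(Omega),
   with weak gradient G *)
Definition sobolev_W01p u G : Prop :=
  sobolev_W1p u G /\
  exists phi : nat -> 'rV[R]_n -> R,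
    [/\ forall k, test_function Omega (phi k),
        (\int[mu]_(x in Omega) (`|phi k x - u x| `^ p)%:E)%E @[k --> \oo]
          --> 0%E
      & (\int[mu]_(x in Omega) (enorm (grad (phi k) x - G x) `^ p)%:E)%E
          @[k --> \oo] --> 0%E].

(* u is in W_0^{1,p}(Omega) and solves - div (a (x, grad u)) = g u weakly *)
Definition weak_solution (a : 'rV[R]_n -> 'rV[R]_n -> 'rV[R]_n) (g : R -> R) u
    : Prop :=
  exists G, sobolev_W01p u G /\
    forall phi, test_function Omega phi ->
      \int[mu]_(x in Omega) dotrV (a x (G x)) (grad phi x) =
      \int[mu]_(x in Omega) (g (u x) * phi x).

Definition p_laplace_eigenvalue (lam : R) : Prop :=
  exists u,
    weak_solution (fun _ z => enorm z `^ (p - 2) *: z)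
                  (fun t => lam * (`|t| `^ (p - 2) * t)) u /\
    ~ {ae mu, forall x, Omega x -> u x = 0}.

(* The least eigenvalue; for Omega empty there is none, and lambda_p is 0. *)
Definition lambda_p : R := inf [set lam | p_laplace_eigenvalue lam].

(* the norm of L^r(Omega), for r in ]0, +oo] *)
Definition Lnorm_on (r : \bar R) u : \bar R :=
  Lnorm mu r (EFin \o (u \_ Omega)).

Definition volume : R := fine (mu Omega).

End sobolev.

(* Main.v *)
(* Let M = |w|_oo.  Testing the equation with the truncation (|w| - k)_+ sgn w,
   M/2 <= k <= 3M/4, where |f(w)| <= 2 c M^(q-1) + d, bounds its energy; with the
   Faber-Krahn inequality this makes the truncated integrals satisfy a De Giorgi
   recursion, which would force |w| <= 3M/4 unless |w|_p is bounded below by a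
   power of M.  According to which of 2 c M^(q-1) and d is larger, this lower
   bound is one of the two terms of the maximum.
   Testing with w itself gives lambda_p |w|_p^p <= c |w|_q^q + d |w|_1, and
   Hoelder's inequality on Omega then bounds |w|_p.  This uses that lambda_p,
   the least eigenvalue, is the infimum of the Rayleigh quotient: the infimum is
   attained, by Rellich compactness and uniform convexity, and it is positive by
   Faber-Krahn. *)
Require Import Defs.
From mathcomp Require Import all_boot all_order all_algebra.
From mathcomp Require Import all_classical all_reals all_analysis.
From mathcomp Require Import measurable_realfun ess_sup_inf.
From mathcomp Require Import ring lra zify.

Set Implicit Arguments.
Unset Strict Implicit.
Unset Printing Implicit Defensive.

Import Order.TTheory GRing.Theory Num.Theory.
Import numFieldNormedType.Exports.

Local Open Scope classical_set_scope.
Local Open Scope ring_scope.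

(** * Lebesgue measure on R^n *)

(** Both Faber-Krahn and Rellich come from one estimate, |u(. + h) - u|_p <= |h| |grad u|_p.
    Averaging over h in a cube gives the first, because x + h leaves a small support for many h;
    averaging inside the cells of a mesh gives the second, because only finitely many cell integrals
    remain to be controlled. This treats every p > 1 alike, without distinguishing p < n from p >=
    n. W_0^{1,p} is known only as a closure of smooth functions, so a truncation has to be smoothed
    before it maps test functions to test functions; its chain rule is then obtained in the limit.
    [lambda_p] is an infimum over eigenvalues. Testing an eigenfunction by itself bounds every
    eigenvalue below by the Rayleigh infimum; the converse needs a minimizer together with its
    Euler-Lagrange equation. Truncation levels stay above M/2 because, for q < 1, the growth bound
    t^(q-1) blows up near 0 and is comparable to M^(q-1) only away from it. *)

Section rV_lebesgue.
Context {R : realType}.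

Lemma lebesgue_measureD (h : R) (A : set (measurableTypeR R)) : measurable A ->
  lebesgue_measure ((fun x => x + h) @^-1` A) = lebesgue_measure A.
Proof.
move=> mA; apply/esym.
have mf : measurable_fun setT
    (fun x : measurableTypeR R => (x + h : measurableTypeR R)).
  exact: measurable_funD.
pose nu : {measure set _ -> \bar R} :=
  measure_function_pushforward__canonical__measure_function_Measure
  lebesgue_measure mf.
apply: (lebesgue_measure_unique (mu := nu)) => // _ [[a b]] _ <-.
rewrite /= /pushforward.
rewrite (_ : _ @^-1` _ = `]a - h, b - h]%classic); last first.
  by apply/seteqP; split => x /=; rewrite !in_itv/= ltrBlDr lerBrDr.
rewrite !lebesgue_measure_itv/= !lte_fin ltrD2r.
by case: ifPn => // _; rewrite -!EFinB; congr EFin; ring.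
Qed.

Local Notation mu n := (rV_lebesgue_measure R n).

Lemma measurable_rV_translate n (h : 'rV[R]_n) :
  measurable_fun [set: 'rV[R]_n] (fun x => x + h).
Proof.
apply: measurable_fun_rV => i.
rewrite (_ : _ \o _ = (fun x => rV_coord i x + h 0 i)); last first.
  by apply/funext => x; rewrite /rV_coord/= mxE.
by apply: measurable_funD => //; exact: measurable_rV_coord.
Qed.

Lemma rV_lebesgue_succE n (A : set 'rV[R]_n.+1) :
  mu n.+1 A = (lebesgue_measure \x mu n)%E (@rV_cons R n @^-1` A).
Proof. by []. Qed.

(** Induction on the dimension: in the coordinates of [rV_cons] a translation acts separately on the
    two factors, and a measure that agrees with the product measure on rectangles is the product
    measure. *)
Lemma rV_lebesgueD n (h : 'rV[R]_n) (A : set 'rV[R]_n) : measurable A ->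
  mu n ((fun x => x + h) @^-1` A) = mu n A.
Proof.
elim: n h A => [|n IH] h A mA.
  by congr (mu 0 _); apply/seteqP; split => x /=; rewrite (thinmx0 (x + h)) (thinmx0 x).
have mT : measurable_fun setT (fun t : measurableTypeR R * 'rV[R]_n =>
    ((t.1 + h 0 0 : measurableTypeR R), t.2 + \row_j h 0 (lift ord0 j))).
  apply/measurable_fun_pairP; split; first exact: measurable_funD.
  exact: (measurableT_comp (measurable_rV_translate _) measurable_snd).
pose nu : {measure set _ -> \bar R} :=
  measure_function_pushforward__canonical__measure_function_Measure
  (lebesgue_measure \x mu n)%E mT.
have mcA : measurable (@rV_cons R n @^-1` A).
  by rewrite -[X in measurable X]setTI; exact: measurable_rV_cons.
rewrite !rV_lebesgue_succE; transitivity (nu (@rV_cons R n @^-1` A)).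
  rewrite /= /pushforward; congr product_measure1.
  apply/seteqP; split => -[t x] /=; congr A;
    apply/rowP => i; rewrite !mxE; case: unliftP => [j ->|->]/=; rewrite ?mxE//.
apply/esym/product_measure_unique => // B C mB mC.
rewrite /= /pushforward.
transitivity ((lebesgue_measure \x mu n)%E
  (((fun x => x + h 0 0) @^-1` B) `*`
   ((fun x => x + \row_j h 0 (lift ord0 j)) @^-1` C))) => //.
rewrite product_measure1E//.
- by congr (_ * _)%E; [exact: lebesgue_measureD|exact: IH].
- by rewrite -[X in measurable X]setTI; exact: measurable_funD.
- by rewrite -[X in measurable X]setTI; exact: measurable_rV_translate.
Qed.

Lemma rV_boxE n (a : 'rV[R]_n) (r : R) :
  [set x : 'rV[R]_n | forall i, a 0 i <= x 0 i < a 0 i + r] =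
  \bigcap_(i in [set: 'I_n]) (@rV_coord R n i @^-1` `[a 0 i, a 0 i + r[).
Proof.
by apply/seteqP; split => x /= H i; have := H i; rewrite /= in_itv//=; exact.
Qed.

Lemma measurable_rV_box n (a : 'rV[R]_n) (r : R) :
  measurable [set x : 'rV[R]_n | forall i, a 0 i <= x 0 i < a 0 i + r].
Proof.
rewrite rV_boxE; apply: fin_bigcap_measurable => // i _.
by rewrite -[X in measurable X]setTI; exact: measurable_rV_coord.
Qed.

Lemma rV_lebesgue_box n (a : 'rV[R]_n) (r : R) : 0 <= r ->
  mu n [set x | forall i, a 0 i <= x 0 i < a 0 i + r] = (r ^+ n)%:E.
Proof.
move=> r0; elim: n a => [|n IH] a.
  rewrite /= diracE mem_set//= => -[]//.
pose b : 'rV[R]_n := \row_j a 0 (lift ord0 j).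
have E : @rV_cons R n @^-1` [set x | forall i, a 0 i <= x 0 i < a 0 i + r] =
    `[a 0 0, a 0 0 + r[%classic `*` [set x : 'rV[R]_n | forall i, b 0 i <= x 0 i < b 0 i + r].
  apply/seteqP; split => -[t x]/=.
    move=> H; split; first by have := H 0; rewrite mxE unlift_none in_itv.
    by move=> i; have := H (lift ord0 i); rewrite !mxE liftK.
  move=> [H1 H2] i; rewrite mxE; case: unliftP => [j ->|->] /=.
    by have := H2 j; rewrite mxE.
  by move: H1; rewrite in_itv.
rewrite rV_lebesgue_succE E product_measure1E//; last exact: measurable_rV_box.
transitivity (r%:E * (r ^+ n)%:E)%E; last by rewrite -EFinM exprS.
congr (_ * _)%E; last exact: IH.
transitivity (lebesgue_measure (`[a 0 0, a 0 0 + r[%classic : set R)) => //.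
rewrite lebesgue_measure_itv/= lte_fin.
case: ifPn => [|]; first by rewrite -EFinB addrAC subrr add0r.
rewrite ltrDl -leNgt => r00.
by congr EFin; apply/eqP; rewrite eq_le r00 r0.
Qed.

Lemma le_coord_norm n (x : 'rV[R]_n) (i : 'I_n) : `|x 0 i| <= `|x|.
Proof.
rewrite [leRHS]/Num.Def.normr/= mx_normrE.
by apply/bigmax_geP; right => /=; exists (0, i).
Qed.

Lemma rV_norm_lt n (x : 'rV[R]_n) (e : R) : 0 < e ->
  (forall i, `|x 0 i| < e) -> `|x| < e.
Proof.
move=> e0 xe; rewrite [ltLHS]/Num.Def.normr/= mx_normrE.
by apply/bigmax_ltP; split => // -[i j] _ /=; rewrite ord1.
Qed.

Lemma rV_norm_le n (x : 'rV[R]_n) (e : R) : 0 <= e ->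
  (forall i, `|x 0 i| <= e) -> `|x| <= e.
Proof.
move=> e0 xe; rewrite [leLHS]/Num.Def.normr/= mx_normrE.
by apply/bigmax_leP; split => // -[i j] _ /=; rewrite ord1.
Qed.

(** Index of the half-open cube of side 1/(k + 1) that contains x. The indices form a countable type
    and the cells have known measure; the mesh serves both the measurability of open sets and the
    compactness argument. *)
Definition grid n (k : nat) (x : 'rV[R]_n) : 'rV[int]_n :=
  \row_i Num.floor (x 0 i * k.+1%:R).

Lemma grid_fiberE n k (z : 'rV[int]_n) :
  [set x : 'rV[R]_n | grid k x = z] =
  [set x | forall i, (\row_j ((z 0 j)%:~R / k.+1%:R) : 'rV[R]_n) 0 i <= x 0 i <
     (\row_j ((z 0 j)%:~R / k.+1%:R) : 'rV[R]_n) 0 i + k.+1%:R^-1].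
Proof.
apply/seteqP; split => x /= H.
  move=> i; rewrite !mxE -[X in _ < _ + X]mul1r -mulrDl.
  rewrite ler_pdivrMr// ltr_pdivlMr//.
  have := floor_itv (x 0 i * k.+1%:R).
  by move/rowP : H => /(_ i); rewrite mxE => ->; rewrite intrD.
apply/rowP => i; rewrite mxE; apply: floor_def.
have := H i; rewrite !mxE -[X in _ < _ + X]mul1r -mulrDl.
by rewrite ler_pdivrMr// ltr_pdivlMr// intrD.
Qed.

Lemma measurable_grid_fiber n k (z : 'rV[int]_n) :
  measurable [set x : 'rV[R]_n | grid k x = z].
Proof. by rewrite grid_fiberE; exact: measurable_rV_box. Qed.

Lemma rV_lebesgue_grid_fiber n k (z : 'rV[int]_n) :
  mu n [set x | grid k x = z] = (k.+1%:R^-1 ^+ n)%:E.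
Proof. by rewrite grid_fiberE; apply: rV_lebesgue_box. Qed.

Lemma grid_dist n k (x y : 'rV[R]_n) : grid k x = grid k y ->
  `|x - y| < k.+1%:R^-1.
Proof.
move=> xy; apply: rV_norm_lt => [|i]; first by rewrite invr_gt0.
have := floor_itv (x 0 i * k.+1%:R); have := floor_itv (y 0 i * k.+1%:R).
move/rowP : xy => /(_ i); rewrite !mxE => ->; rewrite intrD => /andP[a b] /andP[c d].
rewrite -[k.+1%:R^-1]mul1r ltr_pdivlMr// -[X in _ * X]gtr0_norm// -normrM mulrBl.
rewrite ltr_norml; lra.
Qed.

(** The sigma-algebra is generated by the coordinates, whereas openness refers to the norm. The link
    is that an open set is the union of the countably many products of mesh cells that it
    contains. *)
Lemma open_prod_measurable m n (U : set ('rV[R]_m * 'rV[R]_n)) :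
  open U -> measurable U.
Proof.
move=> oU.
pose F (t : nat * 'rV[int]_m * 'rV[int]_n) : set ('rV[R]_m * 'rV[R]_n) :=
  let C := [set x | grid t.1.1 x = t.1.2] `*` [set y | grid t.1.1 y = t.2] in
  if `[< C `<=` U >] then C else set0.
rewrite (_ : U = \bigcup_t F t); last first.
  apply/seteqP; split => [[x y] Uxy|xy [t _]]; last first.
    by rewrite /F; case: asboolP => // CU /CU.
  have /nbhs_ballP[e /= e0 eU] : nbhs (x, y) U by exact: open_nbhs_nbhs.
  have [k _ /(_ k (leqnn k)) /= ke] := near_infty_natSinv_lt (PosNum e0).
  exists (k, grid k x, grid k y) => //=; rewrite /F /=.
  case: asboolP => [_ //|[]] [x' y'] [/= xx' yy'].
  apply: eU; split; rewrite -ball_normE/=; apply: lt_trans ke;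
    by rewrite grid_dist.
apply: countable_bigcupT_measurable => [|t]; first exact: countableP.
rewrite /F; case: asboolP => // _.
by apply: measurableX; exact: measurable_grid_fiber.
Qed.

Lemma open_rV_measurable n (U : set 'rV[R]_n) : open U -> measurable U.
Proof.
move=> oU.
rewrite -[X in measurable X]setTI.
have m1 : measurable_fun setT (fun x : 'rV[R]_n => (x, x)).
  exact: measurable_fun_pair.
apply: (m1 measurableT (fst @^-1` U)); apply: open_prod_measurable.
by apply: open_comp => // -[x y] _; exact: cvg_fst.
Qed.

Lemma continuous_rV_measurable n (f : 'rV[R]_n -> R) : continuous f ->
  measurable_fun setT f.
Proof.
move=> cf; apply: (measurability _ (RGenOInfty.measurableE R)) => //.
move=> _ [_ [a ->] <-]; rewrite setTI; apply: open_rV_measurable.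
by apply: open_comp => //; exact: rray_open.
Qed.

(** Meant for x |-> a(x, G x): the coefficient is continuous on an open cylinder over Omega only,
    and the weak gradient is measurable on Omega only. *)
Lemma open_comp_measurable d (T : measurableType d) m n
    (U : set ('rV[R]_m * 'rV[R]_n)) (f : 'rV[R]_m * 'rV[R]_n -> R)
    (D : set T) (g : T -> 'rV[R]_m) (h : T -> 'rV[R]_n) :
  open U -> {in U, continuous f} -> measurable_fun D g -> measurable_fun D h ->
  (forall x, D x -> U (g x, h x)) ->
  measurable_fun D (fun x => f (g x, h x)).
Proof.
move=> oU cf mg mh DU mD.
apply: (measurability _ (RGenOInfty.measurableE R)) => //.
move=> _ [_ [a ->] <-].
pose V := U `&` f @^-1` `]a, +oo[%classic.
have oV : open V.
  rewrite openE => -[x y] [Uxy fxy]; apply: filterI.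
    by exact: open_nbhs_nbhs.
  apply: cf; first by rewrite inE.
  by apply: open_nbhs_nbhs; split => //; exact: rray_open.
rewrite (_ : _ `&` _ = D `&` (fun x => (g x, h x)) @^-1` V).
  (* Extended by zero outside [D], both maps are measurable on the whole space, where the pair can
     be formed. *)
  have m1 : measurable_fun setT (fun x => ((g \_ D) x, (h \_ D) x)).
    by apply: measurable_fun_pair; apply: (iffLR (measurable_restrictT _ mD)).
  rewrite (_ : _ `&` _ = D `&` (fun x => ((g \_ D) x, (h \_ D) x)) @^-1` V).
    apply: measurableI => //; rewrite -[X in measurable X]setTI.
    by apply: m1 => //; exact: open_prod_measurable.
  by apply/seteqP; split => x [Dx]; rewrite /= !patchE mem_set.
by apply/seteqP; split => x [Dx fx]; split => //; [split => //; exact: DU|case: fx].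
Qed.

Lemma measurable_funrV d (T : measurableType d) n (D : set T) (f : T -> 'rV[R]_n) :
  (forall i, measurable_fun D (fun x => f x 0 i)) -> measurable_fun D f.
Proof.
move=> mf mD; have H : measurable_fun setT (f \_ D).
  apply: measurable_fun_rV => i.
  rewrite (_ : _ \o _ = (fun x => f x 0 i) \_ D).
    by apply: (iffLR (measurable_restrictT _ mD)); exact: mf.
  by apply/funext => x; rewrite /rV_coord /patch/=; case: ifP => //; rewrite mxE.
by apply: (iffRL (measurable_restrictT _ mD)).
Qed.

Lemma measurable_rV_coordP d (T : measurableType d) n (D : set T)
    (f : T -> 'rV[R]_n) i :
  measurable_fun D f -> measurable_fun D (fun x => f x 0 i).
Proof. by move=> mf; apply: (measurableT_comp (measurable_rV_coord i) mf). Qed.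

End rV_lebesgue.

Section integral_translate.
Context {R : realType} (n : nat).
Local Notation mu := (rV_lebesgue_measure R n).
Local Open Scope ereal_scope.

Lemma ge0_integral_rVD (h : 'rV[R]_n) (f : 'rV[R]_n -> \bar R) :
  measurable_fun setT f -> (forall x, 0 <= f x) ->
  \int[mu]_x f (x + h)%R = \int[mu]_x f x.
Proof.
move=> mf f0.
have := @ge0_integral_pushforward _ _ _ _ R _ (measurable_rV_translate h) mu
  setT f measurableT mf (fun x _ => f0 x).
rewrite preimage_setT => <-.
apply: (eq_measure_integral mu) => [|mh A mA _]; last exact: rV_lebesgueD.
exact: measurable_rV_translate.
Qed.

Lemma integral_rVD (h : 'rV[R]_n) (f : 'rV[R]_n -> \bar R) :
  measurable_fun setT f ->
  \int[mu]_x f (x + h)%R = \int[mu]_x f x.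
Proof.
move=> mf; rewrite integralE [RHS]integralE; congr (_ - _).
  rewrite -[RHS](ge0_integral_rVD h)//; first by apply: eq_integral => x _; rewrite !funeposE.
  exact: measurable_funepos.
rewrite -[RHS](ge0_integral_rVD h)//; first by apply: eq_integral => x _; rewrite !funenegE.
exact: measurable_funeneg.
Qed.

End integral_translate.

(** * Euclidean norms and convexity of powers *)

Section euclid.
Context {R : realType} {n : nat}.
Implicit Types u v z a b : 'rV[R]_n.

Lemma dotrVC u v : dotrV u v = dotrV v u.
Proof. by apply: eq_bigr => i _; rewrite mulrC. Qed.

Lemma dotrVDl u v z : dotrV (u + v) z = dotrV u z + dotrV v z.
Proof. by rewrite -big_split; apply: eq_bigr => i _; rewrite mxE mulrDl. Qed.

Lemma dotrVDr u v z : dotrV z (u + v) = dotrV z u + dotrV z v.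
Proof. by rewrite dotrVC dotrVDl !(dotrVC z). Qed.

Lemma dotrVZl (k : R) u z : dotrV (k *: u) z = k * dotrV u z.
Proof. by rewrite mulr_sumr; apply: eq_bigr => i _; rewrite mxE mulrA. Qed.

Lemma dotrVZr (k : R) u z : dotrV z (k *: u) = k * dotrV z u.
Proof. by rewrite dotrVC dotrVZl dotrVC. Qed.

Lemma dotrVNl u z : dotrV (- u) z = - dotrV u z.
Proof. by rewrite -scaleN1r dotrVZl mulN1r. Qed.

Lemma dotrVNr u z : dotrV z (- u) = - dotrV z u.
Proof. by rewrite -scaleN1r dotrVZr mulN1r. Qed.

Lemma dotrV0l z : dotrV 0 z = 0.
Proof. by rewrite -(scale0r z) dotrVZl mul0r. Qed.

Lemma dotrV0r z : dotrV z 0 = 0.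
Proof. by rewrite dotrVC dotrV0l. Qed.

Lemma dotrV_ge0 z : 0 <= dotrV z z.
Proof. by apply: sumr_ge0 => i _; rewrite -expr2 sqr_ge0. Qed.

Lemma enorm_ge0 z : 0 <= enorm z.
Proof. exact: sqrtr_ge0. Qed.

Lemma sqr_enorm z : enorm z ^+ 2 = dotrV z z.
Proof. by rewrite sqr_sqrtr// dotrV_ge0. Qed.

Lemma enorm0 : enorm (0 : 'rV[R]_n) = 0.
Proof. by rewrite /enorm dotrV0l sqrtr0. Qed.

Lemma coord_le_enorm z i : `|z 0 i| <= enorm z.
Proof.
rewrite -sqrtr_sqr ler_wsqrtr// /dotrV (bigD1 i)//= -expr2 lerDl.
by apply: sumr_ge0 => j _; rewrite -expr2 sqr_ge0.
Qed.

Lemma enorm_eq0 z : enorm z = 0 -> z = 0.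
Proof.
move=> z0; apply/rowP => i; rewrite mxE; apply/eqP; rewrite -normr_le0 -z0.
exact: coord_le_enorm.
Qed.

Lemma enorm_gt0 z : z != 0 -> 0 < enorm z.
Proof.
move=> z0; rewrite lt_neqAle enorm_ge0 andbT eq_sym.
by apply: contra z0 => /eqP/enorm_eq0 ->.
Qed.

Lemma enormZ (k : R) z : enorm (k *: z) = `|k| * enorm z.
Proof.
rewrite /enorm dotrVZl dotrVZr mulrA -expr2 sqrtrM ?sqr_ge0//.
by rewrite sqrtr_sqr.
Qed.

Lemma enormN z : enorm (- z) = enorm z.
Proof. by rewrite -scaleN1r enormZ normrN1 mul1r. Qed.

Lemma dotrV_le u v : dotrV u v <= enorm u * enorm v.
Proof.
have [->|u0] := eqVneq u 0; first by rewrite dotrV0l enorm0 mul0r.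
have [->|v0] := eqVneq v 0; first by rewrite dotrV0r enorm0 mulr0.
have nu := enorm_gt0 u0; have nv := enorm_gt0 v0.
have := dotrV_ge0 (enorm v *: u - enorm u *: v).
rewrite !dotrVDl !dotrVDr !dotrVNl !dotrVNr !dotrVZl !dotrVZr -!sqr_enorm.
rewrite (dotrVC v u); set x := enorm u in nu *; set y := enorm v in nv *.
set d := dotrV u v => H.
have : 0 <= (x * y) * (x * y - d) by nra.
by rewrite pmulr_rge0 ?subr_ge0// mulr_gt0.
Qed.

Lemma CauchySchwarz_dotrV u v : `|dotrV u v| <= enorm u * enorm v.
Proof.
by rewrite ler_norml dotrV_le andbT lerNl -dotrVNl -(enormN u) dotrV_le.
Qed.

Lemma enormD u v : enorm (u + v) <= enorm u + enorm v.
Proof.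
rewrite -(@ler_pXn2r _ 2)// ?nnegrE ?addr_ge0 ?enorm_ge0//.
rewrite sqr_enorm dotrVDl !dotrVDr (dotrVC v u) sqrrD !sqr_enorm.
by have := dotrV_le u v; lra.
Qed.

Lemma enormB u v : enorm (u - v) <= enorm u + enorm v.
Proof. by rewrite -(enormN v) enormD. Qed.

Lemma enorm_distC u v : enorm (u - v) = enorm (v - u).
Proof. by rewrite -enormN opprB. Qed.

Lemma ler_enorm_dist u v : `|enorm u - enorm v| <= enorm (u - v).
Proof.
have H1 := enormD (u - v) v; have H2 := enormD (v - u) u.
move: H1 H2; rewrite !subrK (enorm_distC v u) ler_norml => H1 H2.
by apply/andP; split; lra.
Qed.

Lemma enorm_le_sum z : enorm z <= \sum_i `|z 0 i|.
Proof.
rewrite -(@ler_pXn2r _ 2)// ?nnegrE ?enorm_ge0 ?sumr_ge0//.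
rewrite sqr_enorm expr2 mulr_suml; apply: ler_sum => i _.
rewrite mulr_sumr (bigD1 i)//= -normrM; apply: (le_trans (ler_norm _)).
by rewrite lerDl; apply: sumr_ge0 => j _; rewrite mulr_ge0.
Qed.

Lemma enorm_le_norm z : enorm z <= n%:R * `|z|.
Proof.
apply: (le_trans (enorm_le_sum z)).
rewrite mulr_natl -[X in _ *+ X]card_ord -sumr_const.
apply: ler_sum => i _; rewrite [leRHS]/Num.Def.normr/= mx_normrE.
by apply/bigmax_geP; right => /=; exists (0, i).
Qed.

Lemma norm_le_enorm z : `|z| <= enorm z.
Proof.
rewrite [leLHS]/Num.Def.normr/= mx_normrE.
apply/bigmax_leP; split; [exact: enorm_ge0|case=> i j _ /=].
by rewrite ord1; exact: coord_le_enorm.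
Qed.

(** Parallelogram law; it supplies strict convexity between vectors of equal length. *)
Lemma enorm_midpoint a b : enorm ((1 / 2) *: (a + b)) ^+ 2 =
  (enorm a ^+ 2 + enorm b ^+ 2) / 2 - (enorm (a - b) / 2) ^+ 2.
Proof.
rewrite expr_div_n !sqr_enorm !(dotrVZl, dotrVZr, dotrVDl, dotrVDr, dotrVNl, dotrVNr).
by rewrite (dotrVC b a); field.
Qed.

Lemma continuous_enorm : continuous (@enorm R n).
Proof.
move=> z; apply/(@cvgrPdist_lt _ _ _ (nbhs z) _) => e e0; near=> y.
apply: (le_lt_trans (ler_enorm_dist _ _)); apply: (le_lt_trans (enorm_le_norm _)).
rewrite (@le_lt_trans _ _ (n.+1%:R * `|z - y|))//.
  by rewrite ler_wpM2r// ler_nat.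
rewrite mulrC -ltr_pdivlMr//; near: y.
apply: cvgr_dist_lt; last exact: divr_gt0.
exact: cvg_id.
Unshelve. all: by end_near. Qed.

End euclid.

Section powers.
Context {R : realType}.
Implicit Types p t x y : R.

Lemma powR_norm_continuous p : 0 < p -> continuous (fun t : R => `|t| `^ p).
Proof.
move=> p0 t; have [->|t0] := eqVneq t 0.
  rewrite /continuous_at normr0 powR0 ?gt_eqF//.
  apply/cvgrPdist_lt => e e0; near=> s.
  rewrite sub0r normrN ger0_norm ?powR_ge0//.
  rewrite -[e](@powRr1 _ e) ?ltW// -(mulVf (lt0r_neq0 p0)) powRrM.
  apply: gt0_ltr_powR => //; rewrite ?nnegrE ?powR_ge0//.
  near: s; apply: (@cvgr0_norm_lt _ _ _ _ _ id); last exact: powR_gt0.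
  exact: cvg_id.
apply: (@continuous_comp _ _ _ (fun t : R => `|t|) (fun x => x `^ p)).
  exact: norm_continuous.
apply: differentiable_continuous; apply/derivable1_diffP.
by apply: derivable_powR; rewrite in_itv/= andbT normr_gt0.
Unshelve. all: by end_near. Qed.

Lemma powR_nneg_cvg (T : Type) (F : set_system T) (FF : Filter F) (f : T -> R) (l p : R) :
  0 < p -> (forall s, 0 <= f s) -> 0 <= l ->
  f @ F --> l -> (fun s => f s `^ p) @ F --> l `^ p.
Proof.
move=> p0 f0 l0 fl; rewrite -(ger0_norm l0).
rewrite (_ : (fun _ => _) = (fun s => `|f s| `^ p)).
  exact: (cvg_comp _ (fun t : R => `|t| `^ p) fl (powR_norm_continuous p0 (x := l))).
by apply/funext => s; rewrite ger0_norm.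
Qed.

(** The sum is at most twice the larger term. *)
Lemma powRD_le p x y : 0 <= p -> 0 <= x -> 0 <= y ->
  (x + y) `^ p <= 2 `^ p * (x `^ p + y `^ p).
Proof.
move=> p0 x0 y0; wlog xy : x y x0 y0 / x <= y.
  move=> H; have /orP[|] := le_total x y; first exact: H.
  by rewrite addrC (addrC (x `^ p)); exact: H.
apply: (@le_trans _ _ ((2 * y) `^ p)).
  by apply: ge0_ler_powR => //; rewrite ?nnegrE ?addr_ge0 ?mulr_ge0//; lra.
by rewrite powRM// ler_wpM2l ?powR_ge0// lerDr powR_ge0.
Qed.

(** Mean value theorem and strict monotonicity of z^(p-1). The function is taken as |t|^p, which is
    continuous on the whole line, because y = 0 is allowed as an endpoint. *)
Lemma powR_tangent_lt p x y : 1 < p -> 0 < x -> 0 <= y -> x != y ->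
  x `^ p + p * x `^ (p - 1) * (y - x) < y `^ p.
Proof.
move=> p1 x0 y0 xy; have p0 : 0 < p by lra.
have dF (z : R) : 0 < z -> is_derive z 1 (fun t : R => `|t| `^ p) (p * z `^ (p - 1)).
  move=> z0; have H : is_derive z 1 (fun t : R => t `^ p) (p * z `^ (p - 1)).
    apply: DeriveDef; first by apply: derivable_powR; rewrite in_itv/= z0.
    by rewrite -derive1E powR_derive1// in_itv/= z0.
  apply: near_eq_is_derive H.
  near=> t; rewrite ger0_norm// ltW//; near: t.
  by apply: cvgr_gt z0; exact: cvg_id.
have cF (a b : R) : {within `[a, b], continuous (fun t : R => `|t| `^ p)}.
  by apply: continuous_subspaceT; exact: powR_norm_continuous.
have [xy'|yx] := ltP x y.
  have dF' (z : R) : z \in `]x, y[ ->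
      is_derive z 1 (fun t : R => `|t| `^ p) (p * z `^ (p - 1)).
    by rewrite in_itv/= => /andP[xz _]; apply: dF; lra.
  have [z zxy] := MVT xy' dF' (@cF _ _).
  move: zxy; rewrite in_itv/= => /andP[xz zy]; rewrite !ger0_norm//; last by lra.
  move=> E; suff H : x `^ (p - 1) < z `^ (p - 1).
    have : p * x `^ (p - 1) * (y - x) < p * z `^ (p - 1) * (y - x).
      by rewrite ltr_pM2r ?subr_gt0// ltr_pM2l.
    by lra.
  by apply: gt0_ltr_powR; rewrite ?nnegrE; lra.
have {}yx : y < x by rewrite lt_neqAle eq_sym xy.
have dF' (z : R) : z \in `]y, x[ -> is_derive z 1 (fun t : R => `|t| `^ p) (p * z `^ (p - 1)).
  by rewrite in_itv/= => /andP[yz _]; apply: dF; lra.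
have [z zxy] := MVT yx dF' (@cF _ _).
move: zxy; rewrite in_itv/= => /andP[xz zy]; rewrite !ger0_norm//; last by lra.
move=> E; suff H : z `^ (p - 1) < x `^ (p - 1).
  have : p * z `^ (p - 1) * (x - y) < p * x `^ (p - 1) * (x - y).
    by rewrite ltr_pM2r ?subr_gt0// ltr_pM2l.
  by lra.
by apply: gt0_ltr_powR; rewrite ?nnegrE; lra.
Unshelve. all: by end_near. Qed.

(** Add the two tangent inequalities at the midpoint: the linear terms cancel. *)
Lemma powR_midpoint_lt p x y : 1 < p -> 0 <= x -> 0 <= y -> x != y ->
  ((x + y) / 2) `^ p < (x `^ p + y `^ p) / 2.
Proof.
move=> p1 x0 y0 xy; set m := (x + y) / 2.
have m0 : 0 < m.
  rewrite /m divr_gt0// lt_neqAle addr_ge0// andbT eq_sym; apply: contra xy.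
  by rewrite paddr_eq0// => /andP[/eqP-> /eqP->].
have mx : m != x by apply: contra xy => /eqP H; apply/eqP; rewrite /m in H; lra.
have my : m != y by apply: contra xy => /eqP H; apply/eqP; rewrite /m in H; lra.
have := powR_tangent_lt p1 m0 x0 mx; have := powR_tangent_lt p1 m0 y0 my.
have -> : y - m = - (x - m) by rewrite /m; field.
by lra.
Qed.

End powers.

Section euclid_powers.
Context {R : realType} {n : nat} (p : R) (p1 : 1 < p).
Implicit Types z h a b : 'rV[R]_n.

Let p0 : 0 < p. Proof. exact: lt_trans ltr01 p1. Qed.

(** The flux of the q-Laplacian, that is, the gradient of |z|^q / q. Its value at 0 is 0 whatever
    the power of 0 is set to. *)
Definition pvec (q : R) z : 'rV[R]_n := enorm z `^ (q - 2) *: z.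

Lemma enorm_pvec z : enorm (pvec p z) = enorm z `^ (p - 1).
Proof.
rewrite enormZ ger0_norm ?powR_ge0//.
have [->|z0] := eqVneq z 0; first by rewrite enorm0 mulr0 powR0// gt_eqF// subr_gt0.
have ez := enorm_gt0 z0.
rewrite (_ : p - 1 = (p - 2) + 1); last by ring.
by rewrite [RHS]powRD ?(gt_eqF ez) ?implybT// powRr1// enorm_ge0.
Qed.

Lemma dotrV_pvec z : dotrV (pvec p z) z = enorm z `^ p.
Proof.
rewrite dotrVZl -sqr_enorm.
have [->|z0] := eqVneq z 0.
  by rewrite enorm0 expr0n/= mulr0 [RHS]powR0// gt_eqF.
have ez := enorm_gt0 z0.
rewrite -powR_mulrn ?enorm_ge0// -powRD ?(gt_eqF ez) ?implybT//.
by congr (_ `^ _); ring.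
Qed.

Lemma young_powR (x y : R) : 0 <= x -> 0 <= y ->
  p * (x `^ (p - 1) * y) <= (p - 1) * x `^ p + y `^ p.
Proof.
move=> x0 y0; have q0 : 0 < p / (p - 1) by rewrite divr_gt0// subr_gt0.
have := @conjugate_powR R (x `^ (p - 1)) y (p / (p - 1)) p (powR_ge0 _ _) y0 q0 p0.
rewrite -powRrM (_ : (p - 1) * (p / (p - 1)) = p); last first.
  by field; rewrite subr_eq0 gt_eqF.
have -> : (p / (p - 1))^-1 + p^-1 = 1.
  by rewrite invf_div -[X in _ + X]mul1r -mulrDl subrK divff ?gt_eqF.
move=> /(_ erefl).
rewrite -(ler_pM2l p0) => /le_trans; apply.
by rewrite le_eqVlt; apply/orP; left; apply/eqP; field; rewrite subr_eq0 !gt_eqF.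
Qed.

(** Convexity of |z|^p without differentiating it: Cauchy-Schwarz bounds the product of [pvec p z]
    with z + h by |z|^(p-1) |z + h|, and Young's inequality separates the two factors. *)
Lemma enorm_powR_tangent z h :
  enorm z `^ p + p * dotrV (pvec p z) h <= enorm (z + h) `^ p.
Proof.
have := young_powR (enorm_ge0 z) (enorm_ge0 (z + h)).
have : dotrV (pvec p z) (z + h) <= enorm z `^ (p - 1) * enorm (z + h).
  by rewrite -enorm_pvec dotrV_le.
rewrite -(ler_pM2l p0) dotrVDr dotrV_pvec; lra.
Qed.

(** Two sources of strictness: for equal lengths the parallelogram law, for different lengths the
    strict convexity of t^p on the half-line. *)
Lemma enorm_midpoint_lt a b : a != b ->
  enorm ((1 / 2) *: (a + b)) `^ p < (enorm a `^ p + enorm b `^ p) / 2.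
Proof.
move=> ab; have [E|nab] := eqVneq (enorm a) (enorm b).
  rewrite E (_ : (_ + _) / 2 = enorm b `^ p); last by field.
  apply: gt0_ltr_powR; rewrite ?nnegrE ?enorm_ge0//.
  rewrite -(@ltr_pXn2r _ 2) ?nnegrE ?enorm_ge0// enorm_midpoint E.
  have : 0 < enorm (a - b) by rewrite enorm_gt0// subr_eq0.
  by move=> H; have := exprn_gt0 2 (divr_gt0 H (ltr0n _ 2)); lra.
apply: le_lt_trans (powR_midpoint_lt p1 (enorm_ge0 a) (enorm_ge0 b) nab).
apply: ge0_ler_powR; rewrite ?nnegrE ?enorm_ge0 ?(ltW p0)//.
  by rewrite divr_ge0 ?addr_ge0 ?enorm_ge0.
by rewrite enormZ ger0_norm// mul1r mulrC ler_wpM2r// enormD.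
Qed.

Lemma enorm_midpoint_le a b :
  enorm ((1 / 2) *: (a + b)) `^ p <= (enorm a `^ p + enorm b `^ p) / 2.
Proof.
have [->|ab] := eqVneq a b; last exact/ltW/enorm_midpoint_lt.
by rewrite (_ : _ *: _ = b); [lra|apply/rowP => i; rewrite !mxE; field].
Qed.

Lemma enormD_powR_le a b :
  enorm (a + b) `^ p <= 2 `^ p * (enorm a `^ p + enorm b `^ p).
Proof.
apply: le_trans (powRD_le (ltW p0) (enorm_ge0 a) (enorm_ge0 b)).
by apply: ge0_ler_powR; rewrite ?nnegrE ?addr_ge0 ?enorm_ge0 ?(ltW p0) ?enormD.
Qed.

Lemma enormB_powR_le a b :
  enorm (a - b) `^ p <= 2 `^ p * (enorm a `^ p + enorm b `^ p).
Proof. by rewrite -(enormN b) enormD_powR_le. Qed.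

Lemma enormZ_powR (k : R) a : 0 <= k -> enorm (k *: a) `^ p = k `^ p * enorm a `^ p.
Proof. by move=> k0; rewrite enormZ ger0_norm// powRM// enorm_ge0. Qed.

Let defect (x : 'rV[R]_n * 'rV[R]_n) : R :=
  (enorm x.1 `^ p + enorm x.2 `^ p) / 2 - enorm ((1 / 2) *: (x.1 + x.2)) `^ p.

Lemma enorm_powR_continuous (q : R) (T : topologicalType) (f : T -> 'rV[R]_n) :
  0 < q -> continuous f -> continuous (fun x => enorm (f x) `^ q).
Proof.
move=> q0 cf x; apply: powR_nneg_cvg => //; first by move=> ?; exact: enorm_ge0.
  exact: enorm_ge0.
exact: (cvg_comp _ _ (cf x) (continuous_enorm (x := f x))).
Qed.

Let defect_cont : continuous defect.
Proof.
move=> x; apply: cvgB; [apply: cvgMl; apply: cvgD|].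
- by apply: (enorm_powR_continuous p0 (f := fst)) => ?; exact: cvg_fst.
- by apply: (enorm_powR_continuous p0 (f := snd)) => ?; exact: cvg_snd.
- apply: (enorm_powR_continuous p0 (f := fun x : 'rV[R]_n * 'rV[R]_n => (1 / 2) *: (x.1 + x.2))) => y.
  by apply: cvgZl_tmp; apply: cvgD; [exact: cvg_fst|exact: cvg_snd].
Qed.

(* Uniform convexity of |z|^p, with the modulus obtained by compactness of the
   unit sphere {|a|^p + |b|^p = 1}. *)
Lemma enorm_uniformly_convex (e : R) : 0 < e ->
  exists2 C, 0 <= C & forall a b, enorm (a - b) `^ p <=
    e * (enorm a `^ p + enorm b `^ p) +
    C * ((enorm a `^ p + enorm b `^ p) / 2 - enorm ((1 / 2) *: (a + b)) `^ p).
Proof.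
move=> e0.
pose K := [set x : 'rV[R]_n * 'rV[R]_n |
  enorm x.1 `^ p + enorm x.2 `^ p = 1 /\ e <= enorm (x.1 - x.2) `^ p].
have cK : compact K.
  pose B := [set z : 'rV[R]_n | `|z| <= 1].
  have cB : compact B.
    apply: bounded_closed_compact.
      by exists 1; split => // M M1 z /= z1; apply: le_trans z1 (ltW M1).
    rewrite (_ : B = Num.norm @^-1` [set t : R | t <= 1])//.
    by apply: preimage_closed => [z _|]; [exact: norm_continuous|exact: closed_le].
  apply: (subclosed_compact _ (compact_setX cB cB)).
    rewrite (_ : K = (fun x : 'rV[R]_n * 'rV[R]_n =>
         enorm x.1 `^ p + enorm x.2 `^ p) @^-1` [set t : R | t = 1] `&`
       (fun x : 'rV[R]_n * 'rV[R]_n =>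
         enorm (x.1 - x.2) `^ p) @^-1` [set t : R | e <= t])//.
    apply: closedI.
      apply: preimage_closed => [z _|]; last exact: closed_eq.
      apply: cvgD.
        by apply: (enorm_powR_continuous p0 (f := fst)) => ?; exact: cvg_fst.
      by apply: (enorm_powR_continuous p0 (f := snd)) => ?; exact: cvg_snd.
    apply: preimage_closed => [z _|]; last exact: closed_ge.
    apply: (enorm_powR_continuous p0 (f := fun x : 'rV[R]_n * 'rV[R]_n => x.1 - x.2)) => ?.
    by apply: cvgB; [exact: cvg_fst|exact: cvg_snd].
  have le1 (z : 'rV[R]_n) : enorm z `^ p <= 1 -> `|z| <= 1.
    move=> z1; apply: (le_trans (norm_le_enorm z)); rewrite leNgt.
    apply/negP => /(gt0_ltr_powR p0); rewrite !nnegrE enorm_ge0 ler01.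
    by rewrite powR1 ltNge z1 => /(_ isT isT).
  move=> [a b] [/= ab _]; split; apply: le1 => /=.
    by have := powR_ge0 (enorm b) p; lra.
  by have := powR_ge0 (enorm a) p; lra.
have [m m0 mK] : exists2 m, 0 < m & forall x, K x -> m <= defect x.
  have [->|K0] := eqVneq K set0; first by exists 1.
  have [[a b] Kab mab] := compact_EVT_min (iffLR (set0P _) K0) cK
    (continuous_subspaceT defect_cont).
  exists (defect (a, b)); last by move=> x Kx; apply: mab; rewrite inE.
  move: Kab; rewrite inE => -[_ /= eab]; rewrite /defect/= subr_gt0.
  apply: enorm_midpoint_lt; apply: contraTneq eab => ->.
  by rewrite subrr enorm0 powR0 ?gt_eqF// -ltNge.
(* By homogeneity a far-apart pair of size N has defect at least m N, while |a - b|^p <= 2^p N for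
   every pair. *)
exists (2 `^ p / m); first by rewrite divr_ge0 ?powR_ge0 ?ltW.
move=> a b; set N := enorm a `^ p + enorm b `^ p.
have N0 : 0 <= N by rewrite addr_ge0 ?powR_ge0.
have D0 : 0 <= N / 2 - enorm ((1 / 2) *: (a + b)) `^ p.
  by rewrite subr_ge0 enorm_midpoint_le.
have [NN0|N0']  := leP N 0.
  have := enormB_powR_le a b; rewrite -/N => /le_trans; apply.
  apply: (@le_trans _ _ 0).
    by rewrite mulr_ge0_le0 ?powR_ge0.
  rewrite addr_ge0 ?mulr_ge0 ?(ltW e0)//.
  by rewrite invr_ge0 ltW.
have [ab|ab] := ltP (enorm (a - b) `^ p) (e * N).
  by apply: (le_trans (ltW ab)); rewrite lerDl mulr_ge0// divr_ge0 ?powR_ge0 ?ltW.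
(* Scaling by N^(-1/p) moves the pair into [K]; every term is homogeneous of degree p. *)
pose k := N `^ (- p^-1).
have kp : k `^ p = N^-1.
  by rewrite /k -powRrM mulNr mulVf ?gt_eqF// powR_inv1// ltW.
have k0 : 0 <= k by exact: powR_ge0.
have : m <= defect (k *: a, k *: b).
  apply: mK; split; rewrite /= -?scalerBr !(enormZ_powR _ k0) kp.
    by rewrite -mulrDr mulVf// gt_eqF.
  by rewrite mulrC ler_pdivlMr.
have -> : defect (k *: a, k *: b) = ((k `^ p * enorm a `^ p + k `^ p * enorm b `^ p) / 2 -
    k `^ p * enorm ((1 / 2) *: (a + b)) `^ p).
  by rewrite -!(enormZ_powR _ k0) /defect/= -scalerDr !scalerA (mulrC k).
rewrite kp.
set E := enorm ((1 / 2) *: (a + b)) `^ p.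
rewrite (_ : _ - _ = (N / 2 - E) / N); last by rewrite /N; ring.
rewrite ler_pdivlMr// => H.
have {}H : N <= (N / 2 - E) / m.
  by rewrite ler_pdivlMr// mulrC.
apply: (le_trans (enormB_powR_le a b)); rewrite -/N.
apply: (@le_trans _ _ (2 `^ p / m * (N / 2 - E))).
  by rewrite -mulrA ler_wpM2l ?powR_ge0// mulrC.
by rewrite lerDr mulr_ge0// ltW.
Qed.

Lemma continuous_pvec : continuous (pvec p).
Proof.
move=> z; have [->|z0] := eqVneq z 0.
  apply/(@cvgrPdist_lt _ _ _ (nbhs (0 : 'rV[R]_n)) _) => e e0; near=> y.
  rewrite /pvec scaler0 sub0r normrN; apply: (le_lt_trans (norm_le_enorm _)).
  rewrite enorm_pvec; near: y.
  have : enorm y `^ (p - 1) @[y --> (0 : 'rV[R]_n)] --> (enorm (0 : 'rV[R]_n)) `^ (p - 1).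
    apply: (@enorm_powR_continuous (p - 1) 'rV[R]_n id); first by rewrite subr_gt0.
    by move=> ?; exact: cvg_id.
  rewrite enorm0 powR0; last by rewrite gt_eqF// subr_gt0.
  by move=> H; apply: (cvgr_lt _ H).
apply: (@cvgZ _ _ _ (nbhs z) _); last exact: cvg_id.
apply: (cvg_comp _ (fun t : R => t `^ (p - 2)) (continuous_enorm (x := z))).
apply: (@differentiable_continuous R R R (enorm z) (fun t : R => t `^ (p - 2))).
apply/derivable1_diffP.
by apply: derivable_powR; rewrite in_itv/= andbT enorm_gt0.
Unshelve. all: by end_near. Qed.

End euclid_powers.

Section measurable_euclid.
Context {R : realType} d (T : measurableType d) (n : nat).

Lemma measurable_dotrV D (f g : T -> 'rV[R]_n) : measurable_fun D f ->
  measurable_fun D g -> measurable_fun D (fun x => dotrV (f x) (g x)).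
Proof.
move=> mf mg; apply: measurable_sum => i.
by apply: measurable_funM; exact: measurable_rV_coordP.
Qed.

Lemma measurable_enorm D (f : T -> 'rV[R]_n) : measurable_fun D f ->
  measurable_fun D (fun x => enorm (f x)).
Proof.
move=> mf; rewrite (_ : (fun x => _) = (fun x => dotrV (f x) (f x) `^ (1 / 2))).
  apply: (measurableT_comp (measurable_powR (1 / 2))).
  exact: measurable_dotrV.
by apply/funext => x; rewrite mul1r powR12_sqrt// dotrV_ge0.
Qed.

Lemma measurable_enorm_powR D (f : T -> 'rV[R]_n) p : measurable_fun D f ->
  measurable_fun D (fun x => enorm (f x) `^ p).
Proof.
by move=> mf; apply: (measurableT_comp (measurable_powR p)); exact: measurable_enorm.
Qed.

Lemma measurable_norm_powR D (f : T -> R) p : measurable_fun D f ->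
  measurable_fun D (fun x => `|f x| `^ p).
Proof.
move=> mf; apply: (measurableT_comp (measurable_powR p)).
exact: measurableT_comp.
Qed.

End measurable_euclid.

(** * Smooth functions and truncations *)

Section smooth.
Context {R : realType} {n : nat}.
Implicit Types (f g phi : 'rV[R]_n -> R) (i : 'I_n).
Local Notation e_ i := (delta_mx 0 i : 'rV[R]_n).

(** Finite orders of [smooth], arranged for induction: here the innermost partial derivative is
    peeled off, whereas [iter_partial] adds outermost ones. The product and chain rules then pass
    from order k to order k + 1. *)
Fixpoint smoothk (k : nat) f : Prop :=
  (forall x, differentiable f x) /\
  (if k is k'.+1 then forall i, smoothk k' (fun x => 'D_(e_ i) f x) else True).

Lemma iter_partial_rcons (s : seq 'I_n) i f :
  iter_partial (rcons s i) f = iter_partial s (fun x => 'D_(e_ i) f x).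
Proof. by elim: s => //= j s ->. Qed.

Lemma smooth_partial f i : smooth f -> smooth (fun x => 'D_(e_ i) f x).
Proof. by move=> sf s x; rewrite -iter_partial_rcons; exact: sf. Qed.

Lemma smoothkP f : smooth f <-> forall k, smoothk k f.
Proof.
split=> [sf k|sf s].
  elim: k f sf => [|k IH] f sf; first by split => // x; exact: (sf [::]).
  by split=> [x|i]; [exact: (sf [::])|apply: IH; exact: smooth_partial].
have := sf (size s); elim/last_ind: s {sf} f => [|s i IH] f; first by case.
by rewrite size_rcons iter_partial_rcons => -[_ /(_ i)]; exact: IH.
Qed.

Lemma smoothk_differentiable k f x : smoothk k f -> differentiable f x.
Proof. by case: k => [|k] []. Qed.

Lemma smoothk_leS k f : smoothk k.+1 f -> smoothk k f.
Proof.
elim: k f => [|k IH] f [df sf]; first by split.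
by split => // i; apply: IH; exact: sf.
Qed.

Lemma smoothk_cst k (c : R) : smoothk k (fun=> c).
Proof.
elim: k c => [|k IH] c; first by split => // x; exact: differentiable_cst.
split => [x|i]; first exact: differentiable_cst.
rewrite (_ : 'D_(e_ i) _ = fun=> 0)//.
by apply/funext => x; rewrite derive_cst.
Qed.

Lemma smoothkD k f g : smoothk k f -> smoothk k g -> smoothk k (fun x => f x + g x).
Proof.
elim: k f g => [|k IH] f g [df sf] [dg sg].
  by split => // x; exact: differentiableD.
split=> [x|i]; first exact: differentiableD.
rewrite (_ : (fun _ => _) = fun x => 'D_(e_ i) f x + 'D_(e_ i) g x).
  by apply: IH; [exact: sf|exact: sg].
by apply/funext => x; rewrite deriveD//; exact: diff_derivable.
Qed.

Lemma smoothkM k f g : smoothk k f -> smoothk k g -> smoothk k (fun x => f x * g x).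
Proof.
elim: k f g => [|k IH] f g sf sg.
  by split => // x; apply: differentiableM; exact: (@smoothk_differentiable 0).
have [df pf] := sf; have [dg pg] := sg.
split=> [x|i]; first exact: differentiableM.
rewrite (_ : (fun _ => _) = fun x => f x * 'D_(e_ i) g x + g x * 'D_(e_ i) f x).
  apply: smoothkD; apply: IH; do ?[exact: smoothk_leS|exact: pf|exact: pg].
by apply/funext => x; rewrite deriveM//; exact: diff_derivable.
Qed.

Lemma is_derive_comp_line f (h h' : R -> R) x (v : 'rV[R]_n) :
  is_derive (f x) 1 h (h' (f x)) -> differentiable f x ->
  is_derive x v (fun y => h (f y)) (h' (f x) * 'D_v f x).
Proof.
move=> [dh hE] df.
have dh' : differentiable h (f x) by exact/derivable1_diffP.
have dc : differentiable (h \o f) x by exact: differentiable_comp.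
apply: DeriveDef; first exact: diff_derivable.
rewrite (deriveE v dc) diff_comp//= -(deriveE v df) -{}hE.
rewrite -[in LHS](mulr1 ('D_v f x)) -[_ * 1]/(_ *: 1) linearZ/= mulrC -deriveE//.
Qed.

Lemma differentiable_comp_line f (h h' : R -> R) x :
  is_derive (f x) 1 h (h' (f x)) -> differentiable f x ->
  differentiable (fun y => h (f y)) x.
Proof.
move=> [dh _] df; apply: (@differentiable_comp _ _ _ _ f h) => //.
exact/derivable1_diffP.
Qed.

(** The regularity of the outer function enters only through [h'] composed with [f], one order
    lower. For a solution of an autonomous differential equation this can be fed back
    inductively. *)
Lemma smoothk_comp k f (h h' : R -> R) :
  (forall t : R, is_derive t 1 h (h' t)) -> smoothk k.+1 f ->
  smoothk k (fun x => h' (f x)) -> smoothk k.+1 (fun x => h (f x)).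
Proof.
move=> dh sf shf; have [df pf] := sf.
split=> [x|i]; first by apply: (differentiable_comp_line (dh (f x))); exact: df.
rewrite (_ : (fun _ => _) = fun x => h' (f x) * 'D_(e_ i) f x).
  by apply: smoothkM => //; exact: pf.
apply/funext => x.
by have [_ ->] := is_derive_comp_line (e_ i) (dh (f x)) (df x).
Qed.

Lemma smooth_comp f (h h' : R -> R) :
  (forall t : R, is_derive t 1 h (h' t)) -> smooth f ->
  smooth (fun x => h' (f x)) -> smooth (fun x => h (f x)).
Proof.
move=> dh /smoothkP sf /smoothkP shf; apply/smoothkP => k.
by apply: smoothk_leS; exact: smoothk_comp.
Qed.

Lemma smoothD f g : smooth f -> smooth g -> smooth (fun x => f x + g x).
Proof. by move=> /smoothkP sf /smoothkP sg; apply/smoothkP => k; exact: smoothkD. Qed.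

Lemma smoothM f g : smooth f -> smooth g -> smooth (fun x => f x * g x).
Proof. by move=> /smoothkP sf /smoothkP sg; apply/smoothkP => k; exact: smoothkM. Qed.

Lemma smooth_cst (c : R) : smooth (fun _ : 'rV[R]_n => c).
Proof. by apply/smoothkP => k; exact: smoothk_cst. Qed.

Lemma smooth_differentiable f x : smooth f -> differentiable f x.
Proof. by move/(_ [::] x). Qed.

End smooth.

(** * Smooth approximation of truncations *)

Section soft_truncation.
Context {R : realType}.
Implicit Types m k t : R.

Definition logistic m t : R := (1 + expR (- (m * t)))^-1.

(** Smooth approximation of max(t, 0) for m > 0, with error at most ln 2 / m and with derivative
    [logistic m]. *)
Definition softplus m t : R := ln (1 + expR (m * t)) / m.

Let onep_gt0 t : 0 < 1 + expR t. Proof. by rewrite addr_gt0// expR_gt0. Qed.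

Lemma is_derive_expR_lin m t :
  is_derive t 1 (fun s : R => expR (m * s)) (m * expR (m * t)).
Proof.
have H : is_derive t 1 (fun s : R => m * s) m.
  by rewrite -[X in is_derive _ _ _ X]mulr1; exact: is_deriveZ.
by rewrite mulrC; exact: is_derive1_comp.
Qed.

Lemma is_derive_logistic m t :
  is_derive t 1 (logistic m) (m * (logistic m t * (1 - logistic m t))).
Proof.
have H1 : is_derive t 1 (fun s : R => 1 + expR (- m * s)) (- m * expR (- m * t)).
  rewrite -[X in is_derive _ _ _ X]add0r.
  by apply: is_deriveD; exact: is_derive_expR_lin.
have n0 : 1 + expR (- m * t) != 0 by rewrite gt_eqF// onep_gt0.
have H2 : is_derive t 1 (fun s : R => (1 + expR (- m * s))^-1)
    (- (1 + expR (- m * t)) ^- 2 *: (- m * expR (- m * t))) by exact: is_deriveV.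
rewrite (_ : logistic m = fun s => (1 + expR (- m * s))^-1); last first.
  by apply/funext => s; rewrite /logistic mulNr.
apply: is_derive_eq H2 _.
rewrite -[_ *: _]/(_ * _); set E := expR _ in n0 *.
by field.
Qed.

Lemma is_derive_softplus m t : m != 0 ->
  is_derive t 1 (softplus m) (logistic m t).
Proof.
move=> m0.
have H1 : is_derive t 1 (fun s : R => 1 + expR (m * s)) (m * expR (m * t)).
  rewrite -[X in is_derive _ _ _ X]add0r.
  by apply: is_deriveD; exact: is_derive_expR_lin.
have H2 : is_derive t 1 (fun s : R => ln (1 + expR (m * s)))
    ((1 + expR (m * t))^-1 * (m * expR (m * t))).
  apply: (@is_derive1_comp _ (@ln R) (fun s : R => 1 + expR (m * s))).
  by apply: is_derive1_ln; exact: onep_gt0.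
rewrite (_ : softplus m = fun s => m^-1 * ln (1 + expR (m * s))); last first.
  by apply/funext => s; rewrite mulrC.
have H3 := is_deriveZ m^-1 H2.
apply: is_derive_eq H3 _.
rewrite -[_ *: _]/(_ * _) /logistic expRN.
have e0 : expR (m * t) != 0 by rewrite gt_eqF// expR_gt0.
rewrite (_ : 1 + (expR (m * t))^-1 = (1 + expR (m * t)) / expR (m * t)).
  by rewrite invf_div mulrCA mulKf// mulrC.
by rewrite mulrDl mul1r divff// addrC.
Qed.

(* The odd primitive of the indicator of {|t| > k}, smoothed at scale 1/m. *)
Definition soft_trunc m k t : R := softplus m (t - k) - softplus m (- t - k).

Definition soft_indic m k t : R := logistic m (t - k) + logistic m (- t - k).

Lemma is_derive_soft_trunc m k t : m != 0 ->
  is_derive t 1 (soft_trunc m k) (soft_indic m k t).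
Proof.
move=> m0.
have H1 : is_derive t 1 (fun s => softplus m (s - k)) (logistic m (t - k)).
  rewrite -[X in is_derive _ _ _ X]mulr1.
  apply: (@is_derive1_comp _ (softplus m) (fun s => s - k)).
    exact: is_derive_softplus.
  by rewrite -[X in is_derive _ _ _ X]subr0; exact: is_deriveB.
have H2 : is_derive t 1 (fun s => softplus m (- s - k)) (- logistic m (- t - k)).
  rewrite -[X in is_derive _ _ _ X]mulrN1.
  apply: (@is_derive1_comp _ (softplus m) (fun s => - s - k)).
    exact: is_derive_softplus.
  by rewrite -[X in is_derive _ _ _ X]subr0; apply: is_deriveB.
rewrite /soft_indic -[logistic _ (- t - k)]opprK.
exact: is_deriveB.
Qed.

Lemma soft_trunc0 m k : soft_trunc m k 0 = 0.
Proof. by rewrite /soft_trunc oppr0 subrr. Qed.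

Lemma logistic_gt0 m t : 0 < logistic m t.
Proof. by rewrite invr_gt0. Qed.

Lemma logistic_lt1 m t : logistic m t < 1.
Proof.
by rewrite invf_lt1// ltrDl expR_gt0.
Qed.

Lemma soft_indic_ge0 m k t : 0 <= soft_indic m k t.
Proof. by rewrite addr_ge0// ltW// logistic_gt0. Qed.

Lemma soft_indic_le2 m k t : soft_indic m k t <= 2.
Proof.
by have := logistic_lt1 m (t - k); have := logistic_lt1 m (- t - k); rewrite /soft_indic; lra.
Qed.

Lemma smooth_soft_trunc n (f : 'rV[R]_n -> R) m k : m != 0 ->
  smooth f -> smooth (fun x => soft_trunc m k (f x)).
Proof.
move=> m0 sf.
have slog (g : 'rV[R]_n -> R) : smooth g -> smooth (fun x => logistic m (g x)).
  move=> /smoothkP sg; apply/smoothkP => j.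
  (* The derivative of the logistic function is a polynomial in the function itself, so each order
     of smoothness yields the next. *)
  elim: j => [|j IH].
    split => // x; apply: (differentiable_comp_line
      (h' := fun t => m * (logistic m t * (1 - logistic m t)))).
      exact: is_derive_logistic.
    exact: (smoothk_differentiable _ (sg 0%N)).
  apply: (smoothk_comp (is_derive_logistic m)) => //.
  apply: smoothkM; first exact: smoothk_cst.
  apply: smoothkM => //; apply: smoothkD; first exact: smoothk_cst.
  rewrite (_ : (fun _ => _) = fun x => -1 * logistic m (g x)).
    by apply: smoothkM => //; exact: smoothk_cst.
  by apply/funext => x; rewrite mulN1r.
apply: (smooth_comp (fun t => is_derive_soft_trunc k t m0)) => //.
have sN : smooth (fun x => - f x).
  rewrite (_ : (fun _ => _) = fun x => -1 * f x).
    by apply: smoothM => //; exact: smooth_cst.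
  by apply/funext => x; rewrite mulN1r.
by apply: smoothD; apply: slog; apply: smoothD => //; exact: smooth_cst.
Qed.

Lemma logisticN m t : logistic m (- t) = 1 - logistic m t.
Proof.
rewrite /logistic mulrN opprK expRN.
have e0 : 0 < expR (m * t) by exact: expR_gt0.
have n0 : 1 + expR (m * t) != 0 by rewrite gt_eqF.
rewrite (_ : 1 + (expR (m * t))^-1 = (1 + expR (m * t)) / expR (m * t)).
  rewrite invf_div; apply/(mulIf n0); rewrite mulVf// mulrBl mul1r divfK//; ring.
by rewrite mulrDl mul1r divff ?gt_eqF// addrC.
Qed.

(** From 1 + x <= e^x. This decay in m at fixed t < 0 is what the pointwise limit uses; t > 0
    follows by reflection. *)
Lemma logistic_le m t : 0 < m -> t < 0 -> logistic m t <= (- t)^-1 * m^-1.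
Proof.
move=> m0 t0; rewrite -invfM lef_pV2 ?posrE//; last by rewrite mulr_gt0// oppr_gt0.
have := expR_ge1Dx (- (m * t)); rewrite mulNr mulrC; lra.
Qed.

Lemma logistic0 m : logistic m 0 = 1 / 2.
Proof. by rewrite /logistic mulr0 oppr0 expR0; field. Qed.

(** Limit of the logistic functions as m grows. The value 1/2 at 0 is the one they all take there,
    so that convergence holds at every point. *)
Definition half_sign t : R := if 0 < t then 1 else if t == 0 then 1 / 2 else 0.

(* The pointwise limit of [soft_indic m k] as m tends to infinity; it equals
   1 / 2 on {|t| = k}. *)
Definition indic_gt k t : R := half_sign (t - k) + half_sign (- t - k).

(** Soft thresholding: sgn(t) (|t| - k)_+ when k >= 0. *)
Definition trunc k t : R := Num.max (t - k) 0 - Num.max (- t - k) 0.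

Lemma cvg_logistic t : logistic j.+1%:R t @[j --> \oo] --> half_sign t.
Proof.
wlog t0 : t / t < 0.
  move=> H; rewrite /half_sign; case: ltgtP => // [t0|t0|<-].
  - rewrite (_ : (fun _ => _) = fun j => 1 - logistic j.+1%:R (- t)); last first.
      by apply/funext => j; rewrite logisticN opprB addrC subrK.
    rewrite -[X in _ --> X]subr0; apply: cvgB; first exact: cvg_cst.
    have := H (- t); rewrite oppr_lt0 => /(_ t0).
    by rewrite /half_sign oppr_gt0 (lt_gtF t0) oppr_eq0 gt_eqF.
  - have := H t t0.
    by rewrite /half_sign (lt_gtF t0) lt_eqF.
  - by under eq_fun do rewrite logistic0; exact: cvg_cst.
rewrite /half_sign (lt_gtF t0) lt_eqF//.
apply: (@squeeze_cvgr _ _ _ _ (fun=> 0) (fun j => (- t)^-1 * j.+1%:R^-1)).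
- by near=> j; rewrite ltW ?logistic_gt0//= logistic_le.
- exact: cvg_cst.
- rewrite -[X in _ --> X](mulr0 (- t)^-1).
  by apply: cvgMr; exact: cvg_harmonic.
Unshelve. all: by end_near. Qed.

Lemma cvg_soft_indic k t : soft_indic j.+1%:R k t @[j --> \oo] --> indic_gt k t.
Proof. by apply: cvgD; exact: cvg_logistic. Qed.

Lemma half_sign_bounds t : 0 <= half_sign t <= 1.
Proof. by rewrite /half_sign; case: ifP => _; [|case: ifP => _]; lra. Qed.

Lemma indic_gt_bounds k t : 0 < k -> 0 <= indic_gt k t <= 1.
Proof.
move=> k0; rewrite /indic_gt.
have := half_sign_bounds (t - k); have := half_sign_bounds (- t - k).
have [t0|t0] := leP 0 t.
  have -> : half_sign (- t - k) = 0; last by lra.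
  by rewrite /half_sign ifF; [rewrite ifF//; apply/eqP|apply/negP]; lra.
have -> : half_sign (t - k) = 0; last by lra.
by rewrite /half_sign ifF; [rewrite ifF//; apply/eqP|apply/negP]; lra.
Qed.

Lemma softplus_bounds m t : 0 < m ->
  Num.max t 0 <= softplus m t <= Num.max t 0 + ln 2 / m.
Proof.
move=> m0; rewrite ler_pdivlMr// ler_pdivrMr// mulrDl divfK ?gt_eqF//.
have e0 : 0 < expR (m * t) by exact: expR_gt0.
have [t0|t0] := leP t 0; rewrite ?mul0r ?add0r.
  apply/andP; split; first by rewrite ln_ge0// lerDl ltW.
  rewrite (@ler_ln R) ?posrE ?addr_gt0//.
  have : expR (m * t) <= 1 by rewrite -expR0 ler_expR pmulr_rle0.
  by lra.
have : 1 <= expR (m * t) by rewrite -expR0 ler_expR mulr_ge0 ?ltW.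
move=> e1; rewrite -{1 2}(expRK (t * m)) -lnM ?posrE ?expR_gt0// (mulrC t).
by rewrite !ler_ln ?posrE ?mulr_gt0 ?addr_gt0//; lra.
Qed.

Lemma soft_trunc_dist m k t : 0 < m ->
  `|soft_trunc m k t - trunc k t| <= ln 2 * m^-1.
Proof.
move=> m0; have := softplus_bounds (t - k) m0; have := softplus_bounds (- t - k) m0.
by rewrite /soft_trunc /trunc ler_norml; lra.
Qed.

Lemma cvg_soft_trunc k t : soft_trunc j.+1%:R k t @[j --> \oo] --> trunc k t.
Proof.
apply/cvgrPdist_le => /= e e0; near=> j.
rewrite distrC; apply: (le_trans (soft_trunc_dist _ _ _)) => //.
near: j; have H : ln 2 * j.+1%:R^-1 @[j --> \oo] --> (0 : R).
  by rewrite -[X in _ --> X](mulr0 (ln 2)); apply: cvgMr; exact: cvg_harmonic.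
by apply: (cvgr_le _ H).
Unshelve. all: by end_near. Qed.

Lemma trunc_norm k t : 0 <= k -> `|trunc k t| = Num.max (`|t| - k) 0.
Proof.
move=> k0; rewrite /trunc; have [t0|t0] := leP 0 t.
  rewrite [Num.max (- t - k) 0]max_r; last by lra.
  by rewrite subr0 (ger0_norm t0) ger0_norm// le_max lexx orbT.
rewrite [Num.max (t - k) 0]max_r; last by lra.
by rewrite sub0r normrN (ltr0_norm t0) ger0_norm// le_max lexx orbT.
Qed.

Lemma lipschitz_of_derive (h h' : R -> R) (L : R) :
  (forall t, is_derive t (1 : R) h (h' t)) -> (forall t, `|h' t| <= L) ->
  forall s t, `|h t - h s| <= L * `|t - s|.
Proof.
move=> dh hL s t; wlog st : s t / s <= t.
  move=> H; have /orP[|ts] := le_total s t; first exact: H.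
  by rewrite distrC (distrC t); exact: H.
have ch : {within `[s, t], continuous h}.
  apply: continuous_subspaceT => x; apply: differentiable_continuous.
  by apply/derivable1_diffP; case: (dh x).
have [c _ ->] := MVT_segment st (fun x _ => dh x) ch.
by rewrite normrM ler_wpM2r.
Qed.

Lemma soft_trunc_lipschitz m k s t : m != 0 ->
  `|soft_trunc m k t - soft_trunc m k s| <= 2 * `|t - s|.
Proof.
move=> m0; apply: (lipschitz_of_derive (fun t => is_derive_soft_trunc k t m0)) => x.
by rewrite ger0_norm ?soft_indic_ge0// soft_indic_le2.
Qed.

Lemma logistic_lipschitz m s t : 0 < m ->
  `|logistic m t - logistic m s| <= m * `|t - s|.
Proof.
move=> m0; apply: (lipschitz_of_derive (is_derive_logistic m)) => x.
have := logistic_gt0 m x; have := logistic_lt1 m x => l1 l0.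
rewrite normrM (gtr0_norm m0) -[leRHS]mulr1 ler_wpM2l ?(ltW m0)//.
rewrite normrM !ger0_norm ?subr_ge0 ?(ltW l0) ?(ltW l1)//.
by rewrite mulr_ile1 ?subr_ge0 ?(ltW l0) ?(ltW l1)//; lra.
Qed.

Lemma soft_indic_lipschitz m k s t : 0 < m ->
  `|soft_indic m k t - soft_indic m k s| <= 2 * m * `|t - s|.
Proof.
move=> m0; rewrite /soft_indic.
have H1 := logistic_lipschitz (s - k) (t - k) m0.
have H2 := logistic_lipschitz (- s - k) (- t - k) m0.
have E1 : t - k - (s - k) = t - s by ring.
have E2 : - t - k - (- s - k) = - (t - s) by ring.
rewrite E1 in H1; rewrite E2 normrN in H2.
apply: (@le_trans _ _ (`|logistic m (t - k) - logistic m (s - k)| +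
  `|logistic m (- t - k) - logistic m (- s - k)|)); last by lra.
by rewrite opprD addrACA ler_normD.
Qed.

Lemma continuous_soft_trunc m k : m != 0 -> continuous (soft_trunc m k).
Proof.
move=> m0 t; apply: differentiable_continuous; apply/derivable1_diffP.
by have [] := is_derive_soft_trunc k t m0.
Qed.

Lemma continuous_soft_indic m k : continuous (soft_indic m k).
Proof.
have cl : continuous (logistic m).
  move=> t; apply: differentiable_continuous; apply/derivable1_diffP.
  by have [] := is_derive_logistic m t.
have ch (g : R -> R) : continuous g -> continuous (fun t => logistic m (g t)).
  by move=> cg t; exact: (@continuous_comp R R R g (logistic m) t (cg t) (cl _)).
have c1 : continuous (fun t : R => t - k).
  by move=> t; apply: cvgB; [exact: cvg_id|exact: cvg_cst].
have c2 : continuous (fun t : R => - t - k).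
  by move=> t; apply: cvgB; [apply: cvgN; exact: cvg_id|exact: cvg_cst].
by move=> t; apply: cvgD; [exact: (ch _ c1 t)|exact: (ch _ c2 t)].
Qed.

End soft_truncation.

(** * Power integrals and test functions *)

Section power_integral.
Local Open Scope ereal_scope.
Context d {T : measurableType d} {R : realType} (mu : {measure set T -> \bar R}).
Implicit Types (f g h : T -> R) (p : R).

Lemma dominated_cvg_EFin (f_ : nat -> T -> R) f g :
  (forall j, measurable_fun setT (f_ j)) ->
  (forall x, f_ j x @[j --> \oo] --> f x) ->
  mu.-integrable setT (EFin \o g) -> (forall j x, (`|f_ j x| <= g x)%R) ->
  \int[mu]_x (f_ j x)%:E @[j --> \oo] --> \int[mu]_x (f x)%:E.
Proof.
move=> mf ff ig fg.
apply: (@dominated_cvg _ _ _ mu setT measurableT _ _ (EFin \o g)) => //.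
- by move=> j; exact/measurable_EFinP.
- by move=> x _; apply: cvg_EFin; [exact: nearW|exact: ff].
- by move=> j x _; rewrite lee_fin.
Qed.

Definition powint p f := \int[mu]_x (`|f x| `^ p)%:E.

Lemma powint_ge0 p f : 0 <= powint p f.
Proof. by apply: integral_ge0 => x _; rewrite lee_fin powR_ge0. Qed.

Lemma measurable_powint p f : measurable_fun setT f ->
  measurable_fun setT (fun x => (`|f x| `^ p)%:E).
Proof. by move=> mf; apply/measurable_EFinP; exact: measurable_norm_powR. Qed.

Lemma eq_powint p f g : (forall x, `|f x|%R = `|g x|%R) -> powint p f = powint p g.
Proof. by move=> fg; apply: eq_integral => x _; rewrite fg. Qed.

Lemma le_powint p f g : (0 <= p)%R -> measurable_fun setT f ->
  measurable_fun setT g -> (forall x, (`|f x| <= `|g x|)%R) ->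
  powint p f <= powint p g.
Proof.
move=> p0 mf mg fg; apply: ge0_le_integral => //; do ?exact: measurable_powint.
by move=> x _; rewrite lee_fin ge0_ler_powR// nnegrE.
Qed.

Lemma powintZ p (c : R) f : measurable_fun setT f ->
  powint p (fun x => c * f x)%R = (`|c| `^ p)%:E * powint p f.
Proof.
move=> mf; rewrite /powint -ge0_integralZl_EFin ?powR_ge0//.
- by apply: eq_integral => x _; rewrite normrM powRM.
- exact: measurable_powint.
Qed.

Lemma powint_quasi p f g h : (0 <= p)%R -> measurable_fun setT f ->
  measurable_fun setT g -> measurable_fun setT h ->
  (forall x, (`|h x| <= `|f x| + `|g x|)%R) ->
  powint p h <= (2 `^ p)%:E * (powint p f + powint p g).
Proof.
move=> p0 mf mg mh hfg.
rewrite /powint -ge0_integralD//; do ?exact: measurable_powint.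
rewrite -ge0_integralZl_EFin ?powR_ge0//; last 2 first.
- by move=> x _; rewrite adde_ge0// lee_fin powR_ge0.
- by apply: emeasurable_funD; exact: measurable_powint.
apply: ge0_le_integral => //.
- exact: measurable_powint.
- apply: measurable_funeM; apply: emeasurable_funD; exact: measurable_powint.
move=> x _; rewrite -EFinD -EFinM lee_fin.
apply: le_trans (powRD_le p0 (normr_ge0 _) (normr_ge0 _)).
by rewrite ge0_ler_powR// nnegrE.
Qed.

Lemma powint_integrable p f : measurable_fun setT f -> powint p f < +oo ->
  mu.-integrable setT (fun x => (`|f x| `^ p)%:E).
Proof.
move=> mf fo; apply/integrableP; split; first exact: measurable_powint.
apply: le_lt_trans fo; rewrite le_eqVlt; apply/orP; left; apply/eqP.
by apply: eq_integral => x _; rewrite abse_EFin ger0_norm// powR_ge0.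
Qed.

Lemma powint_dct p (f_ : nat -> T -> R) f g : (0 < p)%R ->
  (forall j, measurable_fun setT (f_ j)) -> measurable_fun setT f ->
  measurable_fun setT g ->
  (forall x, f_ j x @[j --> \oo] --> f x) ->
  powint p g < +oo -> (forall j x, (`|f_ j x - f x| <= `|g x|)%R) ->
  powint p (fun x => f_ j x - f x)%R @[j --> \oo] --> 0.
Proof.
move=> p0 mf_ mf mg ff go fg.
rewrite -[X in _ --> X](integral0 mu setT).
apply: (@dominated_cvg_EFin (fun j x => `|f_ j x - f x| `^ p)%R (cst 0%R)
  (fun x => `|g x| `^ p)%R).
- by move=> j; apply: measurable_norm_powR; exact: measurable_funB.
- move=> x; rewrite /= -(powR0 (lt0r_neq0 p0)); apply: powR_nneg_cvg => //.
  rewrite -[X in _ --> X](normr0 R); apply: cvg_norm.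
  by apply/subr_cvg0.
- exact: powint_integrable.
- move=> j x; rewrite ger0_norm ?powR_ge0// ge0_ler_powR ?nnegrE ?(ltW p0)//.
Qed.

Lemma cvge0_ex (u : nat -> \bar R) (e : R) : (forall j, 0 <= u j) ->
  u j @[j --> \oo] --> 0 -> (0 < e)%R -> exists j, u j < e%:E.
Proof.
move=> u0 uc e0; have /fine_cvgP[[N1 _ fu] cu] := uc.
have /cvgr0Pnorm_lt/(_ _ e0)[N2 _ /(_ (N1 + N2)%N (leq_addl _ _))] := cu.
rewrite /= ger0_norm ?fine_ge0// -lte_fin fineK; first by exists (N1 + N2)%N.
by apply: fu => /=; exact: leq_addr.
Qed.

Lemma sume_const N (c : \bar R) : 0 <= c -> (\sum_(i < N) c = N%:R%:E * c)%E.
Proof.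
move=> c0; elim: N => [|N IH]; first by rewrite big_ord0 mul0e.
rewrite big_ord_recr/= IH -[X in _ + X]mul1e -ge0_muleDl ?lee_fin//.
by rewrite -EFinD natr1.
Qed.

End power_integral.

(** * Test functions and their difference quotients *)

Section test_functions.
Context {R : realType} {n : nat}.
Implicit Types (Omega : set 'rV[R]_n) (phi psi : 'rV[R]_n -> R).
Local Notation e_ i := (delta_mx 0 i : 'rV[R]_n).
Local Notation mu := (rV_lebesgue_measure R n).

Lemma derive_grad phi x (v : 'rV[R]_n) : differentiable phi x ->
  'D_v phi x = dotrV (grad phi x) v.
Proof.
move=> df; rewrite deriveE// {1}(row_sum_delta v) linear_sum/=.
apply: eq_bigr => i _; rewrite linearZ/= mxE mulrC deriveE//.
Qed.

Lemma test_differentiable Omega phi x : test_function Omega phi -> differentiable phi x.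
Proof. by move=> [/smooth_differentiable]. Qed.

Lemma test_continuous Omega phi : test_function Omega phi -> continuous phi.
Proof.
by move=> tf x; apply: differentiable_continuous; exact: test_differentiable tf.
Qed.

Lemma test_measurable Omega phi : test_function Omega phi -> measurable_fun setT phi.
Proof. by move=> tf; apply: continuous_rV_measurable; exact: test_continuous tf. Qed.

Lemma derive_support0 (K : set 'rV[R]_n) phi (v : 'rV[R]_n) x : compact K ->
  (forall x, ~ K x -> phi x = 0) -> ~ K x -> 'D_v phi x = 0.
Proof.
move=> cK phi0 Kx; have clK : closed K by apply: compact_closed => //; exact: norm_hausdorff.
rewrite (@near_eq_derive _ _ _ _ (cst 0)) ?derive_cst//.
have oK : open (~` K) by exact: closed_openC.
near=> y; apply: phi0; near: y; exact: (open_nbhs_nbhs (conj oK Kx)).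
Unshelve. all: by end_near. Qed.

Lemma test_partial Omega phi i : test_function Omega phi ->
  test_function Omega (fun x => 'D_(e_ i) phi x).
Proof.
move=> [sphi [K [cK KO phi0]]]; split; first exact: smooth_partial.
by exists K; split => // x; exact: derive_support0.
Qed.

Lemma test_comp Omega phi (h : R -> R) : test_function Omega phi -> h 0 = 0 ->
  smooth (fun x => h (phi x)) -> test_function Omega (fun x => h (phi x)).
Proof.
move=> [_ [K [cK KO phi0]]] h0 sh; split => //; exists K; split => // x Kx.
by rewrite phi0.
Qed.

Lemma testM Omega phi psi : test_function Omega phi -> smooth psi ->
  test_function Omega (fun x => phi x * psi x).
Proof.
move=> [sphi [K [cK KO phi0]]] spsi; split; first exact: smoothM.
by exists K; split => // x Kx; rewrite phi0// mul0r.
Qed.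

Lemma testZ Omega phi (c : R) : test_function Omega phi ->
  test_function Omega (fun x => c * phi x).
Proof.
move=> tf; rewrite (_ : (fun _ => _) = fun x => phi x * c).
  by apply: testM => //; exact: smooth_cst.
by apply/funext => x; rewrite mulrC.
Qed.

Lemma testD Omega phi psi : test_function Omega phi -> test_function Omega psi ->
  test_function Omega (fun x => phi x + psi x).
Proof.
move=> [sphi [K [cK KO phi0]]] [spsi [L [cL LO psi0]]]; split; first exact: smoothD.
exists (K `|` L); split; first exact: compactU.
  by rewrite subUset.
by move=> x /not_orP[Kx Lx]; rewrite phi0// psi0// addr0.
Qed.

Lemma testB Omega phi psi : test_function Omega phi -> test_function Omega psi ->
  test_function Omega (fun x => phi x - psi x).
Proof.
move=> tphi tpsi; rewrite (_ : (fun _ => _) = fun x => phi x + -1 * psi x).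
  by apply: testD => //; exact: testZ.
by apply/funext => x; rewrite mulN1r.
Qed.

Lemma gradD phi psi x : differentiable phi x -> differentiable psi x ->
  grad (fun y => phi y + psi y) x = grad phi x + grad psi x.
Proof.
by move=> df dg; apply/rowP => i; rewrite !mxE deriveD//; exact: diff_derivable.
Qed.

Lemma gradZ (c : R) phi x : differentiable phi x ->
  grad (fun y => c * phi y) x = c *: grad phi x.
Proof.
move=> df; apply/rowP => i; rewrite !mxE.
rewrite (_ : (fun _ => _) = c \*: phi)// deriveZ//; exact: diff_derivable.
Qed.

Lemma gradB phi psi x : differentiable phi x -> differentiable psi x ->
  grad (fun y => phi y - psi y) x = grad phi x - grad psi x.
Proof.
by move=> df dg; apply/rowP => i; rewrite !mxE deriveB//; exact: diff_derivable.
Qed.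

Lemma grad_comp phi (h h' : R -> R) x : differentiable phi x ->
  (forall t, is_derive t (1 : R) h (h' t)) ->
  grad (fun y => h (phi y)) x = h' (phi x) *: grad phi x.
Proof.
move=> df dh; apply/rowP => i; rewrite !mxE.
by have [_ ->] := is_derive_comp_line (e_ i) (dh (phi x)) df.
Qed.

Lemma test_grad_measurable Omega phi : test_function Omega phi ->
  measurable_fun setT (grad phi).
Proof.
move=> tf; apply: measurable_funrV => i.
rewrite (_ : (fun _ => _) = fun x => 'D_(e_ i) phi x).
  exact: test_measurable (test_partial i tf).
by apply/funext => x; rewrite mxE.
Qed.

Lemma test_outside Omega phi x : test_function Omega phi -> ~ Omega x -> phi x = 0.
Proof. by move=> [_ [K [_ KO phi0]]] Ox; apply: phi0 => /KO. Qed.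

Lemma grad_outside Omega phi x : test_function Omega phi -> ~ Omega x -> grad phi x = 0.
Proof.
move=> tf Ox; apply/rowP => i; rewrite !mxE.
exact: test_outside (test_partial i tf) Ox.
Qed.

Lemma test_bounded Omega phi : test_function Omega phi ->
  exists2 M, 0 <= M & forall x, `|phi x| <= M.
Proof.
move=> tf; have [_ [K [cK KO phi0]]] := tf.
have [K0|K0] := pselect (K !=set0); last first.
  by exists 0 => // x; rewrite phi0 ?normr0// => Kx; apply: K0; exists x.
have [c _ Hc] := @EVT_max_rV R n (fun x => `|phi x|) K K0 cK
  (continuous_subspaceT (fun x => continuous_comp (test_continuous tf (x:=x)) (@norm_continuous _ _ _))).
exists `|phi c| => // x; have [Kx|Kx] := pselect (K x); first by apply: Hc; rewrite inE.
by rewrite phi0// normr0.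
Qed.

Lemma test_grad_bounded Omega phi : test_function Omega phi ->
  exists2 M, 0 <= M & forall x, enorm (grad phi x) <= M.
Proof.
move=> tf.
have H i : {M : R | forall x, `|'D_(e_ i) phi x| <= M}.
  by apply: cid; have [M _ HM] := test_bounded (test_partial i tf); exists M.
exists (\sum_i `|projT1 (H i)|); first exact: sumr_ge0.
move=> x; apply: (le_trans (enorm_le_sum _)); apply: ler_sum => i _.
rewrite mxE; apply: le_trans (ler_norm _); exact: (projT2 (H i)).
Qed.

Lemma test_support_bounded Omega phi : test_function Omega phi ->
  exists2 B, 0 <= B & forall x, B < `|x| -> phi x = 0 /\ grad phi x = 0.
Proof.
move=> [_ [K [cK KO phi0]]]; have [M [Mr HM]] := compact_bounded cK.
exists (Num.max 0 (M + 1)); first by rewrite le_max lexx.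
move=> x Bx; have Kx : ~ K x.
  move=> Kx; have := HM (M + 1); rewrite ltrDl ltr01 => /(_ isT x Kx) /=.
  rewrite leNgt => /negP; apply; apply: le_lt_trans Bx.
  by rewrite le_max lexx orbT.
split; first exact: phi0.
by apply/rowP => i; rewrite !mxE; exact: derive_support0 cK phi0 Kx.
Qed.

Lemma rV_cball_box (B : R) : [set x : 'rV[R]_n | `|x| <= B] `<=`
  [set x | forall i, (const_mx (- B) : 'rV[R]_n) 0 i <= x 0 i <
      (const_mx (- B) : 'rV[R]_n) 0 i + (2 * B + 1)].
Proof.
move=> x /= xB i; rewrite !mxE; have := le_trans (le_coord_norm x i) xB.
by rewrite ler_norml => /andP[]; lra.
Qed.

Lemma measurable_rV_cball (B : R) : measurable [set x : 'rV[R]_n | `|x| <= B].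
Proof.
rewrite (_ : [set _ | _] = ~` (Num.norm @^-1` `]B, +oo[%classic)); last first.
  by apply/seteqP; split => x /=; rewrite in_itv/= andbT leNgt => /negP.
apply: measurableC; apply: open_rV_measurable; apply: open_comp.
  by move=> x _; exact: norm_continuous.
exact: rray_open.
Qed.

Lemma rV_cball_lty (B : R) : (mu [set x : 'rV[R]_n | (`|x| <= B)%R] < +oo)%E.
Proof.
have [B0|B0] := leP 0 B; last first.
  rewrite (_ : [set _ | _] = set0) ?measure0//.
  apply/seteqP; split => // x /= xB.
  by have := le_trans (normr_ge0 x) xB; rewrite leNgt B0.
apply: le_lt_trans (le_measure mu _ _ (@rV_cball_box B)) _.
- by rewrite inE; exact: measurable_rV_cball.
- by rewrite inE; exact: measurable_rV_box.
rewrite [ltLHS](_ : _ = ((2 * B + 1) ^+ n)%:E) ?ltry//.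
by apply: rV_lebesgue_box; lra.
Qed.

Lemma bounded_rV_lty (D : set 'rV[R]_n) : bounded_set D -> measurable D -> (mu D < +oo)%E.
Proof.
move=> [B0 [_ HB]] mD.
apply: le_lt_trans (rV_cball_lty (B0 + 1)); apply: le_measure; rewrite ?inE//.
  exact: measurable_rV_cball.
by move=> x Dx /=; apply: HB Dx; rewrite ltrDl.
Qed.

Lemma bounded_support_integrable (f : 'rV[R]_n -> R) (M B : R) :
  measurable_fun setT f -> (forall x, `|f x| <= M) ->
  (forall x, B < `|x| -> f x = 0) -> mu.-integrable setT (EFin \o f).
Proof.
move=> mf fM fB.
pose A := [set x : 'rV[R]_n | `|x| <= B].
have mA : measurable A by exact: measurable_rV_cball.
have : mu.-integrable A (EFin \o f).
  apply: measurable_bounded_integrable => //; first exact: rV_cball_lty.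
    exact: measurable_funS mf.
  exists M; split; first exact: num_real.
  by move=> N MN x _ /=; exact: le_trans (fM x) (ltW MN).
move=> /(integrable_mkcond _ mA).1; apply: eq_integrable => // x _.
rewrite patchE; case: ifPn => // /negP; rewrite inE => xA /=.
by rewrite fB// ltNge; apply/negP.
Qed.

Lemma test_integrable Omega phi : test_function Omega phi ->
  mu.-integrable setT (EFin \o phi).
Proof.
move=> tf; have [M _ HM] := test_bounded tf; have [B _ HB] := test_support_bounded tf.
apply: (bounded_support_integrable (test_measurable tf) HM (B := B)).
by move=> x /HB[].
Qed.

Lemma test_powint_lty Omega phi p : 0 < p -> test_function Omega phi ->
  (powint mu p phi < +oo)%E.
Proof.
move=> p0 tf; have [M M0 HM] := test_bounded tf.
have [B _ HB] := test_support_bounded tf.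
have /integrableP[_] : mu.-integrable setT (EFin \o (fun x => `|phi x| `^ p)).
  apply: (bounded_support_integrable (M := M `^ p) (B := B)).
  - by apply: measurable_norm_powR; exact: test_measurable tf.
  - move=> x; rewrite ger0_norm ?powR_ge0// ge0_ler_powR ?nnegrE ?(ltW p0)//.
  - by move=> x /HB[-> _]; rewrite normr0 powR0// gt_eqF.
apply: le_lt_trans; rewrite le_eqVlt; apply/orP; left; apply/eqP.
by apply: eq_integral => x _ /=; rewrite [`|_ `^ _|]ger0_norm// powR_ge0.
Qed.

Lemma test_grad_powint_lty Omega phi p : 0 < p -> test_function Omega phi ->
  (powint mu p (fun x => enorm (grad phi x)) < +oo)%E.
Proof.
move=> p0 tf; have [M M0 HM] := test_grad_bounded tf.
have [B _ HB] := test_support_bounded tf.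
have /integrableP[_] : mu.-integrable setT (EFin \o (fun x => `|enorm (grad phi x)| `^ p)).
  apply: (bounded_support_integrable (M := M `^ p) (B := B)).
  - by apply: measurable_norm_powR; apply: measurable_enorm; exact: test_grad_measurable tf.
  - move=> x; rewrite ger0_norm ?powR_ge0// ge0_ler_powR ?nnegrE ?(ltW p0)//.
    by rewrite ger0_norm ?enorm_ge0.
  - by move=> x /HB[_ ->]; rewrite enorm0 normr0 powR0// gt_eqF.
apply: le_lt_trans; rewrite le_eqVlt; apply/orP; left; apply/eqP.
by apply: eq_integral => x _ /=; rewrite [`|_ `^ _|]ger0_norm// powR_ge0.
Qed.

Lemma test_line_derive Omega phi x (v : 'rV[R]_n) (t : R) :
  test_function Omega phi ->
  is_derive t (1 : R) (fun s : R => phi (s *: v + x)) ('D_v phi (t *: v + x)).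
Proof.
move=> tf; have df := test_differentiable (t *: v + x) tf.
pose l := fun s : R => s *: v + x.
have dl : is_derive t (1 : R) l v.
  rewrite -[X in is_derive _ _ _ X]addr0; apply: is_deriveD.
  rewrite -[X in is_derive _ _ _ X]scale1r.
  have dz : is_diff t ( *:%R^~ v : R -> 'rV[R]_n) ( *:%R^~ v) by exact: is_diff_scalel.
  apply: DeriveDef; first by apply/derivable1_diffP; exact: ex_diff.
  by rewrite deriveE ?diff_val//; exact: ex_diff.
have dl' : differentiable l t by apply/derivable1_diffP; case: dl.
have dc : differentiable (phi \o l) t by exact: differentiable_comp.
apply: DeriveDef; first exact/derivable1_diffP.
by rewrite (deriveE _ dc) diff_comp//= -(deriveE _ dl') (derive_val (is_derive := dl)) -deriveE.
Qed.

Lemma test_lipschitz Omega phi : test_function Omega phi ->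
  exists2 M, 0 <= M & forall x (h : 'rV[R]_n), `|phi (h + x) - phi x| <= M * enorm h.
Proof.
move=> tf; have [M M0 HM] := test_grad_bounded tf; exists M => // x h.
have := @lipschitz_of_derive R (fun s : R => phi (s *: h + x))
  (fun s => 'D_h phi (s *: h + x)) (M * enorm h)
  (fun t => test_line_derive x h t tf).
move=> /(_ _ 0 1); rewrite scale1r scale0r add0r subr0 normr1 mulr1; apply => t.
rewrite derive_grad; last exact: test_differentiable tf.
apply: le_trans (CauchySchwarz_dotrV _ _) _.
by rewrite ler_wpM2r ?enorm_ge0.
Qed.

Definition diff_quot phi (h : 'rV[R]_n) (j : nat) x : R :=
  j.+1%:R * (phi (x + j.+1%:R^-1 *: h) - phi x).

Lemma cvg_diff_quot Omega phi h x : test_function Omega phi ->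
  diff_quot phi h j x @[j --> \oo] --> 'D_h phi x.
Proof.
move=> tf; have dfh : derivable phi x h by apply: diff_derivable; exact: test_differentiable tf.
have c0 : (fun j : nat => j.+1%:R^-1 : R) @ \oo --> (0 : R)^'.
  move=> A [e /= e0 eA]; have := near_infty_natSinv_lt (PosNum e0).
  apply: filterS => j /= je; apply: eA => /=; last by rewrite invr_neq0.
  by rewrite sub0r normrN ger0_norm.
have H := cvg_comp _ _ c0 dfh.
rewrite (_ : (fun j => _) = (fun j : nat => (j.+1%:R^-1 : R)^-1 *:
    (phi (j.+1%:R^-1 *: h + x) - phi x))); first exact: H.
by apply/funext => j; rewrite /diff_quot invrK (addrC x).
Qed.

Lemma diff_quot_measurable Omega phi h j : test_function Omega phi ->
  measurable_fun setT (diff_quot phi h j).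
Proof.
move=> tf; apply: measurable_funM => //; apply: measurable_funB.
  by apply: (measurableT_comp (test_measurable tf)); exact: measurable_rV_translate.
exact: test_measurable tf.
Qed.

(** A test function is Lipschitz, which bounds all quotients at once; since the steps are at most
    |h|, their supports lie in one ball enlarged by |h|. *)
Lemma diff_quot_dominated Omega phi h : test_function Omega phi ->
  exists2 B, True & exists2 M, 0 <= M &
    forall j x, `|diff_quot phi h j x| <= M * \1_[set x : 'rV[R]_n | `|x| <= B] x.
Proof.
move=> tf; have [M M0 HM] := test_lipschitz tf.
have [B B0 HB] := test_support_bounded tf.
exists (B + `|h|) => //; exists (M * enorm h); first by rewrite mulr_ge0 ?enorm_ge0.
move=> j x; rewrite indicE; case: (boolP (x \in _)) => [_|].
  rewrite mulr1 /diff_quot normrM ger0_norm// (addrC x).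
  apply: (@le_trans _ _ (j.+1%:R * (M * enorm (j.+1%:R^-1 *: h)))).
    by rewrite ler_wpM2l.
  rewrite enormZ ger0_norm ?invr_ge0// mulrCA (mulrA j.+1%:R) divff ?mul1r//.
rewrite notin_setE/= => /negP; rewrite -ltNge => xB; rewrite mulr0.
rewrite /diff_quot (HB x _).1; last by apply: le_lt_trans xB; rewrite lerDl.
rewrite (HB (x + _) _).1 ?subr0 ?mulr0 ?normr0//.
have : `|x| <= `|x + j.+1%:R^-1 *: h| + `|h|.
  rewrite -[X in `|X| <= _](addrK (j.+1%:R^-1 *: h)).
  apply: (le_trans (ler_normB _ _)); rewrite lerD2l normrZ ger0_norm ?invr_ge0//.
  by rewrite ler_piMl// invf_le1// ler1n.
by lra.
Qed.

Lemma integrable_indic_cball (M B : R) :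
  mu.-integrable setT (EFin \o (fun x : 'rV[R]_n => M * \1_[set x : 'rV[R]_n | `|x| <= B] x)).
Proof.
have mI := measurable_indic (D := setT) (measurable_rV_cball B).
apply: (@bounded_support_integrable _ `|M| B).
- by apply: measurable_funM => //; exact: mI.
- move=> x; rewrite normrM ler_piMr// indicE.
  by case: (_ \in _); rewrite ?normr1 ?normr0.
- move=> x Bx; rewrite indicE memNset ?mulr0//=.
  by apply/negP; rewrite -ltNge.
Qed.

(** Each difference quotient has integral 0 by translation invariance of the measure, and dominated
    convergence carries this to the derivative. Applied to a product, this becomes integration by
    parts. *)
Lemma test_partial_integral0 Omega phi i : test_function Omega phi ->
  \int[mu]_x 'D_(e_ i) phi x = 0.
Proof.
move=> tf; have [B _ [M M0 HM]] := diff_quot_dominated (e_ i) tf.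
have H := dominated_cvg_EFin (fun j => diff_quot_measurable (e_ i) j tf)
  (fun x => cvg_diff_quot (h := e_ i) (x := x) tf) (integrable_indic_cball M B) HM.
have E j : (\int[mu]_x (diff_quot phi (e_ i) j x)%:E = 0)%E.
  have itr : mu.-integrable setT (fun x => (phi (x + j.+1%:R^-1 *: e_ i))%:E).
    have /integrableP[mf fo] := test_integrable tf.
    apply/integrableP; split.
      apply/measurable_EFinP; apply: (measurableT_comp (test_measurable tf)).
      exact: measurable_rV_translate.
    rewrite (ge0_integral_rVD _ (f := fun x => `|(phi x)%:E|%E))//.
    by apply: measurableT_comp.
  transitivity (\int[mu]_x (j.+1%:R%:E * ((phi (x + j.+1%:R^-1 *: e_ i))%:E - (phi x)%:E)))%E.
    by apply: eq_integral => x _; rewrite /diff_quot EFinM EFinB.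
  rewrite integralZl//; last first.
    apply: (integrableB measurableT) => //; exact: test_integrable tf.
  rewrite integralB//; last exact: test_integrable tf.
  rewrite (integral_rVD _ (f := fun x => (phi x)%:E)); last first.
    by apply/measurable_EFinP; exact: test_measurable tf.
  rewrite subee ?mule0//; apply: integrable_fin_num => //; exact: test_integrable tf.
rewrite /Rintegral; move: H; under eq_fun do rewrite E.
by move=> /cvg_lim <-//; rewrite lim_cst.
Qed.

Lemma test_ibp Omega phi psi i : test_function Omega phi -> test_function Omega psi ->
  \int[mu]_x (phi x * 'D_(e_ i) psi x) = - \int[mu]_x ('D_(e_ i) phi x * psi x).
Proof.
move=> tphi tpsi.
have t1 : test_function Omega (fun x => phi x * 'D_(e_ i) psi x).
  by apply: testM => //; case: (test_partial i tpsi).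
have t2 : test_function Omega (fun x => 'D_(e_ i) phi x * psi x).
  by apply: testM; [exact: test_partial|case: tpsi].
have t3 : test_function Omega (fun x => phi x * psi x).
  by apply: testM => //; case: tpsi.
apply/eqP; rewrite -addr_eq0 -RintegralD//; [|exact: test_integrable t1|exact: test_integrable t2].
rewrite -(test_partial_integral0 i t3); apply/eqP; apply: eq_Rintegral => x _.
rewrite deriveM; [|apply: diff_derivable; exact: test_differentiable tphi
  |apply: diff_derivable; exact: test_differentiable tpsi].
by congr (_ + _); rewrite mulrC.
Qed.

End test_functions.

(** * The translation estimate *)

Section translation_estimate.
Context {R : realType} {n : nat} (p : R) (p1 : 1 < p).
Local Notation mu := (rV_lebesgue_measure R n).
Implicit Types (phi : 'rV[R]_n -> R) (h : 'rV[R]_n).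

Let p0 : 0 < p. Proof. exact: lt_trans ltr01 p1. Qed.

Lemma powR_tangent_le (x y : R) : 0 <= x -> 0 <= y ->
  x `^ p + p * x `^ (p - 1) * (y - x) <= y `^ p.
Proof.
move=> x0 y0; have [->|xy] := eqVneq x y; first by rewrite subrr mulr0 addr0.
have [->|xn0] := eqVneq x 0.
  by rewrite powR0 ?gt_eqF// powR0 ?mulr0 ?mul0r ?add0r ?powR_ge0// gt_eqF// subr_gt0.
by apply/ltW/powR_tangent_lt => //; rewrite lt_neqAle eq_sym xn0.
Qed.

(** Jensen with equal weights: sum the tangent inequalities at the mean, where the linear terms add
    up to 0. *)
Lemma powR_sum_le N (b : 'I_N -> R) : (0 < N)%N -> (forall j, 0 <= b j) ->
  (\sum_j b j) `^ p <= N%:R `^ (p - 1) * \sum_j b j `^ p.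
Proof.
move=> N0 b0; have N0' : 0 < N%:R :> R by rewrite ltr0n.
pose m := (\sum_j b j) / N%:R.
have m0 : 0 <= m by rewrite divr_ge0 ?sumr_ge0.
have sE : \sum_j b j = N%:R * m by rewrite mulrC divfK ?gt_eqF.
have H : N%:R * m `^ p <= \sum_j b j `^ p.
  apply: (@le_trans _ _ (\sum_j (m `^ p + p * m `^ (p - 1) * (b j - m)))).
    rewrite big_split/= sumr_const card_ord -mulr_sumr sumrB sumr_const card_ord sE.
    by rewrite !mulr_natl subrr mulr0 addr0.
  by apply: ler_sum => j _; exact: powR_tangent_le.
rewrite sE powRM ?ler0n//.
apply: (@le_trans _ _ (N%:R `^ (p - 1) * (N%:R * m `^ p))); last by rewrite ler_wpM2l ?powR_ge0.
by rewrite mulrA (mulrC _ N%:R) mulr_powRB1 ?ler0n.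
Qed.

(** The translation by h is cut into N translations by h/N. Their increments have equal norms, so
    the left-hand side is at most the norm of the difference quotient of step 1/N, which tends to
    the norm of the directional derivative. *)
Lemma test_translate_derive Omega phi h : test_function Omega phi ->
  (powint mu p (fun x => phi (x + h)%R - phi x)%R <=
   powint mu p (fun x => 'D_h phi x))%E.
Proof.
move=> tf; have mphi := test_measurable tf.
have mtr (v : 'rV[R]_n) : measurable_fun setT (fun x : 'rV[R]_n => phi (x + v)).
  by apply: (measurableT_comp mphi); exact: measurable_rV_translate.
have step j : (powint mu p (fun x => phi (x + h)%R - phi x)%R <=
               powint mu p (diff_quot phi h j))%E.
  set N := j.+1; pose v := N%:R^-1 *: h.
  pose b (i : 'I_N) x := `|phi (x + i.+1%:R *: v) - phi (x + i%:R *: v)|.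
  have mb i : measurable_fun setT (b i).
    by apply: measurableT_comp => //; apply: measurable_funB.
  (* Translation invariance: the i-th increment is the first one shifted by i v. *)
  have E i : (\int[mu]_x (b i x `^ p)%:E = powint mu p (fun x => phi (x + v)%R - phi x)%R)%E.
    pose f (x : 'rV[R]_n) := (`|phi (x + v) - phi x| `^ p)%:E.
    transitivity (\int[mu]_x f (x + i%:R *: v)%R)%E.
      apply: eq_integral => x _; rewrite /b /f -addrA.
      by rewrite -natr1 scalerDl scale1r.
    apply: ge0_integral_rVD => [|x]; last by rewrite lee_fin powR_ge0.
    by apply: measurable_powint; apply: measurable_funB.
  apply: (@le_trans _ _ (\int[mu]_x ((N%:R `^ (p - 1))%:E * \sum_(i < N) (b i x `^ p)%:E))%E).
    apply: ge0_le_integral => //.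
    - by apply: measurable_powint; apply: measurable_funB.
    - apply: measurable_funeM; apply: emeasurable_sum => i.
      apply/measurable_EFinP; apply: (measurableT_comp (measurable_powR p)); exact: mb.
    - move=> x _; rewrite sumEFin -EFinM lee_fin.
      apply: le_trans (powR_sum_le (b := b^~ x) _ _) => //; last first.
        by move=> i; exact: normr_ge0.
      apply: ge0_ler_powR; rewrite ?nnegrE ?(ltW p0)//; first by apply: sumr_ge0 => i _; exact: normr_ge0.
      have -> : phi (x + h) - phi x =
          \sum_(i < N) (phi (x + i.+1%:R *: v) - phi (x + i%:R *: v)).
        rewrite -(big_mkord xpredT (fun i => phi (x + i.+1%:R *: v) - phi (x + i%:R *: v))).
        rewrite (telescope_sumr (fun i => phi (x + i%:R *: v)))//.
        by rewrite scale0r addr0 scalerA divff ?scale1r// pnatr_eq0.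
      exact: ler_norm_sum.
  rewrite ge0_integralZl_EFin ?powR_ge0//; last 2 first.
  - by move=> x _; apply: sume_ge0 => i _; rewrite lee_fin powR_ge0.
  - apply: emeasurable_sum => i.
    apply/measurable_EFinP; apply: (measurableT_comp (measurable_powR p)); exact: mb.
  rewrite ge0_integral_sum//; last 2 first.
  - move=> i; apply/measurable_EFinP; apply: (measurableT_comp (measurable_powR p)); exact: mb.
  - by move=> i x _; rewrite lee_fin powR_ge0.
  rewrite (eq_bigr (fun=> powint mu p (fun x => phi (x + v)%R - phi x)%R)) => [|i _]; last exact: E.
  rewrite sume_const ?powint_ge0// muleA -EFinM.
  (* The factor N^(p-1) from Jensen and the N equal summands combine to N^p, the normalization of
     the difference quotient. *)
  rewrite (mulrC (_ `^ _)) mulr_powRB1 ?ler0n// /diff_quot powintZ ?ger0_norm ?ler0n//.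
  by apply: measurable_funB.
have [B _ [M M0 HM]] := diff_quot_dominated h tf.
have H := @dominated_cvg_EFin _ _ _ mu (fun j x => `|diff_quot phi h j x| `^ p)
  (fun x => `|'D_h phi x| `^ p) (fun x : 'rV[R]_n => M `^ p * \1_[set x : 'rV[R]_n | `|x| <= B] x).
have {}H : powint mu p (diff_quot phi h j) @[j --> \oo] --> powint mu p ('D_h phi).
  apply: H.
  - by move=> j; apply: measurable_norm_powR; exact: diff_quot_measurable tf.
  - move=> x; apply: powR_nneg_cvg => //; apply: cvg_norm; exact: cvg_diff_quot tf.
  - exact: integrable_indic_cball.
  - move=> j x; rewrite ger0_norm ?powR_ge0//.
    apply: (@le_trans _ _ ((M * \1_[set x : 'rV[R]_n | `|x| <= B] x) `^ p)).
      by rewrite ge0_ler_powR ?nnegrE ?(ltW p0)// mulr_ge0.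
    rewrite indicE; case: (_ \in _); first by rewrite !mulr1.
    by rewrite !mulr0 powR0// gt_eqF.
rewrite -(cvg_lim _ H)//; apply: lime_ge; first by apply/cvg_ex; eexists; exact: H.
exact: nearW.
Qed.

Lemma test_translate Omega phi h : test_function Omega phi ->
  (powint mu p (fun x => phi (x + h)%R - phi x)%R <=
   (enorm h `^ p)%:E * powint mu p (fun x => enorm (grad phi x)))%E.
Proof.
move=> tf; apply: (le_trans (test_translate_derive h tf)).
have mg := measurable_enorm (test_grad_measurable tf).
rewrite -[enorm h in leRHS](ger0_norm (enorm_ge0 h)) -powintZ//.
apply: le_powint; [exact: ltW|..].
- rewrite (_ : 'D_h phi = fun x => dotrV (grad phi x) h).
    by apply: measurable_dotrV => //; exact: test_grad_measurable tf.
  by apply/funext => x; rewrite derive_grad//; exact: test_differentiable tf.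
- exact: measurable_funM.
- move=> x; rewrite derive_grad; last exact: test_differentiable tf.
  rewrite [leRHS]ger0_norm ?mulr_ge0 ?enorm_ge0// mulrC.
  exact: CauchySchwarz_dotrV.
Qed.

End translation_estimate.

(** * The space W_0^{1,p} *)

Section Lp_norm.
Local Open Scope ereal_scope.
Context d {T : measurableType d} {R : realType} (mu : {measure set T -> \bar R}).
Implicit Types (f g h : T -> R) (p q : R).

Definition Np p f := Lnorm mu p%:E (EFin \o f).

Lemma Np_ge0 p f : 0 <= Np p f.
Proof. exact: Lnorm_ge0. Qed.

Lemma Np_powint p f : Np p f = powint mu p f `^ p^-1.
Proof.
rewrite /Np unlock /powint; congr (_ `^ _); by apply: eq_integral => x _ /=.
Qed.

Lemma powint_Np p f : (0 < p)%R -> powint mu p f = Np p f `^ p.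
Proof.
by move=> p0; rewrite Np_powint -poweRrM mulVf ?gt_eqF// poweRe1// powint_ge0.
Qed.

Lemma eq_Np p f g : (forall x, `|f x|%R = `|g x|%R) -> Np p f = Np p g.
Proof. by move=> fg; rewrite !Np_powint (eq_powint mu p fg). Qed.

Lemma powint_le_Np p f g : (0 < p)%R -> powint mu p f <= powint mu p g -> Np p f <= Np p g.
Proof.
move=> p0 fg; rewrite !Np_powint gt0_ler_poweR ?in_itv/= ?powint_ge0 ?leey//.
by rewrite invr_ge0 ltW.
Qed.

Lemma le_Np p f g : (0 < p)%R -> measurable_fun setT f -> measurable_fun setT g ->
  (forall x, (`|f x| <= `|g x|)%R) -> Np p f <= Np p g.
Proof. by move=> p0 mf mg fg; apply: powint_le_Np => //; exact: le_powint (ltW p0) mf mg fg. Qed.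

Lemma NpD p f g h : (1 <= p)%R -> measurable_fun setT f -> measurable_fun setT g ->
  measurable_fun setT h -> (forall x, (`|h x| <= `|f x| + `|g x|)%R) ->
  Np p h <= Np p f + Np p g.
Proof.
move=> p1 mf mg mh hfg; have p0 : (0 < p)%R by exact: lt_le_trans p1.
have mnf : measurable_fun setT (fun x => `|f x|%R) by exact: measurableT_comp.
have mng : measurable_fun setT (fun x => `|g x|%R) by exact: measurableT_comp.
apply: (@le_trans _ _ (Np p (fun x => `|f x| + `|g x|)%R)).
  apply: le_Np => //; first exact: measurable_funD.
  by move=> x; rewrite [leRHS]ger0_norm// addr_ge0.
rewrite -(@eq_Np p (fun x => `|f x|%R) f) => [|x]; last by rewrite normr_id.
rewrite -(@eq_Np p (fun x => `|g x|%R) g) => [|x]; last by rewrite normr_id.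
exact: minkowski_EFin.
Qed.

Lemma NpZ_le p (c : R) f h : (0 < p)%R -> (0 <= c)%R -> measurable_fun setT f ->
  measurable_fun setT h -> (forall x, (`|h x| <= c * `|f x|)%R) ->
  Np p h <= c%:E * Np p f.
Proof.
move=> p0 c0 mf mh hf.
have -> : c%:E * Np p f = Np p (fun x => c * f x)%R.
  rewrite !Np_powint powintZ// poweRM ?powint_ge0 ?lee_fin ?powR_ge0//.
  by rewrite poweR_EFin -powRrM divff ?gt_eqF// ger0_norm// powRr1.
apply: le_Np => //; first exact: measurable_funM.
by move=> x; rewrite normrM (ger0_norm c0).
Qed.

Lemma Np_lty p f : (0 < p)%R -> powint mu p f < +oo -> Np p f < +oo.
Proof. by move=> p0 fo; rewrite Np_powint; exact: poweR_lty. Qed.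

Lemma powint_lty p f : (0 < p)%R -> Np p f < +oo -> powint mu p f < +oo.
Proof. by move=> p0 fo; rewrite powint_Np//; exact: poweR_lty. Qed.

Lemma powint_lt_Np p f (e : R) : (0 < p)%R -> (0 <= e)%R ->
  powint mu p f < (e `^ p)%:E -> Np p f < e%:E.
Proof.
move=> p0 e0 fe; have fo : powint mu p f < +oo by apply: lt_trans fe _; rewrite ltry.
rewrite Np_powint -(fineK (x := powint mu p f)) ?ge0_fin_numE ?powint_ge0//.
rewrite poweR_EFin lte_fin -[ltRHS](powRr1 e0) -(divff (lt0r_neq0 p0)) powRrM.
apply: gt0_ltr_powR; rewrite ?nnegrE ?powR_ge0 ?invr_gt0 ?fine_ge0 ?powint_ge0//.
by rewrite -lte_fin fineK// ge0_fin_numE ?powint_ge0.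
Qed.

Lemma cvg_powint_Np p (f_ : nat -> T -> R) (e : R) : (0 < p)%R -> (0 < e)%R ->
  powint mu p (f_ j) @[j --> \oo] --> 0 -> exists j, Np p (f_ j) < e%:E.
Proof.
move=> p0 e0 cf.
have [j Hj] := cvge0_ex (fun j => powint_ge0 mu p (f_ j)) cf (powR_gt0 p e0).
by exists j; apply: powint_lt_Np => //; exact: ltW.
Qed.

Lemma hoelder_Np p f g : (1 < p)%R -> measurable_fun setT f -> measurable_fun setT g ->
  \int[mu]_x (`|f x * g x|)%:E <= Np (p / (p - 1)) f * Np p g.
Proof.
move=> p1 mf mg; have p0 : (0 < p)%R by exact: lt_trans p1.
have q0 : (0 < p - 1)%R by rewrite subr_gt0.
have := @hoelder _ _ _ mu f g _ _ mf mg (divr_gt0 p0 q0) p0.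
rewrite invf_div -[X in (_ + X)%R]mul1r -mulrDl subrK divff ?gt_eqF//.
by move=> /(_ erefl); rewrite Lnorm1.
Qed.

Lemma hoelder_integrable p f g : (1 < p)%R -> measurable_fun setT f ->
  measurable_fun setT g -> Np (p / (p - 1)) f < +oo -> Np p g < +oo ->
  mu.-integrable setT (EFin \o (fun x => f x * g x)%R).
Proof.
move=> p1 mf mg fo go; apply/integrableP; split.
  by apply/measurable_EFinP; exact: measurable_funM.
apply: le_lt_trans (hoelder_Np p1 mf mg) _.
by rewrite lte_mul_pinfty ?Np_ge0// ge0_fin_numE// Np_ge0.
Qed.

Lemma hoelder_Rintegral p f g : (1 < p)%R -> measurable_fun setT f ->
  measurable_fun setT g -> Np (p / (p - 1)) f < +oo -> Np p g < +oo ->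
  (`| \int[mu]_x (f x * g x) | <= fine (Np (p / (p - 1)) f) * fine (Np p g))%R.
Proof.
move=> p1 mf mg fo go.
have ifg := hoelder_integrable p1 mf mg fo go.
apply: (le_trans (le_normr_Rintegral measurableT ifg)).
rewrite -lee_fin EFinM !fineK ?ge0_fin_numE ?Np_ge0//; first exact: hoelder_Np.
- apply: le_lt_trans (hoelder_Np p1 mf mg) _.
  by rewrite lte_mul_pinfty ?Np_ge0// ge0_fin_numE// Np_ge0.
- by apply: integral_ge0 => x _; rewrite lee_fin.
Qed.

Lemma Np_conj p f : (1 < p)%R ->
  powint mu (p / (p - 1)) (fun x => `|f x| `^ (p - 1))%R = powint mu p f.
Proof.
move=> p1; apply: eq_integral => x _; rewrite ger0_norm ?powR_ge0//.
rewrite -powRrM; congr (_ `^ _)%:E; field.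
by rewrite subr_eq0 gt_eqF.
Qed.

End Lp_norm.

Section W0.
Context {R : realType} {n : nat} (Omega : set 'rV[R]_n) (p : R) (p1 : 1 < p).
Local Notation mu := (rV_lebesgue_measure R n).
Local Notation N := (Np mu p).
Implicit Types (u v phi : 'rV[R]_n -> R) (G H : 'rV[R]_n -> 'rV[R]_n).

Let p0 : 0 < p. Proof. exact: lt_trans ltr01 p1. Qed.
Let p1' : 1 <= p. Proof. exact: ltW. Qed.

(* W_0^{1,p}(Omega) for functions extended by zero to the whole space, G being
   the extended gradient. *)
Definition W0 u G := [/\ measurable_fun setT u, measurable_fun setT G &
  forall e, 0 < e -> exists phi, [/\ test_function Omega phi,
    (N (fun x => phi x - u x)%R < e%:E)%E &
    (N (fun x => enorm (grad phi x - G x)) < e%:E)%E]].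

Lemma measurable_subrV d (T : measurableType d) (G H : T -> 'rV[R]_n) :
  measurable_fun setT G -> measurable_fun setT H ->
  measurable_fun setT (fun x => G x - H x).
Proof.
move=> mG mH; apply: measurable_funrV => i.
rewrite (_ : (fun _ => _) = fun x => G x 0 i - H x 0 i).
  by apply: measurable_funB; exact: measurable_rV_coordP.
by apply/funext => x; rewrite !mxE.
Qed.

Lemma measurable_scalerV d (T : measurableType d) (c : T -> R) (G : T -> 'rV[R]_n) :
  measurable_fun setT c -> measurable_fun setT G ->
  measurable_fun setT (fun x => c x *: G x).
Proof.
move=> mc mG; apply: measurable_funrV => i.
rewrite (_ : (fun _ => _) = fun x => c x * G x 0 i).
  by apply: measurable_funM => //; exact: measurable_rV_coordP.
by apply/funext => x; rewrite !mxE.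
Qed.

Lemma Np0 : N (fun=> 0) = 0%E.
Proof.
rewrite Np_powint /powint (eq_integral (fun=> 0%E)) => [|x _].
  by rewrite integral0 poweR0r// invr_neq0// gt_eqF.
by rewrite normr0 powR0// gt_eqF.
Qed.

Lemma W0_test phi : test_function Omega phi -> W0 phi (grad phi).
Proof.
move=> tf; split; [exact: test_measurable tf|exact: test_grad_measurable tf|].
move=> e e0; exists phi; split => //.
  rewrite (@eq_Np _ _ _ _ _ _ (fun=> 0)) ?Np0 ?lte_fin// => x.
  by rewrite subrr.
rewrite (@eq_Np _ _ _ _ _ _ (fun=> 0)) ?Np0 ?lte_fin// => x.
by rewrite subrr enorm0.
Qed.

Lemma W0_lty u G : W0 u G ->
  (N u < +oo)%E /\ (N (fun x => enorm (G x)) < +oo)%E.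
Proof.
move=> [mu_ mG /(_ 1 ltr01)[phi [tf u1 G1]]].
have mphi := test_measurable tf; have mg := test_grad_measurable tf.
split.
  apply: (@le_lt_trans _ _ (N phi + N (fun x => phi x - u x)%R)%E).
    apply: NpD => //; first exact: measurable_funB.
    move=> x; rewrite (_ : u x = phi x - (phi x - u x)); last by rewrite opprB addrC subrK.
    by rewrite {2}(_ : phi x - (phi x - u x) = u x) ?ler_normB// opprB addrC subrK.
  apply: lte_add_pinfty; last by rewrite (lt_trans u1)// ltry.
  by apply: Np_lty => //; exact: test_powint_lty tf.
apply: (@le_lt_trans _ _ (N (fun x => enorm (grad phi x)) + N (fun x => enorm (grad phi x - G x)))%E).
  apply: NpD => //; do ?by apply: measurable_enorm; rewrite //; exact: measurable_subrV.
  move=> x; rewrite !ger0_norm ?enorm_ge0//.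
  apply: le_trans (enormB _ _).
  by rewrite opprB addrC subrK.
apply: lte_add_pinfty; last by rewrite (lt_trans G1)// ltry.
by apply: Np_lty => //; exact: test_grad_powint_lty tf.
Qed.

Lemma W0_closed u G : measurable_fun setT u -> measurable_fun setT G ->
  (forall e, 0 < e -> exists v H, [/\ W0 v H, (N (fun x => v x - u x)%R < e%:E)%E &
    (N (fun x => enorm (H x - G x)) < e%:E)%E]) -> W0 u G.
Proof.
move=> mu_ mG HW; split => // e e0.
have e20 : 0 < e / 2 by rewrite divr_gt0.
have [v [H [[mv mH /(_ _ e20)[phi [tf phiv phiH]]] vu HG]]] := HW _ e20.
have mphi := test_measurable tf; have mg := test_grad_measurable tf.
have eE : (e%:E = (e / 2)%:E + (e / 2)%:E)%E by rewrite -EFinD; congr EFin; field.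
exists phi; split => //.
  apply: (@le_lt_trans _ _ (N (fun x => phi x - v x)%R + N (fun x => v x - u x)%R)%E).
    apply: NpD => //; do ?exact: measurable_funB.
    by move=> x; apply: le_trans (ler_normD _ _); rewrite addrA subrK.
  by rewrite eE lteD.
apply: (@le_lt_trans _ _ (N (fun x => enorm (grad phi x - H x)) + N (fun x => enorm (H x - G x)))%E).
  apply: NpD => //; do ?by apply: measurable_enorm; exact: measurable_subrV.
  move=> x; rewrite !ger0_norm ?enorm_ge0//.
  by apply: le_trans (enormD _ _); rewrite addrA subrK.
by rewrite eE lteD.
Qed.

(** Composing an approximating test function with [soft_trunc] gives a test function. In the
    difference of gradients the delicate term is the difference of the two derivatives times G,
    since G is unbounded: it is bounded by the Lipschitz constant where |G| <= j, and by 2 |G|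
    elsewhere, so norm convergence alone suffices. *)
Lemma W0_soft_trunc m k u G : 0 < m -> W0 u G ->
  W0 (fun x => soft_trunc m k (u x)) (fun x => soft_indic m k (u x) *: G x).
Proof.
move=> m0 W; have m0' : m != 0 by rewrite gt_eqF.
have [Nu NG] := W0_lty W; case: W => mu_ mG HW.
have msi : measurable_fun setT (soft_indic m k).
  by apply: continuous_measurable_fun; exact: continuous_soft_indic.
have mst : measurable_fun setT (soft_trunc m k).
  by apply: continuous_measurable_fun; exact: continuous_soft_trunc.
have me : measurable_fun setT (fun x => enorm (G x)) by exact: measurable_enorm.
split; [exact: measurableT_comp|by apply: measurable_scalerV => //; exact: measurableT_comp|].
move=> e e0.
(* The part of |G| above height j has small norm for large j; j is fixed before the accuracy of the
   approximation. *)
pose tail (j : nat) x : R := if j%:R < enorm (G x) then enorm (G x) else 0.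
have mtail j : measurable_fun setT (tail j).
  apply: measurable_fun_ifT => //; apply: measurable_fun_ltr => //.
have [j Hj] : exists j, (N (tail j) < (e / 6)%:E)%E.
  apply: (cvg_powint_Np (f_ := tail)) => //; first by rewrite divr_gt0.
  have := @powint_dct _ _ _ mu p tail (fun=> 0) (fun x => enorm (G x)) p0 mtail.
  move=> /(_ (measurable_cst _) me) H.
  rewrite (_ : (fun j => powint mu p (tail j)) = (fun j => powint mu p (fun x => tail j x - 0))).
    apply: H.
    - move=> x; apply: cvg_near_cst; near=> j; rewrite /tail ifF//.
      apply/negbTE; rewrite -leNgt ltW//; near: j; exact: nbhs_infty_gtr.
    - exact: powint_lty.
    - by move=> j x; rewrite subr0 /tail; case: ifP => // _; rewrite normr0.
  by apply/funext => j; apply: eq_powint => x; rewrite subr0.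
have mj1 : 0 <= m * j%:R by rewrite mulr_ge0// ltW.
have D0 : 0 < 6 * (1 + m * j%:R) by rewrite mulr_gt0// ltr_pwDl.
(* With this accuracy [dl] the errors 2 dl, 2 m j dl and 2 (e / 6) add up to 2 e / 3. *)
have d0 : 0 < e / (6 * (1 + m * j%:R)).
  by rewrite divr_gt0.
set dl := e / _ in d0.
have [phi [tf phiu phiG]] := HW _ d0.
have mphi := test_measurable tf; have mg := test_grad_measurable tf.
have dle : dl <= e / 6.
  rewrite /dl invfM mulrA ler_piMr//; first by rewrite divr_ge0// ltW.
  by rewrite invf_le1 ?lerDl// ltr_pwDl.
have si0 t := soft_indic_ge0 m k t; have si2 t := soft_indic_le2 m k t.
exists (fun x => soft_trunc m k (phi x)); split.
- by apply: test_comp => //; [exact: soft_trunc0|apply: smooth_soft_trunc => //; case: tf].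
- apply: (@le_lt_trans _ _ (2%:E * N (fun x => phi x - u x)%R)%E).
    apply: NpZ_le => //; do ?exact: measurable_funB.
      by apply: measurable_funB; exact: measurableT_comp.
    by move=> x; exact: soft_trunc_lipschitz.
  apply: (@lt_le_trans _ _ (2%:E * dl%:E)%E); first by rewrite lte_pmul2l.
  by rewrite -EFinM lee_fin; lra.
have gE x : grad (fun y => soft_trunc m k (phi y)) x = soft_indic m k (phi x) *: grad phi x.
  apply: grad_comp; first exact: test_differentiable tf.
  by move=> t; exact: is_derive_soft_trunc.
have mf1 : measurable_fun setT (fun x => enorm (grad phi x - G x)).
  by apply: measurable_enorm; exact: measurable_subrV.
have mf2 : measurable_fun setT (fun x => phi x - u x) by exact: measurable_funB.
have mf3 : measurable_fun setT (fun x => 2 * m * j%:R * `|phi x - u x| + 2 * `|tail j x|).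
  by apply: measurable_funD; apply: measurable_funM => //; exact: measurableT_comp.
have mj0 : 0 <= 2 * m * j%:R by rewrite !mulr_ge0// ltW.
apply: (@le_lt_trans _ _ (N (fun x => (2 * enorm (grad phi x - G x))%R) +
  N (fun x => (2 * m * j%:R * `|phi x - u x| + 2 * `|tail j x|)%R))%E).
  apply: NpD => //.
  - exact: measurable_funM.
  - apply: measurable_enorm; apply: measurable_subrV; last first.
      by apply: measurable_scalerV => //; exact: measurableT_comp.
    rewrite (_ : grad _ = fun x => soft_indic m k (phi x) *: grad phi x).
      by apply: measurable_scalerV => //; exact: measurableT_comp.
    by apply/funext => x; exact: gE.
  move=> x; rewrite gE (_ : _ - _ = soft_indic m k (phi x) *: (grad phi x - G x) +
    (soft_indic m k (phi x) - soft_indic m k (u x)) *: G x); last first.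
    by rewrite scalerBr scalerBl addrA subrK.
  rewrite [leLHS]ger0_norm ?enorm_ge0// [X in _ <= X + _]ger0_norm; last first.
    by apply: mulr_ge0 => //; exact: enorm_ge0.
  rewrite [X in _ <= _ + X]ger0_norm; last by apply: addr_ge0; apply: mulr_ge0.
  apply: (le_trans (enormD _ _)); rewrite !enormZ; apply: lerD.
    by rewrite ler_wpM2r ?enorm_ge0// ger0_norm.
  rewrite /tail; case: ltP => [jG|Gj].
    apply: (@le_trans _ _ (2 * enorm (G x))).
      rewrite ler_wpM2r ?enorm_ge0// ler_norml.
      by have := si0 (phi x); have := si2 (phi x); have := si0 (u x); have := si2 (u x); lra.
    by rewrite (ger0_norm (enorm_ge0 _)) lerDr mulr_ge0.
  rewrite normr0 mulr0 addr0.
  rewrite -mulrA (mulrC j%:R) mulrA; apply: ler_pM => //; first exact: enorm_ge0.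
  exact: soft_indic_lipschitz.
have L1 : (N (fun x => (2 * enorm (grad phi x - G x))%R) <= 2%:E * N (fun x => enorm (grad phi x - G x)))%E.
  apply: NpZ_le => //; first exact: measurable_funM.
  by move=> x; rewrite normrM (ger0_norm (ler0n R 2)).
have L2 : (N (fun x => (2 * m * j%:R * `|phi x - u x| + 2 * `|tail j x|)%R) <=
   (2 * m * j%:R)%:E * N (fun x => (phi x - u x)%R) + 2%:E * N (tail j))%E.
  apply: (@le_trans _ _ (N (fun x => (2 * m * j%:R * `|phi x - u x|)%R) + N (fun x => (2 * `|tail j x|)%R))%E).
    apply: NpD => //.
    - by apply: measurable_funM => //; exact: measurableT_comp.
    - by apply: measurable_funM => //; exact: measurableT_comp.
    - by move=> x; exact: ler_normD.
  apply: leeD; apply: NpZ_le => //.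
  - by apply: measurable_funM => //; exact: measurableT_comp.
  - by move=> x; rewrite normrM normr_id (ger0_norm mj0).
  - by apply: measurable_funM => //; exact: measurableT_comp.
  - by move=> x; rewrite normrM normr_id (ger0_norm (ler0n R 2)).
apply: (le_lt_trans (leeD L1 L2)).
apply: (@le_lt_trans _ _ (2%:E * dl%:E + ((2 * m * j%:R)%:E * dl%:E + 2%:E * (e / 6)%:E))%E).
  by rewrite !leeD// lee_wpmul2l ?lee_fin// ltW.
rewrite -!EFinM -!EFinD lte_fin.
have E : dl * (6 * (1 + m * j%:R)) = e.
  by rewrite divfK// gt_eqF.
nra.
Unshelve. all: by end_near. Qed.

Lemma measurable_indic_gt k : measurable_fun setT (indic_gt k : R -> R).
Proof.
apply: (@measurable_fun_cvg _ _ _ setT (fun j => soft_indic j.+1%:R k)).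
  by move=> j; apply: continuous_measurable_fun; exact: continuous_soft_indic.
by move=> t _; exact: cvg_soft_indic.
Qed.

Lemma measurable_trunc k : measurable_fun setT (trunc k : R -> R).
Proof.
apply: (@measurable_fun_cvg _ _ _ setT (fun j => soft_trunc j.+1%:R k)).
  move=> j; apply: continuous_measurable_fun; apply: continuous_soft_trunc.
  by rewrite pnatr_eq0.
by move=> t _; exact: cvg_soft_trunc.
Qed.

Lemma trunc_le (k t : R) : 0 < k -> `|trunc k t| <= `|t|.
Proof.
by move=> k0; rewrite trunc_norm ?(ltW k0)// ge_max normr_ge0 andbT gerBl ltW.
Qed.

(** Limit of [W0_soft_trunc] as the smoothing scale tends to 0. Because [indic_gt] carries the value
    1/2 on {|u| = k}, the gradients converge at every point and dominated convergence applies
    directly. *)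
Lemma W0_trunc k u G : 0 < k -> W0 u G ->
  W0 (fun x => trunc k (u x)) (fun x => indic_gt k (u x) *: G x).
Proof.
move=> k0 W; have [Nu NG] := W0_lty W; have [mu_ mG _] := W.
have me : measurable_fun setT (fun x => enorm (G x)) by exact: measurable_enorm.
have mtu : measurable_fun setT (fun x => trunc k (u x)).
  exact: (measurableT_comp (measurable_trunc k)).
have miu : measurable_fun setT (fun x => indic_gt k (u x)).
  exact: (measurableT_comp (measurable_indic_gt k)).
have msi j : measurable_fun setT (fun x => soft_indic j.+1%:R k (u x)).
  apply: measurableT_comp => //; apply: continuous_measurable_fun.
  exact: continuous_soft_indic.
have mst j : measurable_fun setT (fun x => soft_trunc j.+1%:R k (u x)).
  apply: measurableT_comp => //; apply: continuous_measurable_fun.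
  by apply: continuous_soft_trunc; rewrite pnatr_eq0.
apply: W0_closed => //; first exact: measurable_scalerV.
move=> e e0.
have C1 : powint mu p (fun x => soft_trunc j.+1%:R k (u x) - trunc k (u x)) @[j --> \oo] --> 0%E.
  (* The smoothed truncation is at most 2 |u| and the sharp one at most |u|. *)
  apply: (@powint_dct _ _ _ mu p _ _ (fun x => 3 * u x)) => //.
  - exact: measurable_funM.
  - by move=> x; exact: cvg_soft_trunc.
  - apply: powint_lty => //.
    apply: (@le_lt_trans _ _ (3%:E * N u)%E); last by rewrite lte_mul_pinfty ?lee_fin.
    apply: NpZ_le => //; first exact: measurable_funM.
    by move=> x; rewrite normrM (ger0_norm (ler0n R 3)).
  - move=> j x; apply: (le_trans (ler_normB _ _)); rewrite normrM (ger0_norm (ler0n R 3)).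
    have := @soft_trunc_lipschitz R j.+1%:R k 0 (u x).
    rewrite soft_trunc0 !subr0 => /(_ _)/le_trans H.
    have := trunc_le (u x) k0.
    have := @soft_trunc_lipschitz R j.+1%:R k 0 (u x).
    by rewrite soft_trunc0 !subr0 pnatr_eq0 => /(_ isT); lra.
have C2 : powint mu p (fun x => enorm (soft_indic j.+1%:R k (u x) *: G x - indic_gt k (u x) *: G x)) @[j --> \oo] --> 0%E.
  rewrite (_ : (fun j => _) = fun j => powint mu p (fun x =>
    `|soft_indic j.+1%:R k (u x) - indic_gt k (u x)| * enorm (G x) - 0)); last first.
    apply/funext => j; apply: eq_powint => x.
    by rewrite -scalerBl enormZ subr0.
  apply: (@powint_dct _ _ _ mu p _ _ (fun x => 3 * enorm (G x))) => //.
  - move=> j; apply: measurable_funM => //; apply: measurableT_comp => //.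
    exact: measurable_funB.
  - exact: measurable_funM.
  - move=> x; rewrite -[X in _ --> X](mul0r (enorm (G x))).
    apply: cvgM; last exact: cvg_cst.
    rewrite -[X in _ --> X](normr0 R); apply: cvg_norm; apply/subr_cvg0.
    exact: cvg_soft_indic.
  - apply: powint_lty => //.
    apply: (@le_lt_trans _ _ (3%:E * N (fun x => enorm (G x)))%E); last by rewrite lte_mul_pinfty ?lee_fin.
    apply: NpZ_le => //; first exact: measurable_funM.
    by move=> x; rewrite normrM (ger0_norm (ler0n R 3)).
  - move=> j x; rewrite subr0 !normrM normr_id (ger0_norm (ler0n R 3)) ler_wpM2r//.
    rewrite ler_norml; have := soft_indic_ge0 j.+1%:R k (u x).
    by have := soft_indic_le2 j.+1%:R k (u x); have := indic_gt_bounds (u x) k0; lra.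
have [j /andP[J1 J2]] : exists j, (N (fun x => (soft_trunc j.+1%:R k (u x) - trunc k (u x))%R) < e%:E)%E &&
   (N (fun x => enorm (soft_indic j.+1%:R k (u x) *: G x - indic_gt k (u x) *: G x)) < e%:E)%E.
  have C3 := cvgeD _ C1 C2; rewrite adde0 in C3.
  have [j Hj] := cvge0_ex (fun j => adde_ge0 (powint_ge0 mu p _) (powint_ge0 mu p _)) (C3 _ isT) (powR_gt0 p e0).
  exists j; apply/andP; split; apply: powint_lt_Np => //; try exact: ltW.
    by apply: le_lt_trans Hj; rewrite leeDl// powint_ge0.
  by apply: le_lt_trans Hj; rewrite leeDr// powint_ge0.
exists (fun x => soft_trunc j.+1%:R k (u x)), (fun x => soft_indic j.+1%:R k (u x) *: G x).
by split => //; apply: W0_soft_trunc.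
Qed.

Lemma W0_translate u G h : W0 u G ->
  (N (fun x => (u (x + h) - u x)%R) <= (enorm h)%:E * N (fun x => enorm (G x)))%E.
Proof.
move=> W; have [Nu NG] := W0_lty W; case: W => mu_ mG HW.
apply/lee_addgt0Pr => e e0.
(* The replacement of u costs this accuracy twice, that of its gradient |h| times. *)
have d0 : 0 < e / (2 + enorm h) by rewrite divr_gt0// ltr_pwDl// enorm_ge0.
set dl := e / _ in d0.
have [phi [tf phiu phiG]] := HW _ d0.
have mphi := test_measurable tf; have mg := test_grad_measurable tf.
have mtr (f : 'rV[R]_n -> R) : measurable_fun setT f -> measurable_fun setT (fun x : 'rV[R]_n => f (x + h)).
  by move=> mf; apply: (measurableT_comp mf); exact: measurable_rV_translate.
have Ntr (f : 'rV[R]_n -> R) : measurable_fun setT f -> N (fun x => f (x + h)) = N f.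
  move=> mf; have E : powint mu p (fun x => f (x + h)) = powint mu p f.
    apply: (ge0_integral_rVD h (f := fun x => (`|f x| `^ p)%:E)).
      exact: measurable_powint.
    by move=> x; rewrite lee_fin powR_ge0.
  by rewrite 2!Np_powint E.
have mf1 : measurable_fun setT (fun x => phi x - u x) by exact: measurable_funB.
have mf2 : measurable_fun setT (fun x : 'rV[R]_n => phi (x + h) - phi x) by apply: measurable_funB => //; exact: mtr.
have mf3 : measurable_fun setT (fun x : 'rV[R]_n => u (x + h) - u x) by apply: measurable_funB => //; exact: mtr.
have T1 : (N (fun x => (phi (x + h) - phi x)%R) <= (enorm h)%:E * N (fun x => enorm (grad phi x)))%E.
  have := test_translate p1 h tf.
  rewrite (powint_Np _ _ p0) (powint_Np _ (fun x => enorm _) p0) -poweR_EFin.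
  rewrite -poweRM ?Np_ge0 ?lee_fin ?enorm_ge0// => H.
  have := gt0_ler_poweR (r := p^-1); rewrite invr_ge0 (ltW p0) => /(_ isT _ _ _ _ H).
  rewrite !in_itv/= !poweR_ge0 !leey => /(_ isT isT).
  rewrite -!poweRrM divff ?gt_eqF// !poweRe1 ?Np_ge0// mule_ge0 ?Np_ge0 ?lee_fin ?enorm_ge0//.
have G1 : (N (fun x => enorm (grad phi x)) <= N (fun x => enorm (G x)) + dl%:E)%E.
  apply: (@le_trans _ _ (N (fun x => enorm (G x)) + N (fun x => enorm (grad phi x - G x)))%E).
    apply: NpD => //; do ?by apply: measurable_enorm; rewrite //; exact: measurable_subrV.
    move=> x; rewrite !ger0_norm ?enorm_ge0//.
    by apply: le_trans (enormD _ _); rewrite addrC subrK.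
  by rewrite leeD2l// ltW.
apply: (@le_trans _ _ (N (fun x => (phi (x + h) - phi x)%R) +
  (N (fun x => (phi (x + h) - u (x + h))%R) + N (fun x => (phi x - u x)%R)))%E).
  apply: (@le_trans _ _ (N (fun x => (phi (x + h) - phi x)%R) +
     N (fun x => (phi (x + h) - u (x + h) - (phi x - u x))%R))%E).
    apply: NpD => //; first by apply: measurable_funB => //; exact: (mtr _ mf1).
    move=> x; apply: le_trans (ler_normB _ _).
    by rewrite (_ : _ - _ = phi (x + h) - phi x - (phi (x + h) - u (x + h) - (phi x - u x))) //; ring.
  rewrite leeD2l//; apply: NpD => //; first exact: (mtr _ mf1).
    by apply: measurable_funB => //; exact: (mtr _ mf1).
  by move=> x; exact: ler_normB.
rewrite (Ntr (fun x => phi x - u x))//.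
apply: (@le_trans _ _ ((enorm h)%:E * (N (fun x => enorm (G x)) + dl%:E) + (dl%:E + dl%:E))%E).
  apply: leeD; last by apply: leeD; exact: ltW.
  by apply: (le_trans T1); rewrite lee_wpmul2l ?lee_fin ?enorm_ge0.
rewrite ge0_muleDr ?Np_ge0 ?lee_fin ?(ltW d0)// -addeA leeD2l//.
rewrite -EFinM -!EFinD lee_fin.
have E : dl * (2 + enorm h) = e by rewrite divfK// gt_eqF// ltr_pwDl// enorm_ge0.
lra.
Qed.

(** Density: with flux and source in the conjugate space, both sides are continuous in the test pair
    by Hoelder. It allows the solution and its truncations to serve as test functions. *)
Lemma weak_ext (A : 'rV[R]_n -> 'rV[R]_n) (b : 'rV[R]_n -> R) :
  measurable_fun setT A -> measurable_fun setT b ->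
  (Np mu (p / (p - 1)) (fun x => enorm (A x)) < +oo)%E ->
  (Np mu (p / (p - 1)) b < +oo)%E ->
  (forall phi, test_function Omega phi ->
    \int[mu]_x dotrV (A x) (grad phi x) = \int[mu]_x (b x * phi x)) ->
  forall v H, W0 v H -> \int[mu]_x dotrV (A x) (H x) = \int[mu]_x (b x * v x).
Proof.
move=> mA mb NA Nb HA v H W; have [Nv NH] := W0_lty W; case: W => mv mH HW.
have mnA : measurable_fun setT (fun x => enorm (A x)) by exact: measurable_enorm.
have intA G : measurable_fun setT G -> (N (fun x => enorm (G x)) < +oo)%E ->
    mu.-integrable setT (EFin \o (fun x => dotrV (A x) (G x))).
  move=> mG NG; have mnG : measurable_fun setT (fun x => enorm (G x)) by exact: measurable_enorm.
  apply: (le_integrable measurableT _ _ (hoelder_integrable p1 mnA mnG NA NG)).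
    by apply/measurable_EFinP; exact: measurable_dotrV.
  move=> x _ /=; rewrite lee_fin; apply: (le_trans (CauchySchwarz_dotrV _ _)).
  exact: ler_norm.
have intb f : measurable_fun setT f -> (N f < +oo)%E ->
    mu.-integrable setT (EFin \o (fun x => b x * f x)).
  by move=> mf Nf; exact: hoelder_integrable p1 mb mf Nb Nf.
apply/eqP; rewrite -subr_eq0 -normr_le0; apply/ler_addgt0Pr => e e0; rewrite add0r.
set a := fine (Np mu (p / (p - 1)) (fun x => enorm (A x))).
set c := fine (Np mu (p / (p - 1)) b).
have a0 : 0 <= a by rewrite fine_ge0// Np_ge0.
have c0 : 0 <= c by rewrite fine_ge0// Np_ge0.
have d0 : 0 < e / (1 + a + c) by rewrite divr_gt0// -addrA ltr_pwDl// addr_ge0.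
set dl := e / _ in d0.
have [phi [tf phiv phiH]] := HW _ d0.
have mphi := test_measurable tf; have mg := test_grad_measurable tf.
have Nphi : (N phi < +oo)%E by apply: Np_lty => //; exact: test_powint_lty tf.
have Ng : (N (fun x => enorm (grad phi x)) < +oo)%E.
  by apply: Np_lty => //; exact: test_grad_powint_lty tf.
have mD1 : measurable_fun setT (fun x => grad phi x - H x) by exact: measurable_subrV.
have mD2 : measurable_fun setT (fun x => phi x - v x) by exact: measurable_funB.
have E1 : \int[mu]_x dotrV (A x) (grad phi x) - \int[mu]_x dotrV (A x) (H x) =
    \int[mu]_x dotrV (A x) (grad phi x - H x).
  rewrite -RintegralB//; [|exact: intA|exact: intA].
  by apply: eq_Rintegral => x _; rewrite dotrVDr dotrVNr.
have E2 : \int[mu]_x (b x * phi x) - \int[mu]_x (b x * v x) = \int[mu]_x (b x * (phi x - v x)).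
  rewrite -RintegralB//; [|exact: intb|exact: intb].
  by apply: eq_Rintegral => x _; rewrite mulrBr.
have L1 : `|\int[mu]_x dotrV (A x) (grad phi x - H x)| <= a * dl.
  have mnD : measurable_fun setT (fun x => enorm (grad phi x - H x)) by exact: measurable_enorm.
  have ND : (N (fun x => enorm (grad phi x - H x)) < +oo)%E by apply: lt_trans phiH _; rewrite ltry.
  have I1 := intA _ mD1 ND.
  apply: (le_trans (le_normr_Rintegral measurableT I1)).
  apply: (@le_trans _ _ (\int[mu]_x (enorm (A x) * enorm (grad phi x - H x)))).
    apply: le_Rintegral => //.
    - exact: (integrable_norm I1).
    - exact: hoelder_integrable p1 mnA mnD NA ND.
    - by move=> x _; exact: CauchySchwarz_dotrV.
  apply: (le_trans (ler_norm _)).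
  apply: (le_trans (hoelder_Rintegral p1 mnA mnD NA ND)).
  rewrite ler_wpM2l// -lee_fin fineK ?ge0_fin_numE ?Np_ge0//; exact: ltW.
have L2 : `|\int[mu]_x (b x * (phi x - v x))| <= c * dl.
  have ND : (N (fun x => (phi x - v x)%R) < +oo)%E by apply: lt_trans phiv _; rewrite ltry.
  apply: (le_trans (hoelder_Rintegral p1 mb mD2 Nb ND)).
  rewrite ler_wpM2l// -lee_fin fineK ?ge0_fin_numE ?Np_ge0//; exact: ltW.
have E : dl * (1 + a + c) = e by rewrite divfK// gt_eqF// -addrA ltr_pwDl// addr_ge0.
rewrite (_ : _ - _ = \int[mu]_x (b x * (phi x - v x)) - \int[mu]_x dotrV (A x) (grad phi x - H x)).
  apply: (le_trans (ler_normB _ _)); nra.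
rewrite -E1 -E2 (HA _ tf); ring.
Qed.

End W0.

(** * Faber-Krahn inequality and De Giorgi iteration *)

Section faber_krahn.
Context {R : realType} {n : nat} (Omega : set 'rV[R]_n) (p : R) (p1 : 1 < p).
Local Notation mu := (rV_lebesgue_measure R n).
Implicit Types (v : 'rV[R]_n -> R) (H : 'rV[R]_n -> 'rV[R]_n).

Let p0 : 0 < p. Proof. exact: lt_trans ltr01 p1. Qed.

Lemma measurable_rV_add : measurable_fun setT (fun z : 'rV[R]_n * 'rV[R]_n => z.1 + z.2).
Proof.
apply: measurable_funrV => i.
rewrite (_ : (fun _ => _) = fun z : 'rV[R]_n * 'rV[R]_n => z.1 0 i + z.2 0 i).
  by apply: measurable_funD; apply: measurable_rV_coordP.
by apply/funext => z; rewrite mxE.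
Qed.

Lemma W0_translate_powint v H h : W0 Omega p v H ->
  (powint mu p (fun x => (v (x + h) - v x)%R) <=
   (enorm h `^ p)%:E * powint mu p (fun x => enorm (H x)))%E.
Proof.
move=> W; have := W0_translate p1 h W => T1.
rewrite (powint_Np _ _ p0) (powint_Np _ (fun x => enorm _) p0) -poweR_EFin.
rewrite -poweRM ?Np_ge0 ?lee_fin ?enorm_ge0//.
apply: gt0_ler_poweR => //; first exact: ltW.
- by rewrite in_itv/= Np_ge0 leey.
- by rewrite in_itv/= leey andbT mule_ge0 ?Np_ge0// lee_fin enorm_ge0.
Qed.

(* Averages v(x + h) - v(x) over h in a cube of measure 2 s: for at least half
   of those h, x + h lies outside the support of v. *)
Lemma faber_krahn v H (s r : R) : W0 Omega p v H -> 0 < s -> 0 <= r ->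
  r ^+ n = 2 * s -> (mu [set x | v x != 0%R] <= s%:E)%E ->
  (powint mu p v <= (2 * (n%:R * r) `^ p)%:E * powint mu p (fun x => enorm (H x)))%E.
Proof.
move=> W s0 r0 rn mS; have [mv mH _] := W.
pose Q := [set x : 'rV[R]_n | forall i, (0 : 'rV[R]_n) 0 i <= x 0 i < (0 : 'rV[R]_n) 0 i + r].
have mQ : measurable Q by exact: measurable_rV_box.
have QE : mu Q = (2 * s)%:E by rewrite -rn; exact: rV_lebesgue_box.
pose D := fun z : 'rV[R]_n * 'rV[R]_n => `|v (z.1 + z.2) - v z.1| `^ p.
have mD : measurable_fun setT D.
  apply: measurable_norm_powR; apply: measurable_funB.
    exact: (measurableT_comp mv measurable_rV_add).
  exact: measurableT_comp.
pose F := fun z : 'rV[R]_n * 'rV[R]_n => (D z * \1_Q z.2)%:E.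
have m1Q : measurable_fun setT (\1_Q : 'rV[R]_n -> R) by exact: measurable_indic.
have mF : measurable_fun setT F.
  apply/measurable_EFinP; apply: measurable_funM => //.
  exact: (measurableT_comp m1Q measurable_snd).
have F0 z : (0 <= F z)%E by rewrite lee_fin mulr_ge0 ?powR_ge0.
have mv0 : measurable [set x | v x != 0].
  rewrite -[X in measurable X]setTI.
  rewrite (_ : [set x | _] = v @^-1` (~` [set 0])); last first.
    by apply/seteqP; split => x /= /eqP.
  by apply: mv => //; exact: measurableC.
have tr x : mu [set h | v (x + h) != 0%R] = mu [set x | v x != 0%R].
  rewrite -(rV_lebesgueD x mv0); congr (mu _).
  by apply/seteqP; split => h /=; rewrite addrC.
have lower x : ((`|v x| `^ p)%:E * s%:E <= \int[mu]_h F (x, h))%E.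
  pose S := [set h : 'rV[R]_n | v (x + h) != 0].
  (* For h in [E] the value v(x + h) is 0, so the integrand is |v x|^p; the measure of [E] is at
     least 2 s - s. *)
  pose E := Q `&` ~` S.
  have mvx : measurable S.
    rewrite (_ : S = (fun h => h + x) @^-1` [set x | v x != 0]).
      by rewrite -[X in measurable X]setTI; exact: measurable_rV_translate.
    by apply/seteqP; split => h /=; rewrite addrC.
  have mE : measurable E by apply: measurableI => //; exact: measurableC.
  have sE : (s%:E <= mu E)%E.
    have : (mu Q <= mu E + mu S)%E.
      rewrite -[leLHS](_ : mu (E `|` (Q `&` S)) = _).
        apply: le_trans (measureU2 _ _ _) _ => //; first exact: measurableI.
        by rewrite leeD2l// le_measure ?inE//; exact: measurableI.
      by congr (mu _); rewrite /E -setIUr setUC setUv setIT.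
    rewrite /S tr QE => /le_trans /(_ (leeD2l _ mS)).
    rewrite -leeBlDr// -EFinB; apply: le_trans; rewrite lee_fin; lra.
  apply: (@le_trans _ _ ((`|v x| `^ p)%:E * mu E)%E).
    by rewrite lee_wpmul2l// lee_fin powR_ge0.
  rewrite (_ : mu E = \int[mu]_h (\1_E h)%:E)%E; last by rewrite integral_indic// setIT.
  rewrite -ge0_integralZl_EFin ?powR_ge0//; last first.
    by apply/measurable_EFinP; exact: measurable_indic.
  apply: ge0_le_integral => //.
  - by apply: measurable_funeM; apply/measurable_EFinP; exact: measurable_indic.
  - exact: (measurableT_comp mF (pair1_measurable x)).
  - move=> h _; rewrite -EFinM lee_fin /D/= !indicE.
    case: (boolP (h \in E)) => [|_]; last by rewrite mulr0 mulr_ge0// powR_ge0.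
    rewrite inE => -[Qh /= /negP]; rewrite negbK => /eqP ->.
    by rewrite sub0r normrN mem_set.
have upper h : (\int[mu]_x F (x, h) <= ((n%:R * r) `^ p)%:E *
    powint mu p (fun x => enorm (H x)) * (\1_Q h)%:E)%E.
  rewrite /F indicE /=; case: (boolP (h \in Q)) => [|_]; last first.
    by rewrite mule0 integral0_eq// => x _; rewrite mulr0.
  rewrite inE => Qh; rewrite mule1.
  apply: (@le_trans _ _ (powint mu p (fun x => v (x + h)%R - v x)%R)).
    rewrite le_eqVlt; apply/orP; left; apply/eqP.
    by apply: eq_integral => x _; rewrite mulr1.
  apply: (le_trans (W0_translate_powint h W)).
  rewrite lee_wpmul2r ?powint_ge0// lee_fin.
  apply: ge0_ler_powR; rewrite ?nnegrE ?enorm_ge0 ?mulr_ge0 ?(ltW p0)//.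
  apply: (le_trans (enorm_le_norm h)); rewrite ler_wpM2l//.
  apply: rV_norm_le => // i; have := Qh i; rewrite mxE add0r => /andP[h0 hr].
  by rewrite ger0_norm// ltW.
have H1 : (s%:E * powint mu p v <= \int[mu]_x \int[mu]_h F (x, h))%E.
  rewrite /powint -ge0_integralZl_EFin ?(ltW s0)//; last exact: measurable_powint.
  apply: ge0_le_integral => //.
  - by move=> x _; rewrite mule_ge0// lee_fin ?powR_ge0 ?ltW.
  - by apply: measurable_funeM; exact: measurable_powint.
  - exact: measurable_fun_fubini_tonelli_F mF F0.
  - by move=> x _; rewrite muleC; exact: lower.
have H2 : (\int[mu]_h \int[mu]_x F (x, h) <= ((n%:R * r) `^ p)%:E *
    powint mu p (fun x => enorm (H x)) * (2 * s)%:E)%E.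
  rewrite -QE (_ : mu Q = \int[mu]_h (\1_Q h)%:E)%E; last by rewrite integral_indic// setIT.
  rewrite -ge0_integralZl; [|exact: measurableT|by apply/measurable_EFinP
    |by move=> h _; rewrite lee_fin|by rewrite mule_ge0 ?powint_ge0// lee_fin powR_ge0].
  apply: ge0_le_integral => //.
  - by move=> h _; apply: integral_ge0.
  - exact: measurable_fun_fubini_tonelli_G mF F0.
  - by apply: measurable_funeM; apply/measurable_EFinP.
have H3 : (s%:E * powint mu p v <= s%:E * ((2 * (n%:R * r) `^ p)%:E * powint mu p (fun x => enorm (H x))))%E.
  apply: (le_trans H1); rewrite (@fubini_tonelli _ _ _ _ _ mu mu F mF F0).
  apply: (le_trans H2); rewrite muleC muleA -EFinM muleA -EFinM.
  by rewrite (_ : 2 * s * _ = s * (2 * (n%:R * r) `^ p))//; ring.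
by move: H3; rewrite lee_pmul2l// lte_fin.
Qed.

End faber_krahn.

(** * De Giorgi iteration *)

Section de_giorgi.
Context {R : realType}.

Lemma expr_powR (x r : R) j : 0 <= x -> (x ^+ j) `^ r = (x `^ r) ^+ j.
Proof.
move=> x0; elim: j => [|j IH]; first by rewrite !expr0 powR1.
by rewrite !exprS powRM ?exprn_ge0// IH.
Qed.

(** Fast geometric convergence: the excess exponent [dl] in the recursion beats the shrinking gaps
    between levels as soon as the starting value lies below a threshold. Here [a k] stands for the
    measure of {|w| > k}. *)
Lemma de_giorgi_iteration (a : R -> R) (M B g dl : R) :
  0 < M -> 0 < B -> 0 < g -> 0 < dl -> (forall k, 0 <= a k) ->
  (forall k h, M / 2 <= k -> k <= h -> a h <= a k) ->
  (forall k h, M / 2 <= k -> k < h -> ((h - k) * a h) `^ g <= B * a k `^ (g + dl)) ->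
  a (M / 2) <= ((2 `^ (- (g / dl)) * (M / 8)) `^ g / B) `^ dl^-1 ->
  a (3 / 4 * M) = 0.
Proof.
move=> M0 B0 g0 d0 a0 amono arec.
have h21 : (1 / 2 : R) <= 1 by lra.
have h2g : 2 `^ (- g) = (1 / 2) `^ g.
  by rewrite div1r -(powR_inv1 (ler0n R 2)) -powRrM mulN1r.
set lam := 2 `^ (- (g / dl)); set th := (_ `^ dl^-1) => ath.
have lam0 : 0 < lam by rewrite powR_gt0.
have lam1 : lam < 1.
  rewrite /lam powRN invf_lt1 ?powR_gt0//.
  have := @gt0_ltr_powR R (g / dl) (divr_gt0 g0 d0) 1 2.
  by rewrite powR1 !nnegrE; apply; lra.
have M80 : 0 < M / 8 by rewrite divr_gt0.
have th0 : 0 < th by rewrite powR_gt0// divr_gt0// powR_gt0// mulr_gt0.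
(* The threshold is chosen for this identity; with lam^dl = 2^(-g) it makes the recursion carry the
   bound th lam^j to th lam^(j+1). *)
have thE : B * th `^ dl = (lam * (M / 8)) `^ g.
  rewrite /th -powRrM mulVf ?gt_eqF// powRr1 ?divr_ge0 ?powR_ge0 ?(ltW B0)//.
  by rewrite mulrC divfK// gt_eqF.
have lamE : lam `^ dl = 2 `^ (- g).
  by rewrite /lam -powRrM mulNr divfK// gt_eqF.
(* Levels rising from M/2 towards 3M/4 with gaps (M/8) 2^(-j). *)
pose kk j : R := M / 2 + M / 4 * (1 - (1 / 2) ^+ j).
have H j : a (kk j) <= th * lam ^+ j.
  elim: j => [|j IH]; first by rewrite /kk !expr0 subrr mulr0 addr0 mulr1.
  have k1 : M / 2 <= kk j.
    by rewrite lerDl mulr_ge0 ?divr_ge0 ?(ltW M0)// subr_ge0 exprn_ile1.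
  have kd : kk j.+1 - kk j = M / 8 * (1 / 2) ^+ j by rewrite /kk exprS; field.
  have kd0 : 0 < M / 8 * (1 / 2) ^+ j by rewrite mulr_gt0// exprn_gt0.
  have := arec (kk j) (kk j.+1) k1; rewrite -subr_gt0 kd => /(_ kd0) Hr.
  have th1 : 0 <= th * lam ^+ j by rewrite mulr_ge0 ?exprn_ge0 ?ltW.
  have Hr2 : ((M / 8 * (1 / 2) ^+ j) * a (kk j.+1)) `^ g <=
      ((M / 8 * (1 / 2) ^+ j) * (th * lam ^+ j.+1)) `^ g.
    apply: (le_trans Hr).
    apply: (@le_trans _ _ (B * (th * lam ^+ j) `^ (g + dl))).
      rewrite ler_wpM2l ?(ltW B0)//.
      by apply: ge0_ler_powR; rewrite ?nnegrE ?addr_ge0 ?(ltW g0) ?(ltW d0).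
    rewrite powRD; last by rewrite (gt_eqF (mulr_gt0 th0 (exprn_gt0 j lam0))) implybT.
    rewrite [X in _ * (_ * X)](_ : _ = th `^ dl * ((1 / 2) ^+ j) `^ g); last first.
      rewrite powRM ?(ltW th0) ?exprn_ge0 ?(ltW lam0)//; congr (_ * _).
      rewrite !expr_powR ?(ltW lam0)// lamE; congr (_ ^+ _).
      exact: h2g.
    rewrite (_ : B * _ = (lam * (M / 8)) `^ g * ((th * lam ^+ j) `^ g * ((1 / 2) ^+ j) `^ g)); last first.
      by rewrite -thE; ring.
    rewrite -!powRM ?mulr_ge0 ?exprn_ge0 ?(ltW th0) ?(ltW lam0) ?(ltW M0)//.
    by rewrite le_eqVlt; apply/orP; left; apply/eqP; congr (_ `^ _); rewrite exprS; ring.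
  rewrite leNgt; apply/negP => abs; move: Hr2; rewrite leNgt => /negP; apply.
  apply: gt0_ltr_powR => //.
  - by rewrite nnegrE mulr_ge0 ?(ltW kd0)// mulr_ge0 ?exprn_ge0 ?(ltW th0)// ltW.
  - by rewrite nnegrE mulr_ge0 ?(ltW kd0).
  - by rewrite ltr_pM2l.
apply/eqP; rewrite eq_le a0 andbT.
have cl : (fun j => th * lam ^+ j) @ \oo --> (0 : R).
  rewrite -[X in _ --> X](mulr0 th); apply: cvgMr.
  by apply: cvg_expr; rewrite ger0_norm// ltW.
rewrite -(cvg_lim _ cl)//; apply: limr_ge; first by apply/cvg_ex; eexists; exact: cl.
have hj0 j : 0 <= (1 / 2 : R) ^+ j by rewrite exprn_ge0.
have hj1 j : (1 / 2 : R) ^+ j <= 1 by rewrite exprn_ile1.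
apply: nearW => j; apply: le_trans (H j); apply: amono.
  by rewrite lerDl mulr_ge0 ?divr_ge0 ?(ltW M0)// subr_ge0.
rewrite /kk (_ : _ + _ = 3 / 4 * M - M / 4 * (1 / 2) ^+ j); last by field.
by rewrite gerBl mulr_ge0// divr_ge0// ltW.
Qed.

Context {n : nat} (n0 : (0 < n)%N) (Omega : set 'rV[R]_n) (p : R) (p1 : 1 < p).
Local Notation mu := (rV_lebesgue_measure R n).

Let p0 : 0 < p. Proof. exact: lt_trans ltr01 p1. Qed.

Lemma chebyshev_le d (T : measurableType d) (nu : {measure set T -> \bar R})
    (S : set T) (f : T -> R) (c : R) : measurable S -> measurable_fun setT f ->
  0 <= c -> (forall x, 0 <= f x) -> (forall x, S x -> c <= f x) ->
  (c%:E * nu S <= \int[nu]_x (f x)%:E)%E.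
Proof.
move=> mS mf c0 f0 Sf.
rewrite (_ : nu S = \int[nu]_h (\1_S h)%:E)%E; last by rewrite integral_indic// setIT.
rewrite -ge0_integralZl_EFin//; last first.
  by apply/measurable_EFinP; exact: measurable_indic.
apply: ge0_le_integral => //.
- by move=> x _; rewrite -EFinM lee_fin mulr_ge0.
- by apply: measurable_funeM; apply/measurable_EFinP; exact: measurable_indic.
- exact/measurable_EFinP.
- move=> x _; rewrite -EFinM lee_fin indicE.
  case: (boolP (x \in S)) => [|_]; last by rewrite mulr0.
  by rewrite inE mulr1; exact: Sf.
Qed.

(** By contradiction: a smaller integral of |w|^p would, by Chebyshev at level M/2, put the
    iteration below its threshold, and {|w| > 3M/4} would be a null set. *)
Lemma de_giorgi_bound (w : 'rV[R]_n -> R) (G : 'rV[R]_n -> 'rV[R]_n) (M A : R) :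
  W0 Omega p w G -> 0 < M -> 0 < A ->
  (forall k, M / 2 <= k ->
    (powint mu p (fun x => enorm (indic_gt k (w x) *: G x)) <=
    A%:E * powint mu 1 (fun x => trunc k (w x)))%E) ->
  (0 < mu [set x | (3 / 4 * M < `|w x|)%R])%E ->
  (((M / 2) `^ p * ((2 `^ (- ((p - 1) / (p / n%:R))) * (M / 8)) `^ (p - 1) /
    (2 * n%:R `^ p * 2 `^ (p / n%:R) * A)) `^ (p / n%:R)^-1)%:E <= powint mu p w)%E.
Proof.
move=> W M0 A0 En Mpos.
have nR0 : 0 < n%:R :> R by rewrite ltr0n.
have g0 : 0 < p - 1 by rewrite subr_gt0.
have d0 : 0 < p / n%:R by rewrite divr_gt0.
(* Let I and V be the integrals of |v| and |v|^p for the truncation v at level k. Hoelder gives I^p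
   <= a(k)^(p-1) V; Faber-Krahn with r^n = 2 a(k) and the energy hypothesis give V <= 2 (n r)^p A I.
   Dividing by I leaves I^(p-1) <= B a(k)^(p-1+p/n), and (h - k) a(h) <= I. *)
set B := 2 * _ * _ * A.
have B0 : 0 < B by rewrite !mulr_gt0// powR_gt0.
set th := (_ `^ (p / n%:R)^-1).
have [mw mG _] := W; have [Nw NG] := W0_lty p1 W.
have M20 : 0 < M / 2 by rewrite divr_gt0.
pose S (k : R) := [set x | k < `|w x|].
have mS k : measurable (S k).
  rewrite -[X in measurable X]setTI.
  rewrite (_ : S k = (fun x => `|w x|) @^-1` `]k, +oo[%classic); last first.
    by apply/seteqP; split => x /=; rewrite in_itv/= andbT.
  have : measurable_fun setT (fun x => `|w x|) by exact: measurableT_comp.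
  by apply.
have Pw : (powint mu p w < +oo)%E by exact: powint_lty.
have cheb : (((M / 2) `^ p)%:E * mu (S (M / 2)%R) <= powint mu p w)%E.
  apply: chebyshev_le => //.
  - exact: measurable_norm_powR.
  - exact: powR_ge0.
  - move=> x /= Sx; apply: ge0_ler_powR; rewrite ?nnegrE ?(ltW p0) ?(ltW M20)//.
    exact: ltW.
have Smono k h : k <= h -> (mu (S h) <= mu (S k))%E.
  move=> kh; apply: le_measure; rewrite ?inE//.
  by move=> x /=; exact: le_lt_trans.
have Sfin k : M / 2 <= k -> (mu (S k) < +oo)%E.
  move=> /Smono /le_lt_trans; apply; rewrite ltey; apply/eqP => Soo.
  move: cheb; rewrite Soo gt0_muley ?lte_fin ?powR_gt0// leye_eq => /eqP Pwo.
  by rewrite Pwo in Pw.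
pose a k := fine (mu (S k)).
have a0 k : 0 <= a k by rewrite fine_ge0.
have aE k : M / 2 <= k -> mu (S k) = (a k)%:E.
  by move=> kM; rewrite fineK// ge0_fin_numE// Sfin.
suff ath : th <= a (M / 2).
  by apply: le_trans cheb; rewrite aE// lee_fin ler_wpM2l// powR_ge0.
rewrite leNgt; apply/negP => ath; move: Mpos.
have M34 : M / 2 <= 3 / 4 * M by lra.
rewrite -/(S (3 / 4 * M)) aE//.
suff -> : a (3 / 4 * M) = 0 by rewrite ltxx.
apply: (@de_giorgi_iteration a M B (p - 1) (p / n%:R)) => //; last exact: ltW.
  move=> k h kM kh; have hM := le_trans kM kh.
  by have := Smono _ _ kh; rewrite !aE.
move=> k h kM kh; have hM := le_trans kM (ltW kh).
have k0 : 0 < k := lt_le_trans M20 kM.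
have [mv mH _] := W0_trunc p1 k0 W.
have [Nv NH] := W0_lty p1 (W0_trunc p1 k0 W).
have Wk := W0_trunc p1 k0 W.
set v := (fun x => trunc k (w x)) in mv Nv Wk.
set H := (fun x => indic_gt k (w x) *: G x) in mH NH Wk.
have vS x : (x \in S k) = (v x != 0).
  rewrite -normr_eq0 trunc_norm ?(ltW k0)//; apply/idP/idP; rewrite inE /S/=.
    by move=> kx; rewrite max_l ?subr_ge0 ?(ltW kx)// subr_eq0 gt_eqF.
  by apply: contraNT; rewrite -leNgt => xk; rewrite max_r// subr_le0.
(* Faber-Krahn asks for a positive bound on the support, so an empty level is set aside. *)
have [ak0|ak0] := eqVneq (a k) 0.
  have -> : a h = 0.
    apply/eqP; rewrite eq_le a0 andbT -ak0.
    by have := Smono _ _ (ltW kh); rewrite !aE.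
  by rewrite mulr0 powR0 ?gt_eqF// mulr_ge0 ?powR_ge0// ltW.
have {}ak0 : 0 < a k by rewrite lt_neqAle eq_sym ak0 a0.
pose r := (2 * a k) `^ n%:R^-1.
have r0 : 0 <= r by exact: powR_ge0.
have rn : r ^+ n = 2 * a k.
  by rewrite -powR_mulrn// -powRrM mulVf ?gt_eqF// powRr1// mulr_ge0.
have mS0 : (mu [set x | v x != 0%R] <= (a k)%:E)%E.
  rewrite -aE// (_ : [set x | v x != 0] = S k)//.
  by apply/seteqP; split => x /=; rewrite -vS inE.
have FK := faber_krahn p1 Wk ak0 r0 rn mS0.
have Pv : (powint mu p v < +oo)%E by exact: powint_lty.
have PH : (powint mu p (fun x => enorm (H x)) < +oo)%E by exact: powint_lty.
set V := powint mu p v in FK Pv.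
have V_ge0 : (0 <= V)%E := powint_ge0 mu p v.
have VE : V = (fine V)%:E by apply/esym/fineK; rewrite (ge0_fin_numE V_ge0).
have v0 : 0 <= fine V := fine_ge0 V_ge0.
set I := powint mu 1 v.
have m1S : measurable_fun setT (\1_(S k) : 'rV[R]_n -> R) by exact: measurable_indic.
have I_le : (I <= (a k `^ ((p - 1) / p) * fine V `^ p^-1)%:E)%E.
  have -> : I = (\int[mu]_x (`|\1_(S k) x * v x|)%:E)%E.
    apply: eq_integral => x _; rewrite powRr1//; congr (`|_|%:E).
    rewrite indicE vS; case: eqVneq => [->|_]; first by rewrite mulr0.
    by rewrite mul1r.
  apply: (le_trans (hoelder_Np mu p1 m1S mv)).
  rewrite EFinM; apply: lee_pmul; rewrite ?Np_ge0//; last first.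
    by rewrite Np_powint -/V VE poweR_EFin.
  rewrite Np_powint (_ : powint mu (p / (p - 1)) \1_(S k) = (a k)%:E).
    by rewrite poweR_EFin invf_div.
  rewrite -aE// -[RHS](_ : \int[mu]_x (\1_(S k) x)%:E = _)%E; last by rewrite integral_indic// setIT.
  apply: eq_integral => x _; rewrite indicE; case: (x \in S k).
    by rewrite normr1 powR1.
  by rewrite normr0 powR0// gt_eqF// divr_gt0.
have I_ge0 : (0 <= I)%E := powint_ge0 mu 1 v.
have IE : I = (fine I)%:E.
  apply/esym/fineK; rewrite (ge0_fin_numE I_ge0).
  by apply: (le_lt_trans I_le); rewrite ltry.
have i0 : 0 <= fine I := fine_ge0 I_ge0.
move: I_le; rewrite IE lee_fin => I_le.
have V_le : fine V <= 2 * (n%:R * r) `^ p * (A * fine I).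
  rewrite -lee_fin -VE; apply: (le_trans FK).
  rewrite [in leRHS]EFinM lee_wpmul2l ?lee_fin ?mulr_ge0 ?powR_ge0//.
  by rewrite EFinM -IE; exact: En.
have Ip : fine I `^ p <= a k `^ (p - 1) * fine V.
  apply: (@le_trans _ _ ((a k `^ ((p - 1) / p) * fine V `^ p^-1) `^ p)).
    by apply: ge0_ler_powR; rewrite ?nnegrE ?mulr_ge0 ?powR_ge0 ?(ltW p0).
  rewrite powRM ?powR_ge0// -!powRrM divfK ?gt_eqF// mulVf ?gt_eqF// powRr1//.
have hk : (h - k) * a h <= fine I.
  rewrite -lee_fin EFinM -aE// -IE.
  rewrite (_ : I = \int[mu]_x (`|v x|)%:E)%E; last first.
    by apply: eq_integral => x _; rewrite powRr1.
  apply: chebyshev_le => //.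
  - by apply: measurableT_comp.
  - by rewrite subr_ge0 ltW.
  - move=> x /= hx; rewrite trunc_norm ?(ltW k0)// le_max.
    by rewrite lerD2r (ltW hx).
have [I0|I0] := eqVneq (fine I) 0.
  have -> : (h - k) * a h = 0.
    by apply/eqP; rewrite eq_le -{1}I0 hk mulr_ge0// subr_ge0 ltW.
  by rewrite powR0 ?gt_eqF// mulr_ge0 ?powR_ge0// ltW.
have {}I0 : 0 < fine I by rewrite lt_neqAle eq_sym I0.
apply: (@le_trans _ _ (fine I `^ (p - 1))).
  apply: ge0_ler_powR; rewrite ?nnegrE ?(ltW g0) ?mulr_ge0//.
  by rewrite subr_ge0 ltW.
have IpE : fine I `^ p = fine I * fine I `^ (p - 1) by rewrite mulr_powRB1.
have rp : r `^ p = 2 `^ (p / n%:R) * a k `^ (p / n%:R).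
  by rewrite -powRrM powRM// (mulrC n%:R^-1).
rewrite -(ler_pM2l I0) -IpE; apply: (le_trans Ip).
apply: (@le_trans _ _ (a k `^ (p - 1) * (2 * (n%:R * r) `^ p * (A * fine I)))).
  by rewrite ler_wpM2l// powR_ge0.
rewrite powRM ?(ltW nR0)// rp [a k `^ (p - 1 + _)]powRD; last by rewrite (gt_eqF ak0) implybT.
by rewrite le_eqVlt; apply/orP; left; apply/eqP; rewrite /B; ring.
Qed.

End de_giorgi.

(** * Completeness of L^p and Rellich compactness *)

Section Lp_complete.
Local Open Scope ereal_scope.
Context d {T : measurableType d} {R : realType} (mu : {measure set T -> \bar R}).

Lemma limn_einf_le (u : (\bar R)^nat) (b : \bar R) N :
  (forall i, (N <= i)%N -> u i <= b) -> limn_einf u <= b.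
Proof.
move=> ub; rewrite limn_einf_lim; apply: lime_le; first exact: is_cvg_einfs.
apply: nearW => m; apply: (@le_trans _ _ (u (maxn N m))); last exact/ub/leq_maxl.
by apply: ereal_inf_lbound; exists (maxn N m) => //=; exact: leq_maxr.
Qed.

(** The increments form an absolutely convergent series, of which the sequence is the telescoped
    sum. *)
Lemma cvgn_geometric_increments (x : nat -> R) (C : R) :
  (forall j, `|x j.+1 - x j|%R <= C * (1 / 2) ^+ j)%R -> cvgn x.
Proof.
move=> xC.
have : cvgn (series (telescope x)).
  apply: normed_cvg; apply: (@series_le_cvg _ _ (geometric C (1 / 2)%R)) => [j|j|j|] /=.
  - exact: normr_ge0.
  - by apply: le_trans (xC j).
  - exact: xC.
  - by apply: is_cvg_geometric_series; rewrite ger0_norm ?divr_ge0//; lra.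
move=> cs; rewrite (_ : x = (fun j => x 0%N + series (telescope x) j)%R); last first.
  by apply/funext => j; exact: eq_sum_telescope.
by apply: is_cvgD => //; exact: is_cvg_cst.
Qed.

(** Riesz-Fischer with a rate: the limit is as close to the j-th term as all later terms are. The
    explicit rate lets limits of functions and of gradient components be taken along the same
    indices. *)
Lemma Lp_complete (p : R) (f_ : nat -> T -> R) : (0 < p)%R ->
  (forall j, measurable_fun setT (f_ j)) ->
  (forall j i, (j <= i)%N -> powint mu p (fun x => f_ i x - f_ j x)%R <= (((1 / 4) ^+ j) `^ p)%:E) ->
  exists f : T -> R, measurable_fun setT f /\
    forall j, powint mu p (fun x => f_ j x - f x)%R <= (((1 / 4) ^+ j) `^ p)%:E.
Proof.
move=> p0 mf fC.
(* The upper limit is defined and measurable everywhere; it is the limit wherever the sequence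
   converges. *)
pose f x := fine (limn_esup (fun j => (f_ j x)%:E)).
have mF : measurable_fun setT f.
  apply: (@measurableT_comp _ _ _ _ _ _ fine); first exact: fine_measurable.
  by apply: measurable_fun_limn_esup => j; exact/measurable_EFinP.
exists f; split => // j.
(* The weights 2^i leave integrals dominated by a geometric series of ratio 2^(-p), yet where the
   sum is finite they force increments of order 2^(-i), hence convergence. *)
pose g i x := (`|2 ^+ i * (f_ i.+1 x - f_ i x)| `^ p)%:E.
have mg i : measurable_fun setT (g i).
  by apply: measurable_powint; apply: measurable_funM => //; exact: measurable_funB.
have g0 i x : 0 <= g i x by rewrite lee_fin powR_ge0.
have gi i : \int[mu]_x g i x <= (((1 / 2) `^ p) ^+ i)%:E.
  rewrite -[X in X <= _]/(powint mu p (fun x => 2 ^+ i * (f_ i.+1 x - f_ i x))%R).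
  rewrite powintZ; last exact: measurable_funB.
  apply: (@le_trans _ _ ((`|2 ^+ i| `^ p)%:E * (((1 / 4) ^+ i) `^ p)%:E)).
    by apply: lee_wpmul2l; [rewrite lee_fin powR_ge0|exact: fC].
  rewrite -EFinM lee_fin -powRM ?exprn_ge0 ?divr_ge0// ger0_norm ?exprn_ge0//.
  rewrite -expr_powR ?divr_ge0// -exprMn (_ : 2 * (1 / 4) = 1 / 2 :> R)%R//; lra.
have Sfin : \int[mu]_x (\sum_(0 <= i <oo) g i x) < +oo.
  rewrite integral_nneseries//.
  have h1 : ((1 / 2) `^ p < 1 :> R)%R.
    have := @gt0_ltr_powR R p p0 (1 / 2)%R 1%R; rewrite powR1 !nnegrE; apply; lra.
  apply: (@le_lt_trans _ _ ((1 - (1 / 2) `^ p)^-1)%:E); last by rewrite ltry.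
  apply: lime_le; first by apply: is_cvg_nneseries => i _ _; apply: integral_ge0.
  apply: nearW => k; apply: (@le_trans _ _ (\sum_(0 <= i < k) (((1 / 2) `^ p) ^+ i)%:E)).
    by apply: lee_sum => i _; exact: gi.
  rewrite sumEFin lee_fin.
  rewrite (_ : \sum_(0 <= i < k) _ = series (geometric 1%R ((1 / 2) `^ p)) k)%R; last first.
    by rewrite seriesEnat; apply: eq_bigr => i _; rewrite exprn_geometric.
  rewrite geometric_seriesE ?lt_eqF//=; have := powR_ge0 (1 / 2 : R) p.
  move: (_ `^ p)%R h1 => z z1 z0; rewrite mul1r ler_piMl ?invr_ge0 ?subr_ge0 ?(ltW z1)//.
  by rewrite gerBl exprn_ge0.
have mS : measurable_fun setT (fun x => \sum_(0 <= i <oo) g i x).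
  by apply: ge0_emeasurable_sum => //.
have iS : mu.-integrable setT (fun x => \sum_(0 <= i <oo) g i x).
  apply/integrableP; split => //; apply: le_lt_trans Sfin.
  rewrite le_eqVlt; apply/orP; left; apply/eqP; apply: eq_integral => x _.
  by rewrite gee0_abs// nneseries_ge0.
have cv : {ae mu, forall x, setT x -> f_ i x @[i --> \oo] --> f x}.
  apply: filterS (integrable_ae measurableT iS) => x /(_ I) Sx _.
  have cx : cvgn (fun i => f_ i x).
    apply: (@cvgn_geometric_increments _ (fine (\sum_(0 <= i <oo) g i x) `^ p^-1)) => i.
    have gS : (g i x <= \sum_(0 <= i <oo) g i x).
      apply: le_trans (nneseries_lim_ge i.+1 _) => //.
      by rewrite big_nat_recr//= leeDr// sume_ge0.
    have : (`|2 ^+ i * (f_ i.+1 x - f_ i x)| `^ p <= fine (\sum_(0 <= i <oo) g i x))%R.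
      by rewrite -lee_fin fineK.
    move=> /(@ge0_ler_powR _ p^-1) H.
    have {}H := H (ltac:(by rewrite invr_ge0 ltW)) (ltac:(by rewrite nnegrE powR_ge0))
      (ltac:(by rewrite nnegrE fine_ge0// nneseries_ge0)).
    move: H; rewrite -powRrM divff ?gt_eqF// powRr1// normrM ger0_norm ?exprn_ge0// => H.
    by rewrite expr_div_n expr1n mulrA mulr1 ler_pdivlMr ?exprn_gt0// mulrC.
  have ce : (f_ i x)%:E @[i --> \oo] --> (limn (fun i => f_ i x))%:E.
    by apply: cvg_EFin => //; exact: nearW.
  by rewrite /f (cvg_limn_einf_sup ce).2.
have [mB mB'] : (forall i, measurable_fun setT (fun x => (`|f_ i x - f_ j x| `^ p)%:E)) /\
    measurable_fun setT (fun x => (`|f_ j x - f x| `^ p)%:E).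
  by split => [i|]; apply: measurable_powint; exact: measurable_funB.
(* Fatou's lemma, with j fixed and i tending to infinity, transfers the Cauchy bound to the
   limit. *)
apply: (@le_trans _ _ (\int[mu]_x limn_einf (fun i => (`|f_ i x - f_ j x| `^ p)%:E))).
  apply: ae_ge0_le_integral => //.
  - by move=> x _; rewrite limn_einf_lim; apply: lime_ge; [exact: is_cvg_einfs|
      apply: nearW => m; apply: le_ereal_inf_tmp => _ [i _ <-]; rewrite lee_fin powR_ge0].
  - rewrite (_ : (fun x => _) = (fun x => - limn_esup (fun i => - (`|f_ i x - f_ j x| `^ p)%:E))).
      apply: measurableT_comp => //; apply: measurable_fun_limn_esup => i.
      exact: measurableT_comp.
    by [].
  apply: filterS cv => x cx _.
  have ce : (`|f_ i x - f_ j x| `^ p)%:E @[i --> \oo] --> (`|f x - f_ j x| `^ p)%:E.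
    apply: cvg_EFin; first exact: nearW.
    by apply: powR_nneg_cvg => //; apply: cvg_norm; apply: cvgB; [exact: cx|exact: cvg_cst].
  by rewrite (cvg_limn_einf_sup ce).1 distrC.
apply: (@le_trans _ _ (limn_einf (fun i => powint mu p (fun x => f_ i x - f_ j x)%R))).
  by apply: fatou.
by apply: (@limn_einf_le _ _ j) => i ji; exact: fC.
Qed.
End Lp_complete.

(** * Rellich compactness *)

Section rellich.
Context {R : realType} {n : nat} (Omega : set 'rV[R]_n) (p : R) (p1 : 1 < p).
Local Notation mu := (rV_lebesgue_measure R n).
Implicit Types (phi : 'rV[R]_n -> R).

Let p0 : 0 < p. Proof. exact: lt_trans ltr01 p1. Qed.

(** A bounded sequence clusters at some l, and an ultrafilter containing no set near l would contain
    its complement. Ultrafilters replace repeated subsequences: finitely many such conditions are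
    simply intersected. *)
Lemma ultra_bounded (U : set_system nat) (a : nat -> R) (K e : R) : UltraFilter U ->
  (forall k, `|a k| <= K) -> 0 < e -> exists l, U [set k | `|a k - l| < e].
Proof.
move=> UU aK e0.
have FK : (a @ U) `[- K, K]%classic.
  by apply: nearW => k; rewrite /= in_itv/= -ler_norml.
have [l [_ cl]] := segment_compact _ FK; exists l.
have [//|UC] := in_ultra_setVsetC [set k | `|a k - l| < e] UU.
pose V : set R := [set y | `|y - l| < e].
have : nbhs (l : R) V.
  by apply/nbhs_normP; exists e => // y; rewrite /ball_ /= distrC.
have FC : (a @ U) (~` V) by exact: UC.
by move=> /(cl _ _ FC)[y []].
Qed.

(** Cells meeting a ball have integer coordinates between F and -F. Written as an ordinal minus |F|,
    they are indexed by a finite type. *)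
Lemma int_offset (z F : int) : F <= 0 -> F <= z -> z <= - F ->
  z = (inord (absz (z + (absz F)%:Z)) : 'I_(2 * absz F).+1)%:Z - (absz F)%:Z.
Proof. by move=> F0 Fz zF; rewrite inordK; lia. Qed.

Lemma small_powR (K e : R) : 0 <= K -> 0 < e ->
  exists2 eta, 0 < eta & eta `^ p * K <= e.
Proof.
move=> K0 e0; have K1 : 0 < K + 1 by rewrite ltr_wpDl.
have eK : 0 < e / (K + 1) by rewrite divr_gt0.
exists ((e / (K + 1)) `^ p^-1); first by rewrite powR_gt0.
rewrite -powRrM mulVf ?gt_eqF// powRr1 ?(ltW eK)// mulrAC ler_pdivrMr//.
by rewrite ler_wpM2l ?(ltW e0)// lerDl.
Qed.

Lemma small_mesh (c K e : R) : 0 <= c -> 0 <= K -> 0 < e ->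
  exists m, (c * m.+1%:R^-1) `^ p * K <= e.
Proof.
move=> c0 K0 e0; have [eta eta0 He] := small_powR K0 e0.
have c1 : 0 < c + 1 by rewrite ltr_wpDl.
have h : 0 < eta / (c + 1) by rewrite divr_gt0.
have [m _ Hm] := near_infty_natSinv_lt (PosNum h); exists m.
have /ltW := Hm m (leqnn m); rewrite /= ler_pdivlMr// => Hm'.
apply: le_trans He; rewrite ler_wpM2r//; apply: ge0_ler_powR.
- exact: ltW.
- by rewrite nnegrE mulr_ge0.
- by rewrite nnegrE ltW.
- by apply: le_trans Hm'; rewrite mulrC ler_wpM2l// lerDl.
Qed.

Definition cell_int m (z : 'rV[int]_n) phi :=
  \int[mu]_y (\1_[set x : 'rV[R]_n | grid m x = z] y * phi y).

(** Hoelder against the indicator of C. As the indicator is idempotent it can be kept on both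
    factors, so the right-hand side sees C only. *)
Lemma jensen_indic (C : set 'rV[R]_n) (c : R) (h : 'rV[R]_n -> R) : measurable C ->
  0 < c -> mu C = c%:E -> measurable_fun setT h ->
  ((\int[mu]_y (`|\1_C y * h y|)%:E) `^ p <=
    (c `^ (p - 1))%:E * powint mu p (fun y => (\1_C y * h y)%R))%E.
Proof.
move=> mC c0 CE mh; have q0 : 0 < p / (p - 1) by rewrite divr_gt0// subr_gt0.
have m1 : measurable_fun setT (\1_C : 'rV[R]_n -> R) by exact: measurable_indic.
have mch : measurable_fun setT (fun y => \1_C y * h y) by exact: measurable_funM.
have E1 : Np mu (p / (p - 1)) (\1_C : 'rV[R]_n -> R) = (c `^ ((p - 1) / p))%:E.
  rewrite Np_powint invf_div -poweR_EFin; congr (_ `^ _)%E.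
  rewrite -CE -[in RHS](setIT C) -integral_indic//; apply: eq_integral => y _.
  rewrite indicE; case: (y \in C); rewrite ?normr1 ?normr0 ?powR1// powR0//.
  by rewrite gt_eqF.
have := @hoelder_Np _ _ _ mu p (\1_C : 'rV[R]_n -> R) _ p1 m1 mch.
rewrite (eq_integral (fun y => (`|\1_C y * h y|)%:E)); last first.
  move=> y _; congr (`| _ |)%:E; rewrite !indicE.
  by case: (y \in C); rewrite ?mul1r ?mul0r ?mulr0.
rewrite E1 => H.
have I0 : (0 <= \int[mu]_y (`|\1_C y * h y|)%:E)%E by apply: integral_ge0.
apply: (@le_trans _ _ (((c `^ ((p - 1) / p))%:E * Np mu p (fun y => (\1_C y * h y)%R)) `^ p)%E).
  apply: gt0_ler_poweR => //; first exact: ltW.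
  - by rewrite in_itv/= I0 leey.
  - by rewrite in_itv/= leey andbT mule_ge0 ?Np_ge0// lee_fin powR_ge0.
rewrite poweRM ?Np_ge0 ?lee_fin ?powR_ge0// -powint_Np// poweR_EFin -powRrM divfK//.
by rewrite gt_eqF.
Qed.

Lemma integrable_cell m z (g : 'rV[R]_n -> R) (M : R) : measurable_fun setT g ->
  (forall x, `|g x| <= M) ->
  mu.-integrable setT (EFin \o (fun y => \1_[set x : 'rV[R]_n | grid m x = z] y * g y)).
Proof.
move=> mg gM; set C := [set x | _].
have [[x0 Cx0]|C0] := pselect (C !=set0); last first.
  rewrite (_ : EFin \o _ = fun=> 0%E); first exact: integrable0.
  apply/funext => y /=; rewrite indicE memNset ?mul0r// => Cy.
  by apply: C0; exists y.
apply: (@bounded_support_integrable _ _ _ M (`|x0| + m.+1%:R^-1)).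
- by apply: measurable_funM => //; apply: measurable_indic; exact: measurable_grid_fiber.
- move=> y; rewrite normrM indicE; case: (y \in C); rewrite ?normr1 ?mul1r//.
  by rewrite normr0 mul0r (le_trans _ (gM y)).
- move=> y yB; rewrite indicE memNset ?mul0r// => Cy.
  have /ltW : `|y - x0| < m.+1%:R^-1 by apply: grid_dist; rewrite Cy Cx0.
  move=> yx; move: yB; rewrite ltNge => /negP; apply.
  rewrite -[X in `|X| <= _](subrK x0).
  by rewrite (le_trans (ler_normD _ _))// addrC lerD2l.
Qed.

(** Compare phi(x) with its average over the cell of x: the deviation is an average of phi(x) -
    phi(y), bounded by Jensen, and the average itself is at most eta / d^n. The integral is written
    in the shift h = y - x, to suit the translation estimate. *)
Lemma cell_pointwise phi (eta : R) m x : test_function Omega phi -> 0 <= eta ->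
  `|cell_int m (grid m x) phi| <= eta ->
  let d : R := m.+1%:R^-1 in
  let Q := [set h : 'rV[R]_n | forall i,
     (const_mx (- d) : 'rV[R]_n) 0 i <= h 0 i < (const_mx (- d) : 'rV[R]_n) 0 i + 2 * d] in
  let F := fun z : 'rV[R]_n * 'rV[R]_n => (`|phi (z.1 + z.2) - phi z.1| `^ p * \1_Q z.2)%:E in
  measurable_fun setT F -> (forall z, (0 <= F z)%E) ->
  ((`|phi x| `^ p)%:E <= (2 `^ p * (d ^+ n) `^ (- 1))%:E * \int[mu]_h F (x, h)
     + (2 `^ p * (d ^+ n) `^ (- p) * eta `^ p)%:E)%E.
Proof.
move=> tf eta0 aeta d Q F mF F0.
have d0 : 0 < d by rewrite invr_gt0.
have dn0 : 0 < d ^+ n by rewrite exprn_gt0.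
have mphi := test_measurable tf; have [M M0 phiM] := test_bounded tf.
pose C := [set y : 'rV[R]_n | grid m y = grid m x].
have mC : measurable C by exact: measurable_grid_fiber.
have CE : mu C = (d ^+ n)%:E by exact: rV_lebesgue_grid_fiber.
have m1 : measurable_fun setT (\1_C : 'rV[R]_n -> R) by exact: measurable_indic.
pose h y := phi x - phi y.
have mh : measurable_fun setT h by exact: measurable_funB.
have hM y : `|h y| <= M + M by apply: (le_trans (ler_normB _ _)); exact: lerD.
have ih := integrable_cell m (grid m x) mh hM.
have ip := integrable_cell m (grid m x) mphi phiM.
pose I1 : R := \int[mu]_y `|\1_C y * h y|.
have I10 : 0 <= I1 by apply: Rintegral_ge0.
have S1 : d ^+ n * `|phi x| <= I1 + eta.
  have : \int[mu]_y (\1_C y * phi x) = d ^+ n * phi x.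
    rewrite RintegralZr//; last first.
      have := @integrable_cell m (grid m x) (cst 1) 1.
      rewrite (_ : (fun _ => _) = (\1_C : 'rV[R]_n -> R)); last first.
        by apply/funext => y; rewrite mulr1.
      by apply => // y; rewrite normr1.
    congr (_ * _); transitivity (fine (mu C)); last by rewrite CE.
    by rewrite -[in RHS](setIT C) -integral_indic.
  have -> : \int[mu]_y (\1_C y * phi x) = \int[mu]_y (\1_C y * h y + \1_C y * phi y).
    by apply: eq_Rintegral => y _; rewrite -mulrDr /h subrK.
  rewrite RintegralD// -[X in _ + X]/(cell_int m (grid m x) phi) => E.
  rewrite -[X in X * _](gtr0_norm dn0) -normrM -E.
  apply: (le_trans (ler_normD _ _)); apply: lerD => //.
  exact: le_normr_Rintegral.
have S2 : ((I1 `^ p)%:E <= ((d ^+ n) `^ (p - 1))%:E * \int[mu]_h F (x, h))%E.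
  have I1E : I1%:E = (\int[mu]_y (`|\1_C y * h y|)%:E)%E.
    by rewrite /I1 /Rintegral fineK//; apply: integrable_fin_num => //; exact: integrable_norm ih.
  rewrite -poweR_EFin I1E; apply: (le_trans (jensen_indic mC dn0 CE mh)).
  rewrite lee_wpmul2l ?lee_fin ?powR_ge0//.
  have mG : measurable_fun setT (fun y => (`|(\1_C y * h y)%R| `^ p)%:E).
    by apply: measurable_powint; exact: measurable_funM.
  rewrite /powint -(ge0_integral_rVD x mG); last by move=> y; rewrite lee_fin powR_ge0.
  apply: ge0_le_integral => //.
  - exact: (measurableT_comp mG (measurable_rV_translate x)).
  - exact: (measurableT_comp mF (pair1_measurable x)).
  move=> k _; rewrite lee_fin !indicE /=.
  case: (boolP (_ \in C)) => [|_]; last by rewrite mul0r normr0 powR0 ?gt_eqF// mulr_ge0 ?powR_ge0.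
  rewrite inE => /grid_dist; rewrite addrK => kd.
  (* Points of one cell differ by less than d in each coordinate, hence a cube of side 2 d centred
     at 0. *)
  have Qk : Q k.
    move=> i; have := le_lt_trans (le_coord_norm k i) kd; rewrite !mxE ltr_norml -/d; lra.
  by rewrite (mem_set Qk) mul1r mulr1 /h [k + x]addrC distrC.
have S3 : `|phi x| `^ p <= 2 `^ p * (d ^+ n) `^ (- p) * (I1 `^ p + eta `^ p).
  have : (d ^+ n * `|phi x|) `^ p <= 2 `^ p * (I1 `^ p + eta `^ p).
    apply: le_trans (powRD_le (ltW p0) I10 eta0).
    by apply: ge0_ler_powR; rewrite ?nnegrE ?addr_ge0 ?mulr_ge0 ?(ltW dn0) ?(ltW p0).
  rewrite powRM ?(ltW dn0)// => H.
  by rewrite mulrAC powRN ler_pdivlMr ?powR_gt0// mulrC.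
apply: (@le_trans _ _ ((2 `^ p * (d ^+ n) `^ (- p))%:E * (I1 `^ p)%:E +
    (2 `^ p * (d ^+ n) `^ (- p) * eta `^ p)%:E)%E).
  by rewrite -EFinM -EFinD lee_fin -mulrDr.
rewrite leeD2r//.
apply: (le_trans (lee_wpmul2l _ S2)); first by rewrite lee_fin mulr_ge0 ?powR_ge0.
rewrite muleA -EFinM le_eqVlt; apply/orP; left; apply/eqP; congr (_%:E * _)%E.
rewrite -mulrA -powRD; last by rewrite (gt_eqF dn0) implybT.
by congr (_ * _ `^ _); ring.
Qed.

(** A Poincare inequality on a mesh of side d = 1/(m + 1): integrate [cell_pointwise] in x, exchange
    the integrals and apply the translation estimate for each shift. The factor 2^n is the volume
    ratio of [Q] to a cell. *)
Lemma powint_cells phi (B eta : R) m : test_function Omega phi ->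
  (forall x, B < `|x| -> phi x = 0) -> 0 <= eta ->
  (forall x, `|x| <= B -> `|cell_int m (grid m x) phi| <= eta) ->
  (powint mu p phi <= (2 `^ p * 2 ^+ n * (n%:R * m.+1%:R^-1) `^ p)%:E *
     powint mu p (fun x => enorm (grad phi x)) +
   (2 `^ p * (m.+1%:R^-1 ^+ n) `^ (- p) * eta `^ p)%:E * mu [set x | `|x| <= B]%R)%E.
Proof.
move=> tf pB eta0 aeta; set d : R := m.+1%:R^-1.
have d0 : 0 < d by rewrite invr_gt0.
have dn0 : 0 < d ^+ n by rewrite exprn_gt0.
have mphi := test_measurable tf.
pose Q := [set h : 'rV[R]_n | forall i, (const_mx (- d) : 'rV[R]_n) 0 i <= h 0 i < (const_mx (- d) : 'rV[R]_n) 0 i + 2 * d].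
have mQ : measurable Q by exact: measurable_rV_box.
have QE : mu Q = ((2 * d) ^+ n)%:E by apply: rV_lebesgue_box; rewrite mulr_ge0// ltW.
have inQ h : `|h| < d -> Q h.
  move=> hd i; have := le_lt_trans (le_coord_norm h i) hd; rewrite !mxE ltr_norml; lra.
have Qin h : Q h -> `|h| <= d.
  move=> Qh; apply: rV_norm_le; first exact: ltW.
  by move=> i; have := Qh i; rewrite !mxE ler_norml; lra.
pose F := fun z : 'rV[R]_n * 'rV[R]_n => (`|phi (z.1 + z.2) - phi z.1| `^ p * \1_Q z.2)%:E.
have m1Q : measurable_fun setT (\1_Q : 'rV[R]_n -> R) by exact: measurable_indic.
have mF : measurable_fun setT F.
  apply/measurable_EFinP; apply: measurable_funM.
    apply: measurable_norm_powR; apply: measurable_funB.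
      exact: (measurableT_comp mphi measurable_rV_add).
    exact: measurableT_comp.
  exact: (measurableT_comp m1Q measurable_snd).
have F0 z : (0 <= F z)%E by rewrite lee_fin mulr_ge0 ?powR_ge0.
have mball := @measurable_rV_cball R n B.
pose b x : R := \1_[set x : 'rV[R]_n | `|x| <= B] x.
have mb : measurable_fun setT b by exact: measurable_indic.
have mFI : measurable_fun setT (fun x => \int[mu]_h F (x, h))%E.
  exact: measurable_fun_fubini_tonelli_F mF F0.
have FI0 x : (0 <= \int[mu]_h F (x, h))%E by apply: integral_ge0.
set E1 := (2 `^ p * (d ^+ n) `^ (- 1))%R; set E2 := (2 `^ p * (d ^+ n) `^ (- p) * eta `^ p)%R.
have E10 : 0 <= E1 by rewrite mulr_ge0 ?powR_ge0.
have E20 : 0 <= E2 by rewrite !mulr_ge0 ?powR_ge0.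
have pt x : ((`|phi x| `^ p)%:E <= E1%:E * \int[mu]_h F (x, h) + (E2 * b x)%:E)%E.
  have [xB|xB] := ltP B `|x|.
    rewrite pB// normr0 powR0 ?gt_eqF// adde_ge0 ?mule_ge0// lee_fin mulr_ge0//.
  have bx : b x = 1 by rewrite /b indicE mem_set.
  rewrite bx mulr1; exact: (cell_pointwise tf eta0 (aeta x xB) mF F0).
have H1 : (powint mu p phi <= E1%:E * \int[mu]_x \int[mu]_h F (x, h) +
    E2%:E * mu [set x | `|x| <= B]%R)%E.
  rewrite -[X in mu X]setIT -integral_indic//.
  rewrite -!ge0_integralZl_EFin//; last first.
    by apply/measurable_EFinP.
  rewrite -ge0_integralD//; last 4 first.
  - by move=> x _; rewrite mule_ge0.
  - exact: measurable_funeM.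
  - by move=> x _; rewrite mule_ge0// lee_fin indicE.
  - by apply: measurable_funeM; apply/measurable_EFinP.
  apply: ge0_le_integral => //.
  - exact: measurable_powint.
  - apply: emeasurable_funD; first exact: measurable_funeM.
    by apply: measurable_funeM; apply/measurable_EFinP.
apply: (le_trans H1); rewrite leeD2r//.
rewrite (@fubini_tonelli _ _ _ _ _ mu mu F mF F0).
set D := powint _ _ _.
have D0 : (0 <= D)%E by exact: powint_ge0.
have H2 : (\int[mu]_h \int[mu]_x F (x, h) <= ((n%:R * d) `^ p)%:E * D * ((2 * d) ^+ n)%:E)%E.
  rewrite -QE -[X in mu X]setIT -integral_indic//.
  rewrite -ge0_integralZl; [|exact: measurableT|by apply/measurable_EFinP
    |by move=> h _; rewrite lee_fin|by rewrite mule_ge0// lee_fin powR_ge0].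
  apply: ge0_le_integral => //.
  - by move=> h _; apply: integral_ge0.
  - exact: measurable_fun_fubini_tonelli_G mF F0.
  - by apply: measurable_funeM; apply/measurable_EFinP.
  move=> h _; rewrite /F indicE /=; case: (boolP (h \in Q)) => [|_]; last first.
    by rewrite mule0 integral0_eq// => x _; rewrite mulr0.
  rewrite inE => Qh; rewrite mule1.
  apply: (@le_trans _ _ (powint mu p (fun x => phi (x + h)%R - phi x)%R)).
    rewrite le_eqVlt; apply/orP; left; apply/eqP.
    by apply: eq_integral => x _; rewrite mulr1.
  apply: (le_trans (test_translate p1 h tf)).
  rewrite lee_wpmul2r// lee_fin.
  apply: ge0_ler_powR; rewrite ?nnegrE ?enorm_ge0 ?mulr_ge0 ?(ltW p0) ?(ltW d0)//.
  by apply: (le_trans (enorm_le_norm h)); rewrite ler_wpM2l//; exact: Qin.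
apply: (le_trans (lee_wpmul2l _ H2)); first by rewrite lee_fin.
rewrite muleAC -!EFinM muleA -EFinM lee_wpmul2r// lee_fin.
rewrite le_eqVlt; apply/orP; left; apply/eqP.
rewrite /E1 exprMn powR_inv1 ?(ltW dn0)//; field.
by rewrite gt_eqF.
Qed.

Lemma cell_intB m z phi psi : test_function Omega phi -> test_function Omega psi ->
  cell_int m z (fun y => phi y - psi y) = cell_int m z phi - cell_int m z psi.
Proof.
move=> tphi tpsi; have [M1 _ b1] := test_bounded tphi; have [M2 _ b2] := test_bounded tpsi.
rewrite /cell_int -RintegralB//; last 2 first.
- exact: (integrable_cell m z (test_measurable tphi) b1).
- exact: (integrable_cell m z (test_measurable tpsi) b2).
by apply: eq_Rintegral => y _; rewrite mulrBr.
Qed.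

(** By t <= 1 + t^p on the cell; the bound is uniform over the family, as [ultra_bounded]
    requires. *)
Lemma cell_int_bound m z phi (L : R) : test_function Omega phi ->
  (powint mu p phi <= L%:E)%E -> `|cell_int m z phi| <= (m.+1%:R^-1) ^+ n + L.
Proof.
move=> tphi phiL; have mphi := test_measurable tphi; have [M1 _ b1] := test_bounded tphi.
pose C := [set x : 'rV[R]_n | grid m x = z].
have mC : measurable C by exact: measurable_grid_fiber.
have m1 : measurable_fun setT (\1_C : 'rV[R]_n -> R) by exact: measurable_indic.
have i1 := integrable_cell m z mphi b1.
apply: (le_trans (le_normr_Rintegral measurableT i1)).
rewrite -lee_fin /Rintegral fineK; last first.
  by apply: integrable_fin_num => //; exact: integrable_norm i1.
apply: (@le_trans _ _ (\int[mu]_y ((\1_C y)%:E + (`|phi y| `^ p)%:E))%E); last first.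
  rewrite ge0_integralD//; last 2 first.
  - by apply/measurable_EFinP.
  - exact: measurable_powint.
  rewrite integral_indic// setIT.
  rewrite [X in (X + _)%E](_ : _ = (m.+1%:R^-1 ^+ n)%:E); last exact: rV_lebesgue_grid_fiber.
  by rewrite EFinD leeD2l.
apply: ge0_le_integral => //.
- by apply/measurable_EFinP; apply: measurableT_comp => //; exact: measurable_funM.
- apply: emeasurable_funD; first exact/measurable_EFinP.
  exact: measurable_powint.
move=> y _; rewrite -EFinD lee_fin normrM.
have t0 := normr_ge0 (phi y).
rewrite indicE; case: (y \in C); last by rewrite normr0 mul0r add0r powR_ge0.
rewrite normr1 mul1r; have [t1|t1] := leP `|phi y| 1.
  by rewrite (le_trans t1)// lerDl powR_ge0.
apply: (@le_trans _ _ (`|phi y| `^ p)); last by rewrite lerDr.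
rewrite -[X in X <= _](powRr1 t0); apply: ler_powR; exact: ltW.
Qed.

(** Bounded gradients make the sequence Cauchy in L^p along U. On a member of U all of the finitely
    many cell integrals lie within eta / 2 of their limits, and [powint_cells] is applied to the
    difference of two terms. *)
Lemma rellich (U : set_system nat) (phi : nat -> 'rV[R]_n -> R) (L e : R) :
  UltraFilter U -> bounded_set Omega -> (forall k, test_function Omega (phi k)) ->
  (forall k, powint mu p (phi k) <= L%:E)%E ->
  (forall k, powint mu p (fun x => enorm (grad (phi k) x)) <= L%:E)%E -> 0 < e ->
  exists2 A, U A & forall k l, A k -> A l ->
    (powint mu p (fun x => (phi k x - phi l x)%R) <= e%:E)%E.
Proof.
move=> UU [B0 [_ HB]] tf phiL gradL e0.
pose B := `|B0| + 1.
have OB x : B < `|x| -> ~ Omega x.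
  move=> xB Ox; have : B0 < B by rewrite /B; have := ler_norm B0; lra.
  by move=> /HB /(_ _ Ox) /=; rewrite leNgt xB.
have phi0 k x : B < `|x| -> phi k x = 0 by move=> /OB; exact: test_outside (tf k).
have L0 : 0 <= L by rewrite -lee_fin (le_trans (powint_ge0 mu p (phi 0%N)))//; exact: phiL.
pose V : R := fine (mu [set x | `|x| <= B]%R).
have VE : mu [set x | `|x| <= B]%R = V%:E.
  by rewrite fineK// ge0_fin_numE// rV_cball_lty.
have V0 : 0 <= V by rewrite -lee_fin -VE.
(* The gradient term is made small by the mesh, then the cell term by [eta]. *)
have [m Hm] : exists m : nat, 2 `^ p * 2 ^+ n * (n%:R * m.+1%:R^-1) `^ p * (2 `^ p * (L + L)) <= e / 2.
  have [|m Hm] := @small_mesh n%:R (2 `^ p * 2 ^+ n * (2 `^ p * (L + L))) (e / 2) (ler0n R n) _ (divr_gt0 e0 (ltr0n R 2)).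
    by rewrite !mulr_ge0 ?exprn_ge0 ?powR_ge0 ?addr_ge0.
  by exists m; apply: le_trans Hm; rewrite le_eqVlt; apply/orP; left; apply/eqP; ring.
have [eta eta0 Heta] : exists2 eta : R, 0 < eta &
    2 `^ p * (m.+1%:R^-1 ^+ n) `^ (- p) * eta `^ p * V <= e / 2.
  have [|eta eta0 Heta] := @small_powR (2 `^ p * (m.+1%:R^-1 ^+ n) `^ (- p) * V) (e / 2) _ (divr_gt0 e0 (ltr0n R 2)).
    by rewrite !mulr_ge0 ?powR_ge0.
  by exists eta => //; rewrite mulrAC mulrC.
pose N := (2 * `|Num.floor (- B * m.+1%:R)|)%N.+1.
pose cell (s : {ffun 'I_n -> 'I_N}) : 'rV[int]_n :=
  \row_i ((s i)%:Z - `|Num.floor (- B * m.+1%:R)|%:Z)%R.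
have cellP x : `|x| <= B -> exists s, grid m x = cell s.
  move=> xB; exists [ffun i => inord (absz (grid m x 0 i + `|Num.floor (- B * m.+1%:R)|%:Z))].
  have B0' : 0 <= B by rewrite addr_ge0.
  have F0 : (Num.floor (- B * m.+1%:R : R) <= 0)%R.
    by rewrite -(@floor0 R) le_floor// mulNr oppr_le0 mulr_ge0.
  apply/rowP => i; rewrite !mxE ffunE.
  have xi : - B <= x 0 i <= B by rewrite -ler_norml (le_trans (le_coord_norm x i)).
  have F1 : (Num.floor (- B * m.+1%:R : R) <= Num.floor (x 0 i * m.+1%:R))%R.
    by rewrite le_floor// ler_wpM2r//; case/andP: xi.
  have F2 : (Num.floor (x 0 i * m.+1%:R) <= - Num.floor (- B * m.+1%:R : R))%R.
    rewrite -(ler_int R) (le_trans (floor_le _))// mulrNz lerNr.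
    rewrite (le_trans (floor_le _))// mulNr lerN2 ler_wpM2r//; by case/andP: xi.
  by rewrite [grid m x 0 i]mxE; exact: int_offset.
have [l Hl] : exists l : {ffun 'I_n -> 'I_N} -> R,
    forall s, U [set k | `|cell_int m (cell s) (phi k) - l s| < eta / 2].
  have [|l Hl] := @choice {ffun 'I_n -> 'I_N} R
    (fun s t => U [set k | `|cell_int m (cell s) (phi k) - t| < eta / 2]); last by exists l.
  move=> s; apply: (@ultra_bounded U _ (m.+1%:R^-1 ^+ n + L)) => //.
    by move=> k; exact: cell_int_bound.
  by rewrite divr_gt0.
exists [set k | forall s, `|cell_int m (cell s) (phi k) - l s| < eta / 2].
  by apply: filter_forall => s; exact: Hl.
move=> k j Ak Aj.
have tkj := testB (tf k) (tf j).
apply: (le_trans (powint_cells (B := B) (eta := eta) (m := m) tkj _ _ _)).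
- by move=> x xB; rewrite !phi0// subrr.
- exact: ltW.
- move=> x xB; have [s ->] := cellP x xB; rewrite cell_intB//.
  have := Ak s; have := Aj s; rewrite !ltr_norml ler_norml; lra.
rewrite VE -EFinM (_ : e%:E = (e / 2)%:E + (e / 2)%:E)%E; last first.
  by rewrite -EFinD; congr EFin; field.
apply: leeD; last by rewrite lee_fin.
apply: (@le_trans _ _ ((2 `^ p * 2 ^+ n * (n%:R * m.+1%:R^-1) `^ p)%:E * (2 `^ p * (L + L))%:E)%E).
  rewrite lee_wpmul2l ?lee_fin ?mulr_ge0 ?exprn_ge0 ?powR_ge0//.
  have mg i := measurable_enorm (test_grad_measurable (tf i)).
  apply: (@le_trans _ _ ((2 `^ p)%:E * (powint mu p (fun x => enorm (grad (phi k) x)) +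
     powint mu p (fun x => enorm (grad (phi j) x))))%E).
    apply: powint_quasi => //; first exact: ltW.
      by apply: measurable_enorm; exact: test_grad_measurable tkj.
    move=> x; rewrite !ger0_norm ?enorm_ge0//.
    rewrite gradB; [|exact: test_differentiable (tf _)..].
    exact: enormB.
  by rewrite EFinM lee_wpmul2l ?lee_fin ?powR_ge0// EFinD leeD.
by rewrite -EFinM lee_fin.
Qed.

End rellich.

(** * The first eigenfunction *)

(** Integrates the uniform convexity inequality; the energy of the mean is kept on the left so that
    all integrands are nonnegative and may have infinite integrals. *)
Lemma powint_comb d (T : measurableType d) (R : realType)
    (mu : {measure set T -> \bar R}) (p : R) (f g h1 h2 : T -> R) (K C : R) :
  measurable_fun setT f -> measurable_fun setT g ->
  measurable_fun setT h1 -> measurable_fun setT h2 -> 0 <= K -> 0 <= C ->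
  (forall x, `|f x| `^ p + C * `|g x| `^ p <= K * (`|h1 x| `^ p + `|h2 x| `^ p)) ->
  (powint mu p f + C%:E * powint mu p g <= K%:E * (powint mu p h1 + powint mu p h2))%E.
Proof.
move=> mf mg m1 m2 K0 C0 H.
have pos (h : T -> R) x : (0 <= (`|h x| `^ p)%:E)%E by rewrite lee_fin powR_ge0.
have mp (h : T -> R) : measurable_fun setT h ->
  measurable_fun setT (fun x => (`|h x| `^ p)%:E) by exact: measurable_powint.
have -> : (powint mu p h1 + powint mu p h2 = \int[mu]_x ((`|h1 x| `^ p)%:E + (`|h2 x| `^ p)%:E))%E.
  by rewrite (ge0_integralD mu measurableT (fun x _ => pos h1 x) (mp _ m1) (fun x _ => pos h2 x) (mp _ m2)).
have m12 : measurable_fun setT (fun x => (`|h1 x| `^ p)%:E + (`|h2 x| `^ p)%:E)%E.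
  by apply: emeasurable_funD; exact: mp.
have p12 x : (0 <= (`|h1 x| `^ p)%:E + (`|h2 x| `^ p)%:E)%E by rewrite adde_ge0.
rewrite -(ge0_integralZl_EFin mu measurableT (fun x _ => p12 x) m12 K0).
rewrite {2}/powint -(ge0_integralZl_EFin mu measurableT (fun x _ => pos g x) (mp _ mg) C0).
have mCg : measurable_fun setT (fun x => (C%:E * (`|g x| `^ p)%:E)%E).
  by apply: measurable_funeM; exact: mp.
have pCg x : (0 <= C%:E * (`|g x| `^ p)%:E)%E by rewrite mule_ge0.
rewrite -(ge0_integralD mu measurableT (fun x _ => pos f x) (mp _ mf) (fun x _ => pCg x) mCg).
apply: ge0_le_integral => //.
- by move=> x _; rewrite adde_ge0.
- by apply: emeasurable_funD => //; exact: mp.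
- exact: measurable_funeM.
- by move=> x _; rewrite -EFinM -!EFinD -EFinM lee_fin.
Qed.

Lemma Np_le_powR d (T : measurableType d) (R : realType)
    (mu : {measure set T -> \bar R}) (p c : R) (f : T -> R) : 0 < p -> 0 <= c ->
  (powint mu p f <= (c `^ p)%:E)%E -> (Np mu p f <= c%:E)%E.
Proof.
move=> p0 c0 fc; rewrite Np_powint (_ : c%:E = (c `^ p)%:E `^ p^-1)%E; last first.
  by rewrite poweR_EFin -powRrM divff ?gt_eqF// powRr1.
apply: gt0_ler_poweR; rewrite ?invr_ge0 ?(ltW p0)//.
- by rewrite in_itv/= leey andbT powint_ge0.
- by rewrite in_itv/= leey andbT lee_fin powR_ge0.
Qed.

Section minimizer.
Context {R : realType} {n : nat} (Omega : set 'rV[R]_n) (p : R) (p1 : 1 < p).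
Local Notation mu := (rV_lebesgue_measure R n).
Local Notation Dint phi := (powint mu p (fun x => enorm (grad phi x))).
Implicit Types (phi psi u v : 'rV[R]_n -> R) (G H : 'rV[R]_n -> 'rV[R]_n).

Let p0 : 0 < p. Proof. exact: lt_trans ltr01 p1. Qed.
Let p1' : 1 <= p. Proof. exact: ltW. Qed.

(** The infimum runs over normalized test functions; the inequality reaches all of [W0] by density
    in [W0_rayleigh]. Without nonzero test functions it is the infimum of the empty set, 0. *)
Definition rayleigh_inf : R :=
  inf [set t | exists phi, [/\ test_function Omega phi, powint mu p phi = 1%E &
    Dint phi = t%:E]].

Lemma test_grad_powintE phi : test_function Omega phi -> Dint phi = (fine (Dint phi))%:E.
Proof. by move=> tf; rewrite fineK// ge0_fin_numE ?powint_ge0//; exact: test_grad_powint_lty tf. Qed.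

Lemma grad_powintZ phi (c : R) : test_function Omega phi -> 0 <= c ->
  Dint (fun x => c * phi x) = ((c `^ p)%:E * Dint phi)%E.
Proof.
move=> tf c0; rewrite -[in RHS](ger0_norm c0) -powintZ; last first.
  by apply: measurable_enorm; exact: test_grad_measurable tf.
apply: eq_powint => x; rewrite gradZ; last exact: test_differentiable tf.
by rewrite enormZ (ger0_norm c0).
Qed.

Lemma normalize_test phi : test_function Omega phi -> (0 < powint mu p phi)%E ->
  exists psi, [/\ test_function Omega psi, powint mu p psi = 1%E &
    Dint phi = (powint mu p phi * Dint psi)%E].
Proof.
move=> tf; set t := powint mu p phi => t0.
have tE : t = (fine t)%:E.
  by rewrite fineK// ge0_fin_numE ?(ltW t0)//; exact: test_powint_lty tf.
rewrite tE lte_fin in t0; rewrite tE; move: (fine t) t0 tE => s s0 tE.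
have cE : (s `^ (- p^-1)) `^ p = s^-1.
  by rewrite -powRrM mulNr mulVf ?gt_eqF// powR_inv1// ltW.
exists (fun x => s `^ (- p^-1) * phi x); split; first exact: testZ.
  rewrite powintZ; last exact: test_measurable tf.
  by rewrite ger0_norm ?powR_ge0// cE -/t tE -EFinM mulVf// gt_eqF.
by rewrite grad_powintZ ?powR_ge0// cE muleA -EFinM divff ?gt_eqF// mul1e.
Qed.

Lemma rayleigh_has_lbound : has_lbound [set t | exists phi, [/\ test_function Omega phi,
  powint mu p phi = 1%E & Dint phi = t%:E]].
Proof.
by exists 0 => t [phi [_ _ E]]; rewrite -lee_fin -E powint_ge0.
Qed.

Lemma rayleigh_inf_ge0 : 0 <= rayleigh_inf.
Proof.
rewrite /rayleigh_inf; set S := [set _ | _].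
have [S0|S0] := pselect (S !=set0); last first.
  have -> : S = set0 by apply/eqP/negP => /negP/set0P.
  by rewrite inf0.
by apply: lb_le_inf => // t [phi [_ _ E]]; rewrite -lee_fin -E powint_ge0.
Qed.

Lemma rayleigh_test phi : test_function Omega phi ->
  (rayleigh_inf%:E * powint mu p phi <= Dint phi)%E.
Proof.
move=> tf; have := powint_ge0 mu p phi; rewrite le_eqVlt => /predU1P[<-|t0].
  by rewrite mule0 powint_ge0.
have [psi [tpsi psi1 ->]] := normalize_test tf t0.
rewrite muleC; apply: lee_wpmul2l; first exact: ltW.
have D := test_grad_powintE tpsi; rewrite D lee_fin.
apply: ge_inf; first exact: rayleigh_has_lbound.
by exists psi; split.
Qed.

Lemma W0_rayleigh v H : W0 Omega p v H ->
  (rayleigh_inf%:E * powint mu p v <= powint mu p (fun x => enorm (H x)))%E.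
Proof.
move=> W; have [Nv NH] := W0_lty p1 W; case: W => mv mH WH.
set l := rayleigh_inf; have l0 : 0 <= l := rayleigh_inf_ge0.
set k := l `^ p^-1; have k0 : 0 <= k by exact: powR_ge0.
have kp : k `^ p = l by rewrite -powRrM mulVf ?gt_eqF// powRr1.
(* Taking p-th roots first makes the triangle inequality available for the approximation. *)
suff H1 : (k%:E * Np mu p v <= Np mu p (fun x => enorm (H x)))%E.
  rewrite (powint_Np _ v p0) (powint_Np _ (fun x => enorm _) p0) -kp -poweR_EFin.
  rewrite -poweRM ?Np_ge0 ?lee_fin//; apply: gt0_ler_poweR => //; first exact: ltW.
    by rewrite in_itv/= leey andbT mule_ge0 ?Np_ge0.
  by rewrite in_itv/= leey andbT Np_ge0.
apply/lee_addgt0Pr => e e0.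
have e1 : 0 < e / (1 + k) by rewrite divr_gt0// ltr_pwDl.
have [phi [tf v1 H1]] := WH _ e1.
have mphi := test_measurable tf; have mg := test_grad_measurable tf.
have R1 : (k%:E * Np mu p phi <= Np mu p (fun x => enorm (grad phi x)))%E.
  rewrite !Np_powint /k -poweR_EFin -poweRM ?powint_ge0 ?lee_fin//.
  apply: gt0_ler_poweR; rewrite ?invr_ge0 ?(ltW p0)//.
  - by rewrite in_itv/= leey andbT mule_ge0 ?powint_ge0.
  - by rewrite in_itv/= leey andbT powint_ge0.
  - exact: rayleigh_test.
have R2 : (Np mu p v <= Np mu p phi + (e / (1 + k))%:E)%E.
  apply: (@le_trans _ _ (Np mu p phi + Np mu p (fun x => (phi x - v x)%R))%E).
    apply: NpD => //; first exact: measurable_funB.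
    move=> x; have := ler_normB (phi x) (phi x - v x).
    by rewrite (_ : phi x - (phi x - v x) = v x)// opprB addrC subrK.
  by rewrite leeD2l// ltW.
have R3 : (Np mu p (fun x => enorm (grad phi x)) <= Np mu p (fun x => enorm (H x)) + (e / (1 + k))%:E)%E.
  apply: (@le_trans _ _ (Np mu p (fun x => enorm (H x)) + Np mu p (fun x => enorm (grad phi x - H x)))%E).
    apply: NpD => //; do ?by apply: measurable_enorm; rewrite //; exact: measurable_subrV.
    move=> x; rewrite !ger0_norm ?enorm_ge0//.
    by apply: le_trans (enormD _ _); rewrite addrC subrK.
  by rewrite leeD2l// ltW.
apply: (le_trans (lee_wpmul2l _ R2)); first by rewrite lee_fin.
rewrite ge0_muleDr ?Np_ge0 ?lee_fin ?(ltW e1)//.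
apply: (le_trans (leeD2r _ (le_trans R1 R3))).
rewrite -addeA leeD2l// -EFinM -EFinD lee_fin.
rewrite -{1}[e / (1 + k)]mul1r -mulrDl mulrC divfK//.
by rewrite gt_eqF// ltr_pwDl.
Qed.

(* A minimizing sequence is Cauchy in energy because the mean of two nearly
   minimal, nearly equal functions still has energy at least the infimum. *)
Lemma min_grad_le phi psi (e C d s : R) : test_function Omega phi -> test_function Omega psi ->
  0 <= e -> 0 <= C ->
  (forall a b : 'rV[R]_n, enorm (a - b) `^ p <= e * (enorm a `^ p + enorm b `^ p) +
    C * ((enorm a `^ p + enorm b `^ p) / 2 - enorm ((1 / 2) *: (a + b)) `^ p)) ->
  powint mu p phi = 1%E -> 
  (Dint phi <= (rayleigh_inf + d)%:E)%E -> (Dint psi <= (rayleigh_inf + d)%:E)%E ->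
  0 <= s -> s <= 1 -> (Np mu p (fun x => phi x - psi x)%R <= (2 * s)%:E)%E ->
  (powint mu p (fun x => enorm (grad phi x - grad psi x)) <=
    (2 * e * (rayleigh_inf + d) + C * (d + rayleigh_inf * (p * s)))%:E)%E.
Proof.
move=> tf tg e0 C0 HC phi1 phid psid s0 s1 Ns.
have l0 := rayleigh_inf_ge0.
pose m x := (1 / 2) * (phi x + psi x).
have tm : test_function Omega m by apply: testZ; exact: testD.
have gm x : grad m x = (1 / 2) *: (grad phi x + grad psi x).
  rewrite /m gradZ ?gradD//; do ?exact: test_differentiable (tf).
  - exact: test_differentiable tg.
  - exact: test_differentiable (testD tf tg).
have mphi := test_measurable tf; have mpsi := test_measurable tg.
have mm := test_measurable tm.
have m1 : (1 <= Np mu p m + s%:E)%E.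
  have -> : 1%E = Np mu p phi by rewrite Np_powint phi1 poweR1r.
  have mh : measurable_fun setT (fun x => (1 / 2) * (phi x - psi x)).
    by apply: measurable_funM => //; exact: measurable_funB.
  apply: (@le_trans _ _ (Np mu p m + Np mu p (fun x => (1 / 2) * (phi x - psi x))%R)%E).
    apply: NpD => // x; apply: le_trans (ler_normD _ _).
    by rewrite [X in _ <= `|X|](_ : _ = phi x)// /m; field.
  have HZ : (Np mu p (fun x => (1 / 2) * (phi x - psi x))%R <=
      (1 / 2)%:E * Np mu p (fun x => phi x - psi x)%R)%E.
    apply: NpZ_le => //; first exact: measurable_funB.
    by move=> x; rewrite normrM ger0_norm// divr_ge0.
  apply: (le_trans (leeD2l _ HZ)).
  rewrite leeD2l//; apply: (le_trans (lee_wpmul2l _ Ns)); first by rewrite lee_fin divr_ge0.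
  by rewrite -EFinM lee_fin; lra.
have Nm : ((1 - s)%:E <= Np mu p m)%E by rewrite EFinB leeBlDr.
(* The mean has norm at least 1 - s, since half the difference has norm at most s; then (1 - s)^p >=
   1 - p s by convexity at 1. *)
have Pm : ((1 - p * s)%:E <= powint mu p m)%E.
  apply: (@le_trans _ _ ((1 - s) `^ p)%:E).
    rewrite lee_fin; have := powR_tangent_le p1 (ler01) (_ : 0 <= 1 - s).
    rewrite !powR1 mulr1 subr_ge0 => /(_ s1); apply: le_trans.
    by rewrite le_eqVlt; apply/orP; left; apply/eqP; ring.
  rewrite powint_Np// -poweR_EFin; apply: gt0_ler_poweR => //; first exact: ltW.
  - by rewrite in_itv/= leey andbT lee_fin subr_ge0.
  - by rewrite in_itv/= leey andbT Np_ge0.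
have Em : ((rayleigh_inf * (1 - p * s))%:E <= Dint m)%E.
  apply: le_trans (rayleigh_test tm).
  by rewrite EFinM lee_wpmul2l ?lee_fin.
have mgf := measurable_enorm (test_grad_measurable tf).
have mgg := measurable_enorm (test_grad_measurable tg).
have mgm := measurable_enorm (test_grad_measurable tm).
have mgd : measurable_fun setT (fun x => enorm (grad phi x - grad psi x)).
  by apply: measurable_enorm; apply: measurable_subrV; [exact: test_grad_measurable tf|exact: test_grad_measurable tg].
have key : (powint mu p (fun x => enorm (grad phi x - grad psi x)) + C%:E * Dint m <=
    (e + C / 2)%:E * (Dint phi + Dint psi))%E.
  have eC : 0 <= e + C / 2 by rewrite addr_ge0// divr_ge0.
  apply: (@powint_comb _ _ _ mu p _ _ _ _ _ _ mgd mgm mgf mgg eC C0) => x.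
  rewrite gm !ger0_norm ?enorm_ge0//.
  have := HC (grad phi x) (grad psi x).
  move: (_ `^ p) (_ `^ p) (_ `^ p) (_ `^ p) => A1 A2 A3 A4 H.
  by rewrite -lerBrDr; apply: (le_trans H); rewrite le_eqVlt; apply/orP; left; apply/eqP; field.
have Dfin f : test_function Omega f -> exists t : R, Dint f = t%:E.
  by move=> tff; exists (fine (Dint f)); exact: test_grad_powintE.
have [E1 D1] := Dfin _ tm; have [E2 D2] := Dfin _ tf; have [E3 D3] := Dfin _ tg.
rewrite D1 in Em key; rewrite D2 in phid key; rewrite D3 in psid key.
rewrite lee_fin in Em; rewrite lee_fin in phid; rewrite lee_fin in psid.
have fin : (powint mu p (fun x => enorm (grad phi x - grad psi x)) <= ((e + C / 2) * (E2 + E3) - C * E1)%:E)%E.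
  by rewrite EFinB leeBrDr// EFinM EFinD EFinM.
apply: (le_trans fin); rewrite lee_fin.
have H1 : (e + C / 2) * (E2 + E3) <= (e + C / 2) * (2 * (rayleigh_inf + d)).
  by rewrite ler_wpM2l ?addr_ge0 ?divr_ge0//; lra.
have H2 : C * (rayleigh_inf * (1 - p * s)) <= C * E1 by rewrite ler_wpM2l.
lra.
Qed.

Lemma rayleigh_min_seq : (exists2 phi, test_function Omega phi & (0 < powint mu p phi)%E) ->
  exists phi : nat -> 'rV[R]_n -> R, [/\ forall k, test_function Omega (phi k),
    forall k, powint mu p (phi k) = 1%E &
    forall k, (Dint (phi k) <= (rayleigh_inf + k.+1%:R^-1)%:E)%E].
Proof.
move=> [phi0 t0 p0'].
have [psi [tpsi psi1 _]] := normalize_test t0 p0'.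
have H k : exists phi, [/\ test_function Omega phi, powint mu p phi = 1%E &
    (Dint phi <= (rayleigh_inf + k.+1%:R^-1)%:E)%E].
  have [|t [phi [tf f1 D]] /ltW h] := @inf_adherent _ [set t | exists phi,
      [/\ test_function Omega phi, powint mu p phi = 1%E & Dint phi = t%:E]]
      k.+1%:R^-1 (ltac:(by rewrite invr_gt0)).
    split; last exact: rayleigh_has_lbound.
    by exists (fine (Dint psi)); exists psi; split => //; exact: test_grad_powintE.
  by exists phi; split => //; rewrite D lee_fin.
have [phi Hphi] := @choice nat ('rV[R]_n -> R) _ H.
by exists phi; split => k; have [] := Hphi k.
Qed.

(** Gradients converge component by component, and n^(p-1) from [powR_sum_le] times n summands gives
    the factor n in the rate. Cutting the limits off outside Omega only decreases distances, as test
    functions and their gradients vanish there. *)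
Lemma W0_row_limit (phi : nat -> 'rV[R]_n -> R) : (0 < n)%N -> measurable Omega ->
  (forall k, test_function Omega (phi k)) ->
  (forall j i, (j <= i)%N -> (powint mu p (fun x => phi i x - phi j x)%R <= (((1 / 4) ^+ j) `^ p)%:E)%E) ->
  (forall j i, (j <= i)%N -> (powint mu p (fun x => enorm (grad (phi i) x - grad (phi j) x)) <= (((1 / 4) ^+ j) `^ p)%:E)%E) ->
  exists u G, [/\ measurable_fun setT u, measurable_fun setT G,
    forall x, ~ Omega x -> u x = 0 /\ G x = 0,
    forall j, (powint mu p (fun x => (phi j x - u x)%R) <= (((1 / 4) ^+ j) `^ p)%:E)%E &
    forall j, (powint mu p (fun x => enorm (grad (phi j) x - G x)) <= ((n%:R * (1 / 4) ^+ j) `^ p)%:E)%E].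
Proof.
move=> n0 mO tf C1 C2.
have mphi k := test_measurable (tf k); have mg k := test_grad_measurable (tf k).
have mc (k : nat) (i : 'I_n) : measurable_fun setT (fun x => grad (phi k) x 0 i).
  exact: measurable_rV_coordP.
have [u0 [mu0 Hu0]] := Lp_complete p0 mphi C1.
have CG i : exists g : 'rV[R]_n -> R, measurable_fun setT g /\
    forall j, (powint mu p (fun x => grad (phi j) x 0 i - g x)%R <= (((1 / 4) ^+ j) `^ p)%:E)%E.
  apply: (Lp_complete p0 (f_ := fun k x => grad (phi k) x 0 i)) => [k|j k jk]; first exact: mc.
  apply: le_trans (C2 j k jk); apply: le_powint; first exact: ltW.
  - exact: measurable_funB.
  - by apply: measurable_enorm; exact: measurable_subrV.
  - move=> x; rewrite [leRHS]ger0_norm ?enorm_ge0//.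
    by apply: le_trans (coord_le_enorm _ i); rewrite !mxE.
have [g0 Hg0] := @choice 'I_n ('rV[R]_n -> R) _ CG.
have mindic : measurable_fun setT (\1_Omega : 'rV[R]_n -> R) by exact: measurable_indic.
pose u x := \1_Omega x * u0 x.
pose G x : 'rV[R]_n := \row_i (\1_Omega x * g0 i x).
have mu_ : measurable_fun setT u by exact: measurable_funM.
have mG : measurable_fun setT G.
  apply: measurable_funrV => i; rewrite (_ : (fun _ => _) = fun x => \1_Omega x * g0 i x).
    by apply: measurable_funM => //; have [] := Hg0 i.
  by apply/funext => x; rewrite mxE.
have cut (a b : R) x : (~ Omega x -> a = 0) -> `|a - \1_Omega x * b| <= `|a - b|.
  move=> a0; rewrite indicE; case: (boolP (x \in Omega)); first by rewrite mul1r.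
  by move/negP; rewrite inE => /a0 ->; rewrite mul0r subrr normr0.
exists u, G; split; [exact: mu_|exact: mG| | |].
- move=> x Ox; split; first by rewrite /u indicE memNset ?mul0r.
  by apply/rowP => i; rewrite !mxE indicE memNset ?mul0r.
- move=> j; apply: le_trans (Hu0 j); apply: le_powint; first exact: ltW.
  + exact: measurable_funB.
  + exact: measurable_funB.
  + by move=> x; apply: cut => Ox; exact: test_outside (tf j) Ox.
move=> j; set q := ((1 / 4) ^+ j : R).
have q0 : 0 <= q by rewrite exprn_ge0// divr_ge0.
pose h i x := grad (phi j) x 0 i - g0 i x.
have mh i : measurable_fun setT (h i).
  by apply: measurable_funB; [exact: mc|have [] := Hg0 i].
apply: (@le_trans _ _ (\int[mu]_x \sum_(i < n) ((n%:R `^ (p - 1))%:E * (`|h i x| `^ p)%:E))%E).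
  apply: ge0_le_integral => //.
  - by apply: measurable_powint; apply: measurable_enorm; exact: measurable_subrV.
  - by apply: emeasurable_sum => i; apply: measurable_funeM; exact: measurable_powint.
  - move=> x _; under eq_bigr do rewrite -EFinM.
    rewrite sumEFin lee_fin ger0_norm ?enorm_ge0// -mulr_sumr.
    apply: le_trans (powR_sum_le p1 n0 (fun i => normr_ge0 (h i x))).
    apply: ge0_ler_powR; rewrite ?nnegrE ?enorm_ge0 ?sumr_ge0 ?(ltW p0)//.
    apply: (le_trans (enorm_le_sum _)); apply: ler_sum => i _.
    have -> : (grad (phi j) x - G x) 0 i = grad (phi j) x 0 i - \1_Omega x * g0 i x.
      by rewrite !mxE.
    by apply: cut => Ox; rewrite (grad_outside (tf j) Ox) mxE.
rewrite ge0_integral_sum//; last first.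
  by move=> i; apply: measurable_funeM; exact: measurable_powint.
apply: (@le_trans _ _ (\sum_(i < n) ((n%:R `^ (p - 1))%:E * (q `^ p)%:E))%E).
  apply: lee_sum => i _; rewrite ge0_integralZl_EFin ?powR_ge0//; last exact: measurable_powint.
  by rewrite lee_wpmul2l ?lee_fin ?powR_ge0//; have [_] := Hg0 i; exact.
under eq_bigr do rewrite -EFinM.
rewrite sumEFin sumr_const card_ord lee_fin -[leLHS]mulr_natl mulrA mulr_powRB1//.
by rewrite powRM.
Qed.

(* The two families of sets of indices where the functions, respectively their
   gradients, are mutually [e]-close belong to the ultrafilter. *)
Lemma min_seq_cauchy (U : set_system nat) (phi : nat -> 'rV[R]_n -> R) (e : R) :
  UltraFilter U -> \oo `<=` U -> bounded_set Omega ->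
  (forall k, test_function Omega (phi k)) -> (forall k, powint mu p (phi k) = 1%E) ->
  (forall k, Dint (phi k) <= (rayleigh_inf + k.+1%:R^-1)%:E)%E -> 0 < e ->
  exists2 A, U A & forall k l, A k -> A l ->
    (powint mu p (fun x => phi k x - phi l x)%R <= e%:E)%E /\
    (powint mu p (fun x => enorm (grad (phi k) x - grad (phi l) x)) <= e%:E)%E.
Proof.
move=> UU oU bO tf phi1 Dphi e0.
have l0 := rayleigh_inf_ge0.
have rel d : 0 < d -> exists2 A, U A & forall k l, A k -> A l ->
    (powint mu p (fun x => (phi k x - phi l x)%R) <= d%:E)%E.
  apply: (rellich p1 (L := 1 + (rayleigh_inf + 1)) UU bO tf) => k.
    by rewrite phi1 lee_fin lerDl addr_ge0.
  apply: (le_trans (Dphi k)); rewrite lee_fin.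
  have : k.+1%:R^-1 <= 1 :> R by rewrite invf_le1// ler1n.
  by move: (k.+1%:R^-1) => t t1; lra.
(* The bound of [min_grad_le] has three terms: [ee] makes the first at most e / 2, and then [s] and
   [d], chosen after the constant C, make each of the others at most e / 4. *)
pose ee := e / (2 * (2 * (rayleigh_inf + 1))).
have ee0 : 0 < ee by rewrite divr_gt0// !mulr_gt0// ltr_wpDl.
have [C C0 HC] := enorm_uniformly_convex (n := n) p1 ee0.
pose s := Num.min 1 (e / (4 * (C + 1) * (rayleigh_inf + 1) * p)).
have s0 : 0 < s.
  by rewrite lt_min ltr01/= divr_gt0// !mulr_gt0// ltr_wpDl.
have s1 : s <= 1 by rewrite ge_min lexx.
have Hs : C * (rayleigh_inf * (p * s)) <= e / 4.
  apply: (@le_trans _ _ ((C + 1) * ((rayleigh_inf + 1) * (p * s)))).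
    apply: ler_pM => //; rewrite ?mulr_ge0 ?(ltW p0) ?(ltW s0)//; first lra.
    by apply: ler_wpM2r; [rewrite mulr_ge0 ?(ltW p0) ?(ltW s0)|rewrite lerDl].
  have : s <= e / (4 * (C + 1) * (rayleigh_inf + 1) * p) by rewrite ge_min lexx orbT.
  rewrite ler_pdivlMr ?mulr_gt0 ?ltr_wpDl// => H.
  rewrite ler_pdivlMr//; apply: le_trans H; rewrite le_eqVlt; apply/orP; left; apply/eqP; ring.
pose d := Num.min 1 (e / (4 * (C + 1))).
have d0 : 0 < d by rewrite lt_min ltr01/= divr_gt0// mulr_gt0// ltr_wpDl.
have d1 : d <= 1 by rewrite ge_min lexx.
have Hd : C * d <= e / 4.
  have : d <= e / (4 * (C + 1)) by rewrite ge_min lexx orbT.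
  rewrite ler_pdivlMr ?mulr_gt0 ?ltr_wpDl// => H.
  have : 0 <= d by exact: ltW. lra.
have [A1 UA1 HA1] := rel e e0.
have [A2 UA2 HA2] := rel ((2 * s) `^ p) (powR_gt0 _ (mulr_gt0 (ltr0n R 2) s0)).
have UA3 : U [set k | k.+1%:R^-1 < d :> R].
  by apply: oU; exact: near_infty_natSinv_lt (PosNum d0).
exists (A1 `&` (A2 `&` [set k | k.+1%:R^-1 < d :> R])).
  by apply: filterI => //; exact: filterI.
move=> k l [k1 [k2 k3]] [l1' [l2 l3]]; split; first exact: HA1.
have Dd j : [set k | k.+1%:R^-1 < d :> R] j -> (Dint (phi j) <= (rayleigh_inf + d)%:E)%E.
  move=> /= jd; apply: (le_trans (Dphi j)); rewrite lee_fin lerD2l; exact: ltW.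
have Ns : (Np mu p (fun x => phi k x - phi l x)%R <= (2 * s)%:E)%E.
  have s20 : 0 <= 2 * s by rewrite mulr_ge0// ltW.
  by apply: Np_le_powR => //; exact: HA2.
apply: (le_trans (min_grad_le (tf k) (tf l) (ltW ee0) C0 HC (phi1 k) (Dd k k3) (Dd l l3) (ltW s0) s1 Ns)).
rewrite lee_fin [C * (_ + _)]mulrDr.
have : 2 * ee * (rayleigh_inf + d) <= e / 2.
  apply: (@le_trans _ _ (2 * ee * (rayleigh_inf + 1))).
    by apply: ler_wpM2l; [rewrite mulr_ge0 ?(ltW ee0)|rewrite lerD2l].
  rewrite /ee le_eqVlt; apply/orP; left; apply/eqP; field.
  by rewrite gt_eqF// ltr_wpDl.
lra.
Qed.

Lemma minimizer : (0 < n)%N -> measurable Omega -> bounded_set Omega ->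
  (exists2 phi, test_function Omega phi & (0 < powint mu p phi)%E) ->
  exists u G, [/\ W0 Omega p u G, forall x, ~ Omega x -> u x = 0 /\ G x = 0,
    powint mu p u = 1%E & powint mu p (fun x => enorm (G x)) = rayleigh_inf%:E].
Proof.
move=> n0 mO bO /rayleigh_min_seq[phi [tf phi1 Dphi]].
have l0 := rayleigh_inf_ge0.
have [U [UU oU]] := @ultraFilterLemma nat \oo _.
pose q j : R := ((1 / 4) ^+ j) `^ p.
have q0 j : 0 < q j by rewrite powR_gt0// exprn_gt0// divr_gt0.
have [A HA] := @choice nat (set nat) _ (fun j => let: ex_intro2 A UA HA :=
  min_seq_cauchy UU oU bO tf phi1 Dphi (q0 j) in ex_intro _ A (conj UA HA)).
(* From the ultrafilter back to a sequence: K j is picked in A 0, ..., A j and beyond j, so that the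
   terms have the geometric rate of [W0_row_limit] and energies within 1/(j + 1) of the infimum. *)
have BU m : U [set k | forall i, (i < m)%N -> A i k].
  elim: m => [|m IH]; first exact: filterS filterT.
  have [Am _] := HA m; apply: filterS2 Am IH => k Ak Hk i.
  by rewrite ltnS leq_eqVlt => /predU1P[->//|]; exact: Hk.
have BU' j : U ([set k | forall i, (i < j.+1)%N -> A i k] `&` [set k | (j <= k)%N]).
  by apply: filterI => //; apply: oU; exact: nbhs_infty_ge.
have [K HK] := @choice nat nat _ (fun j => filter_ex (BU' j)).
have KA j i : (j <= i)%N -> A j (K i) by move=> ji; have [+ _] := HK i; apply.
have [|j i ji|j i ji|u [G [mu_ mG uG0 Hu HG]]] := @W0_row_limit (fun j => phi (K j)) n0 mO.
- by move=> k.
- exact: ((HA j).2 _ _ (KA _ _ ji) (KA _ _ (leqnn j))).1.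
- exact: ((HA j).2 _ _ (KA _ _ ji) (KA _ _ (leqnn j))).2.
have r0 j : 0 <= ((1 / 4) ^+ j : R) by rewrite exprn_ge0// divr_ge0.
have Nu j : (Np mu p (fun x => phi (K j) x - u x)%R <= ((1 / 4) ^+ j)%:E)%E.
  exact: Np_le_powR.
have NG j : (Np mu p (fun x => enorm (grad (phi (K j)) x - G x)) <= (n%:R * (1 / 4) ^+ j)%:E)%E.
  by apply: Np_le_powR => //; rewrite mulr_ge0.
have c4 : (1 / 4 : R) ^+ j @[j --> \oo] --> (0 : R).
  by apply: cvg_expr; rewrite ger0_norm ?divr_ge0//; lra.
have small (e : R) : 0 < e -> exists j, (1 / 4) ^+ j < e.
  move=> e0; have /cvgr0Pnorm_lt/(_ _ e0)[j _ /(_ j (leqnn j))] := c4.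
  by rewrite /= ger0_norm//; exists j.
have mphi k := test_measurable (tf k); have mg k := test_grad_measurable (tf k).
have W : W0 Omega p u G.
  split => // e e0; have [j Hj] := small (e / n.+1%:R) (divr_gt0 e0 (ltr0n R n.+1)).
  have {}Hj : n.+1%:R * (1 / 4) ^+ j < e by rewrite mulrC -ltr_pdivlMr.
  exists (phi (K j)); split => //.
    apply: (le_lt_trans (Nu j)); rewrite lte_fin; apply: le_lt_trans Hj.
    by rewrite ler_peMl// ler1n.
  apply: (le_lt_trans (NG j)); rewrite lte_fin; apply: le_lt_trans Hj.
  by rewrite ler_wpM2r// ler_nat.
have Nphi k : Np mu p (phi k) = 1%E by rewrite Np_powint phi1 poweR1r.
have u1 : Np mu p u = 1%E.
  apply/eqP; rewrite eq_le; apply/andP; split; apply/lee_addgt0Pr => e e0;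
    have [j /ltW Hj] := small e e0.
    rewrite -(Nphi (K j)); apply: le_trans (leeD2l _ (le_trans (Nu j) (_ : _ <= e%:E)%E)) => //.
    apply: NpD => //; first exact: measurable_funB.
    move=> x; have := ler_normB (phi (K j) x) (phi (K j) x - u x).
    by rewrite (_ : phi (K j) x - (phi (K j) x - u x) = u x)// opprB addrC subrK.
  rewrite -(Nphi (K j)); apply: le_trans (leeD2l _ (le_trans (Nu j) (_ : _ <= e%:E)%E)) => //.
  apply: NpD => //; first exact: measurable_funB.
  by move=> x; apply: le_trans (ler_normD _ _); rewrite addrC subrK.
have pu1 : powint mu p u = 1%E by rewrite powint_Np// u1 poweR1r.
exists u, G; split => //; apply/eqP; rewrite eq_le; apply/andP; split; last first.
  by have := W0_rayleigh W; rewrite pu1 mule1.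
(* Bound on |G|_p by the norm of the j-th gradient plus its distance to G; it tends to the p-th root
   of the infimum. *)
pose v j : R := (rayleigh_inf + j.+1%:R^-1) `^ p^-1 + n%:R * (1 / 4) ^+ j.
have cv : v j @[j --> \oo] --> rayleigh_inf `^ p^-1.
  rewrite -[X in _ --> X]addr0; apply: cvgD; last first.
    by rewrite -(mulr0 n%:R); apply: cvgMr; exact: c4.
  apply: powR_nneg_cvg => //; [by rewrite invr_gt0|by move=> j; rewrite addr_ge0|].
  by rewrite -[X in _ --> X]addr0; apply: cvgD; [exact: cvg_cst|exact: cvg_harmonic].
have NGv j : (Np mu p (fun x => enorm (G x)) <= (v j)%:E)%E.
  rewrite /v EFinD; apply: le_trans (leeD2l _ (NG j)).
  apply: (@le_trans _ _ (Np mu p (fun x => enorm (grad (phi (K j)) x)) +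
      Np mu p (fun x => enorm (grad (phi (K j)) x - G x)))%E).
    apply: NpD => //; do ?by apply: measurable_enorm; rewrite //; exact: measurable_subrV.
    move=> x; rewrite !ger0_norm ?enorm_ge0//.
    have := enormB (grad (phi (K j)) x) (grad (phi (K j)) x - G x).
    by rewrite (_ : grad (phi (K j)) x - (grad (phi (K j)) x - G x) = G x)// opprB addrC subrK.
  rewrite leeD2r// Np_powint -poweR_EFin; apply: gt0_ler_poweR.
  - by rewrite invr_ge0 ltW.
  - by rewrite in_itv/= leey andbT powint_ge0.
  - by rewrite in_itv/= leey andbT lee_fin addr_ge0.
  apply: (le_trans (Dphi (K j))); rewrite lee_fin lerD2l lef_pV2 ?posrE// ler_nat ltnS.
  by have [] := HK j.
have NGl : (Np mu p (fun x => enorm (G x)) <= (rayleigh_inf `^ p^-1)%:E)%E.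
  apply/lee_addgt0Pr => e e0.
  have /cvgrPdist_lt/(_ _ e0)[j _ /(_ j (leqnn j)) /=] := cv.
  rewrite distrC => /ltr_distlDr/ltW H.
  by apply: (le_trans (NGv j)); rewrite -EFinD lee_fin.
rewrite powint_Np// (_ : rayleigh_inf%:E = (rayleigh_inf `^ p^-1)%:E `^ p)%E; last first.
  by rewrite poweR_EFin -powRrM mulVf ?gt_eqF// powRr1.
apply: gt0_ler_poweR => //; first exact: ltW.
- by rewrite in_itv/= leey andbT Np_ge0.
- by rewrite in_itv/= leey andbT lee_fin powR_ge0.
Qed.

End minimizer.

(** * The Euler-Lagrange equation of a minimizer *)

Section eigenfunction.
Context {R : realType} {n : nat} (Omega : set 'rV[R]_n) (p : R) (p1 : 1 < p).
Local Notation mu := (rV_lebesgue_measure R n).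
Implicit Types (phi psi u v : 'rV[R]_n -> R) (G H : 'rV[R]_n -> 'rV[R]_n).

Let p0 : 0 < p. Proof. exact: lt_trans ltr01 p1. Qed.

Lemma W0D u v G H : W0 Omega p u G -> W0 Omega p v H ->
  W0 Omega p (fun x => u x + v x) (fun x => G x + H x).
Proof.
move=> [mu_ mG WG] [mv mH WH]; split; first exact: measurable_funD.
  apply: measurable_funrV => i.
  rewrite (_ : (fun _ => _) = fun x => G x 0 i + H x 0 i); last by apply/funext => x; rewrite mxE.
  by apply: measurable_funD; exact: measurable_rV_coordP.
move=> e e0; have e2 : 0 < e / 2 by rewrite divr_gt0.
have [phi [tf pu pG]] := WG _ e2; have [psi [tg qv qH]] := WH _ e2.
have eE : (e%:E = (e / 2)%:E + (e / 2)%:E)%E by rewrite -EFinD; congr EFin; field.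
have mphi := test_measurable tf; have mpsi := test_measurable tg.
have mgf := test_grad_measurable tf; have mgg := test_grad_measurable tg.
exists (fun x => phi x + psi x); split; first exact: testD.
  apply: (@le_lt_trans _ _ (Np mu p (fun x => phi x - u x)%R + Np mu p (fun x => psi x - v x)%R)%E).
    apply: NpD => //; do ?exact: measurable_funB; first exact: ltW.
      by apply: measurable_funB; exact: measurable_funD.
    by move=> x; apply: le_trans (ler_normD _ _); rewrite addrACA -opprD.
  by rewrite eE lteD.
have gE x : grad (fun y => phi y + psi y) x = grad phi x + grad psi x.
  by apply: gradD; [exact: test_differentiable tf|exact: test_differentiable tg].
apply: (@le_lt_trans _ _ (Np mu p (fun x => enorm (grad phi x - G x)) + Np mu p (fun x => enorm (grad psi x - H x)))%E).
  apply: NpD; first exact: ltW.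
  - by apply: measurable_enorm; exact: measurable_subrV.
  - by apply: measurable_enorm; exact: measurable_subrV.
  - apply: measurable_enorm; apply: measurable_subrV.
      exact: test_grad_measurable (testD tf tg).
    apply: measurable_funrV => i.
    rewrite (_ : (fun _ => _) = fun x => G x 0 i + H x 0 i); last by apply/funext => x; rewrite mxE.
    by apply: measurable_funD; exact: measurable_rV_coordP.
  move=> x; rewrite gE !ger0_norm ?enorm_ge0//; apply: le_trans (enormD _ _).
  by rewrite addrACA -opprD.
by rewrite eE lteD.
Qed.

Lemma powR_signed_tangent (x h : R) :
  `|x| `^ p + p * (`|x| `^ (p - 2) * x) * h <= `|x + h| `^ p.
Proof.
have [->|x0] := eqVneq x 0.
  by rewrite normr0 mulr0 mulr0 mul0r addr0 powR0 ?gt_eqF// powR_ge0.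
have nx : 0 < `|x| by rewrite normr_gt0.
apply: le_trans (powR_tangent_le p1 (normr_ge0 x) (normr_ge0 (x + h))).
rewrite lerD2l -!mulrA; apply: ler_wpM2l; first exact: ltW.
have -> : `|x| `^ (p - 1) = `|x| `^ (p - 2) * `|x|.
  rewrite -[X in _ = _ * X](powRr1 (normr_ge0 x)) -powRD; last by rewrite (gt_eqF nx) implybT.
  by congr (_ `^ _); ring.
rewrite -mulrA; apply: ler_wpM2l; first exact: powR_ge0.
have H1 : x * (x + h) <= `|x| * `|x + h| by rewrite -normrM ler_norm.
have H2 : `|x| * `|x| = x * x by rewrite -normrM ger0_norm// -expr2 sqr_ge0.
lra.
Qed.

Lemma normr_powR_pred (t : R) : `| `|t| `^ (p - 2) * t| = `|t| `^ (p - 1).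
Proof.
have [->|t0] := eqVneq t 0.
  by rewrite mulr0 normr0 powR0// gt_eqF// subr_gt0.
rewrite normrM (ger0_norm (powR_ge0 _ _)) -[X in _ * X](powRr1 (normr_ge0 t)) -powRD.
  by congr (_ `^ _); ring.
by rewrite normr_eq0 t0 implybT.
Qed.

Lemma measurable_powR_pred d (T : measurableType d) (D : set T) (f : T -> R) :
  measurable_fun D f -> measurable_fun D (fun x => `|f x| `^ (p - 2) * f x).
Proof. by move=> mf; apply: measurable_funM => //; exact: measurable_norm_powR. Qed.

Lemma measurable_pvec G : measurable_fun setT G -> measurable_fun setT (fun x => pvec p (G x)).
Proof.
by move=> mG; apply: measurable_scalerV => //; exact: measurable_enorm_powR.
Qed.

Lemma Np_conj_lty (f : 'rV[R]_n -> R) g : (forall x, `|g x| = `|f x| `^ (p - 1)) ->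
  (Np mu p f < +oo)%E -> (Np mu (p / (p - 1)) g < +oo)%E.
Proof.
move=> gf fo; have q0 : 0 < p / (p - 1) by rewrite divr_gt0// subr_gt0.
apply: Np_lty => //.
rewrite (eq_powint mu _ (g := fun x => `|f x| `^ (p - 1))); last first.
  by move=> x; rewrite gf [RHS]ger0_norm// powR_ge0.
by rewrite Np_conj//; exact: powint_lty.
Qed.

Lemma cvg_dotrV (w : nat -> 'rV[R]_n) (z c : 'rV[R]_n) :
  w j @[j --> \oo] --> z -> dotrV (w j) c @[j --> \oo] --> dotrV z c.
Proof.
move=> wz; rewrite /dotrV.
apply: (@cvg_big R 'I_n +%R 0 xpredT (@add_continuous R) nat \oo) => i _.
apply: cvgMr_tmp.
exact: (cvg_comp _ _ wz (@coord_continuous _ _ _ 0 i z)).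
Qed.

Lemma cvg_pvec (w : nat -> 'rV[R]_n) (z : 'rV[R]_n) :
  w j @[j --> \oo] --> z -> pvec p (w j) @[j --> \oo] --> pvec p z.
Proof.
have cp : {for z, continuous (pvec p : 'rV[R]_n -> 'rV[R]_n)} by exact: continuous_pvec.
by move=> wz; exact: (cvg_comp _ _ wz cp).
Qed.

Lemma Rintegral_affine_le d (T : measurableType d) (nu : {measure set T -> \bar R})
    (f g h : T -> R) (k : R) : nu.-integrable setT (EFin \o f) ->
  nu.-integrable setT (EFin \o g) -> nu.-integrable setT (EFin \o h) ->
  (forall x, f x + k * g x <= h x) ->
  \int[nu]_x f x + k * \int[nu]_x g x <= \int[nu]_x h x.
Proof.
move=> If Ig Ih H.
have Ikg : nu.-integrable setT (EFin \o (fun x => k * g x)) by exact: (integrableZl _ k Ig).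
rewrite -RintegralZl// -RintegralD//; apply: le_Rintegral => //.
exact: (integrableD _ If Ikg).
Qed.

Let variation_arith (l k A B I J : R) : 0 <= l -> 0 < k ->
  1 + k * B <= A -> l * A <= J -> J - k * I <= l -> l * B <= I.
Proof.
move=> l0 k0 H1 H2 H3; rewrite -(ler_pM2l k0).
have := ler_wpM2l l0 H1; rewrite mulrDr mulr1 => H4.
have -> : k * (l * B) = l * (k * B) by ring.
lra.
Qed.

(* One-sided variation: for a minimizer [u], the convexity inequality of [|.|^p]
   at [G + t grad psi] bounds the difference quotient from above. *)
Lemma euler_lagrange_le u G psi : W0 Omega p u G -> test_function Omega psi ->
  powint mu p u = 1%E -> powint mu p (fun x => enorm (G x)) = (rayleigh_inf Omega p)%:E ->
  rayleigh_inf Omega p * \int[mu]_x (`|u x| `^ (p - 2) * u x * psi x) <=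
  \int[mu]_x dotrV (pvec p (G x)) (grad psi x).
Proof.
move=> W tf u1 G1; have [Nu NG] := W0_lty p1 W; have [mu_ mG _] := W.
have l0 := rayleigh_inf_ge0 Omega p.
set l := rayleigh_inf _ _ in G1 l0 *.
have mpsi := test_measurable tf; have mg := test_grad_measurable tf.
have Npsi : (Np mu p psi < +oo)%E by apply: Np_lty => //; exact: test_powint_lty tf.
have Ngp : (Np mu p (fun x => enorm (grad psi x)) < +oo)%E.
  by apply: Np_lty => //; exact: test_grad_powint_lty tf.
pose T (j : nat) : R := j.+1%:R^-1.
have T0 j : 0 < T j by rewrite invr_gt0.
have T1 j : T j <= 1 by rewrite invf_le1// ler1n.
pose F j x := G x + T j *: grad psi x.
have mF j : measurable_fun setT (F j).
  apply: measurable_funrV => i.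
  rewrite (_ : (fun _ => _) = fun x => G x 0 i + T j * grad psi x 0 i); last first.
    by apply/funext => x; rewrite !mxE.
  by apply: measurable_funD; [|apply: measurable_funM => //]; exact: measurable_rV_coordP.
pose D x := enorm (G x) + enorm (grad psi x).
have mD : measurable_fun setT D by apply: measurable_funD; exact: measurable_enorm.
have D0 x : 0 <= D x by rewrite addr_ge0 ?enorm_ge0.
have ND : (Np mu p D < +oo)%E.
  apply: (@le_lt_trans _ _ (Np mu p (fun x => enorm (G x)) + Np mu p (fun x => enorm (grad psi x)))%E).
    apply: NpD; [exact: ltW|exact: measurable_enorm|exact: measurable_enorm|exact: mD|].
    by move=> x; rewrite /D !ger0_norm ?enorm_ge0 ?addr_ge0 ?enorm_ge0.
  exact (lte_add_pinfty NG Ngp).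
have FD j x : enorm (F j x) <= D x.
  apply: (le_trans (enormD _ _)); rewrite /D lerD2l enormZ ger0_norm ?(ltW (T0 j))//.
  by rewrite ler_piMl ?enorm_ge0.
(* As the steps T j are at most 1, all |F j| are below [D]; this product is integrable by Hoelder
   and dominates the fluxes uniformly in j. *)
pose dom x := D x `^ (p - 1) * enorm (grad psi x).
have idom : mu.-integrable setT (EFin \o dom).
  apply: (hoelder_integrable p1) => //.
  - exact: (measurableT_comp (measurable_powR _) mD).
  - exact: measurable_enorm.
  - by apply: (Np_conj_lty (f := D)) => // x; rewrite ger0_norm ?powR_ge0// (ger0_norm (D0 x)).
have bd z x : enorm z <= D x -> `|dotrV (pvec p z) (grad psi x)| <= dom x.
  move=> zD; apply: (le_trans (CauchySchwarz_dotrV _ _)); rewrite enorm_pvec//.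
  rewrite ler_wpM2r ?enorm_ge0//; apply: ge0_ler_powR; rewrite ?nnegrE ?enorm_ge0 ?D0//.
  by rewrite subr_ge0 ltW.
have mdot H : measurable_fun setT H -> measurable_fun setT (fun x => dotrV (pvec p (H x)) (grad psi x)).
  by move=> mH; apply: measurable_dotrV => //; exact: measurable_pvec.
have idot H : measurable_fun setT H -> (forall x, enorm (H x) <= D x) ->
    mu.-integrable setT (EFin \o (fun x => dotrV (pvec p (H x)) (grad psi x))).
  move=> mH HD; apply: le_integrable idom => //.
    by apply/measurable_EFinP; exact: mdot.
  by move=> x _; rewrite lee_fin (ger0_norm (_ : 0 <= dom x)) ?bd// mulr_ge0 ?powR_ge0 ?enorm_ge0.
have iu : mu.-integrable setT (EFin \o (fun x => `|u x| `^ (p - 2) * u x * psi x)).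
  apply: (hoelder_integrable p1) => //; first exact: measurable_powR_pred.
  by apply: (Np_conj_lty (f := u)) => // x; exact: normr_powR_pred.
have key j : l * \int[mu]_x (`|u x| `^ (p - 2) * u x * psi x) <=
    \int[mu]_x dotrV (pvec p (F j x)) (grad psi x).
  have W1 := W0D W (W0_test p1 (testZ (T j) tf)).
  have FE : (fun x => G x + grad (fun y => T j * psi y) x) = F j.
    by apply/funext => x; rewrite /F gradZ//; exact: test_differentiable tf.
  rewrite FE in W1; have [Nv NF] := W0_lty p1 W1; have [mv _ _] := W1.
  have := W0_rayleigh p1 W1; rewrite -/l.
  have iv := powint_integrable mv (powint_lty p0 Nv).
  have iF := powint_integrable (measurable_enorm (mF j)) (powint_lty p0 NF).
  have iu' := powint_integrable mu_ (powint_lty p0 Nu).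
  have iG := powint_integrable (measurable_enorm mG) (powint_lty p0 NG).
  have fE (h : 'rV[R]_n -> R) : mu.-integrable setT (fun x => (`|h x| `^ p)%:E) ->
      powint mu p h = (\int[mu]_x (`|h x| `^ p))%:E.
    by move=> ih; rewrite /Rintegral fineK//; exact: integrable_fin_num.
  rewrite (fE _ iv) (fE _ iF) -EFinM lee_fin => R1.
  have E1 : \int[mu]_x (`|u x| `^ p) = 1 by apply: EFin_inj; rewrite -(fE _ iu').
  have E2 : \int[mu]_x (`|enorm (G x)| `^ p) = l by apply: EFin_inj; rewrite -(fE _ iG).
  (* Convexity is used at opposite base points: at u for the L^p integral, at the perturbed gradient
     [F j] for the energy. Both inequalities then combine with the Rayleigh bound for the perturbed
     pair, leaving only the flux at [F j] to pass to the limit. *)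
  have R2 : 1 + p * T j * \int[mu]_x (`|u x| `^ (p - 2) * u x * psi x) <=
      \int[mu]_x (`|u x + T j * psi x| `^ p).
    have := Rintegral_affine_le (k := p * T j) iu' iu iv; rewrite E1; apply => x.
    apply: le_trans (powR_signed_tangent (u x) (T j * psi x)).
    by rewrite le_eqVlt; apply/orP; left; apply/eqP; ring.
  have R3 : \int[mu]_x (`|enorm (F j x)| `^ p) - p * T j * \int[mu]_x dotrV (pvec p (F j x)) (grad psi x) <= l.
    have := Rintegral_affine_le (k := - (p * T j)) iF (idot _ (mF j) (FD j)) iG.
    rewrite E2 mulNr; apply => x; rewrite !ger0_norm ?enorm_ge0//.
    have := enorm_powR_tangent p1 (F j x) (- (T j *: grad psi x)).
    have -> : F j x - T j *: grad psi x = G x by rewrite /F addrK.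
    apply: le_trans; rewrite dotrVNr dotrVZr le_eqVlt; apply/orP; left; apply/eqP; ring.
  exact: (variation_arith l0 (mulr_gt0 p0 (T0 j)) R2 R1 R3).
have cvI : \int[mu]_x dotrV (pvec p (F j x)) (grad psi x) @[j --> \oo] -->
    \int[mu]_x dotrV (pvec p (G x)) (grad psi x).
  apply: fine_cvg; rewrite fineK; last first.
    apply: integrable_fin_num => //; apply: idot => // x.
    by rewrite lerDl enorm_ge0.
  apply: (dominated_cvg_EFin (g := dom)) => //.
  - by move=> j; exact: mdot.
  - move=> x; apply: cvg_dotrV.
    have cF : F j x @[j --> \oo] --> G x.
      rewrite -[X in _ --> X]addr0 -(scale0r (grad psi x)).
      by apply: cvgD; [exact: cvg_cst|apply: cvgZr_tmp; exact: cvg_harmonic].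
    exact: cvg_pvec cF.
  - by move=> j x; exact: bd.
rewrite -(cvg_lim _ cvI)//; apply: limr_ge; last exact: nearW.
by apply/cvg_ex; eexists; exact: cvI.
Qed.

(** The one-sided inequality for psi and for -psi. *)
Lemma euler_lagrange u G psi : W0 Omega p u G -> test_function Omega psi ->
  powint mu p u = 1%E -> powint mu p (fun x => enorm (G x)) = (rayleigh_inf Omega p)%:E ->
  \int[mu]_x dotrV (pvec p (G x)) (grad psi x) =
  \int[mu]_x (rayleigh_inf Omega p * (`|u x| `^ (p - 2) * u x) * psi x).
Proof.
move=> W tf u1 G1; have [Nu NG] := W0_lty p1 W; have [mu_ mG _] := W.
set l := rayleigh_inf _ _ in G1 *.
have mpsi := test_measurable tf; have mg := test_grad_measurable tf.
have Npsi : (Np mu p psi < +oo)%E by apply: Np_lty => //; exact: test_powint_lty tf.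
have Ngp : (Np mu p (fun x => enorm (grad psi x)) < +oo)%E.
  by apply: Np_lty => //; exact: test_grad_powint_lty tf.
have iu : mu.-integrable setT (EFin \o (fun x => `|u x| `^ (p - 2) * u x * psi x)).
  apply: (hoelder_integrable p1) => //; first exact: measurable_powR_pred.
  by apply: (Np_conj_lty (f := u)) => // x; exact: normr_powR_pred.
have idom : mu.-integrable setT (EFin \o (fun x => enorm (G x) `^ (p - 1) * enorm (grad psi x))).
  apply: (hoelder_integrable p1) => //.
  - exact: (measurableT_comp (measurable_powR _) (measurable_enorm mG)).
  - exact: measurable_enorm.
  - apply: (Np_conj_lty (f := fun x => enorm (G x))) => // x.
    by rewrite ger0_norm ?powR_ge0// ger0_norm ?enorm_ge0.
have idot : mu.-integrable setT (EFin \o (fun x => dotrV (pvec p (G x)) (grad psi x))).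
  apply: le_integrable idom => //.
    by apply/measurable_EFinP; apply: measurable_dotrV => //; exact: measurable_pvec.
  move=> x _; rewrite lee_fin [leRHS]ger0_norm ?mulr_ge0 ?powR_ge0 ?enorm_ge0//.
  by apply: (le_trans (CauchySchwarz_dotrV _ _)); rewrite enorm_pvec.
rewrite (_ : \int[mu]_x (l * _ * _) = l * \int[mu]_x (`|u x| `^ (p - 2) * u x * psi x)); last first.
  by rewrite -RintegralZl//; apply: eq_Rintegral => x _; ring.
apply/eqP; rewrite eq_le; apply/andP; split; last exact: euler_lagrange_le.
have := euler_lagrange_le W (testZ (-1) tf) u1 G1; rewrite -/l.
rewrite (_ : \int[mu]_x (_ * (-1 * psi x)) = - \int[mu]_x (`|u x| `^ (p - 2) * u x * psi x)); last first.
  rewrite -[RHS]mulN1r -RintegralZl//; apply: eq_Rintegral => x _; ring.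
rewrite (_ : \int[mu]_x dotrV _ (grad (fun y => -1 * psi y) x) =
    - \int[mu]_x dotrV (pvec p (G x)) (grad psi x)); last first.
  rewrite -[RHS]mulN1r -RintegralZl//; apply: eq_Rintegral => x _.
  by rewrite gradZ ?dotrVZr//; exact: test_differentiable tf.
by rewrite mulrN lerN2.
Qed.

End eigenfunction.

Lemma cvge0_near (R : realType) (u : nat -> \bar R) (e : R) : (forall j, (0 <= u j)%E) ->
  u j @[j --> \oo] --> 0%E -> 0 < e -> \forall j \near \oo, (u j < e%:E)%E.
Proof.
move=> u0 uc e0; have /fine_cvgP[fu cu] := uc.
have /cvgr0Pnorm_lt/(_ _ e0) nu := cu.
apply: filterS2 fu nu => j fj; rewrite /= ger0_norm ?fine_ge0// => H.
by rewrite -(fineK fj) lte_fin.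
Qed.

Lemma cvge0_ex2 (R : realType) (u v : nat -> \bar R) (e : R) :
  (forall j, (0 <= u j)%E) -> (forall j, (0 <= v j)%E) ->
  u j @[j --> \oo] --> 0%E -> v j @[j --> \oo] --> 0%E -> 0 < e ->
  exists2 j, (u j < e%:E)%E & (v j < e%:E)%E.
Proof.
move=> u0 v0 uc vc e0.
have [j [ju jv]] := filter_ex (filterI (cvge0_near u0 uc e0) (cvge0_near v0 vc e0)).
by exists j.
Qed.

(** * Link with the Sobolev space of the statement, and the first eigenvalue *)

Section sobolev.
Context {R : realType} {n : nat} (Omega : set 'rV[R]_n) (p : R) (p1 : 1 < p)
  (mO : measurable Omega).
Local Notation mu := (rV_lebesgue_measure R n).
Implicit Types (phi psi u v : 'rV[R]_n -> R) (G H : 'rV[R]_n -> 'rV[R]_n).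

Let p0 : 0 < p. Proof. exact: lt_trans ltr01 p1. Qed.

Lemma integral_outside0 (f : 'rV[R]_n -> \bar R) : (forall x, ~ Omega x -> f x = 0%E) ->
  (\int[mu]_(x in Omega) f x = \int[mu]_x f x)%E.
Proof.
move=> f0; rewrite integral_mkcond; apply: eq_integral => x _.
by rewrite patchE; case: ifPn => // /negP; rewrite inE => /f0.
Qed.

Lemma Rintegral_outside0 (f : 'rV[R]_n -> R) : (forall x, ~ Omega x -> f x = 0) ->
  \int[mu]_(x in Omega) f x = \int[mu]_x f x.
Proof. by move=> f0; rewrite /Rintegral integral_outside0// => x /f0 ->. Qed.

(** Integration by parts holds for test functions, and both sides are continuous in the pair (u, G)
    because phi and its derivative lie in the conjugate space. *)
Lemma W0_weak_gradient u G : W0 Omega p u G -> weak_gradient Omega u G.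
Proof.
move=> W phi tphi i; have [Nu NG] := W0_lty p1 W; case: W => mu_ mG WG.
pose dphi : 'rV[R]_n -> R := 'D_(delta_mx 0 i) phi.
have q0 : 0 < p / (p - 1) by rewrite divr_gt0// subr_gt0.
have tphi' : test_function Omega dphi := test_partial i tphi.
have mphi := test_measurable tphi; have mphi' := test_measurable tphi'.
have N1 : (Np mu (p / (p - 1)) phi < +oo)%E by apply: Np_lty => //; exact: test_powint_lty tphi.
have N2 : (Np mu (p / (p - 1)) (dphi) < +oo)%E.
  by apply: Np_lty => //; exact: test_powint_lty tphi'.
change (\int[mu]_(x in Omega) (u x * dphi x) = - \int[mu]_(x in Omega) (G x 0 i * phi x)).
rewrite !Rintegral_outside0; last 2 first.
- by move=> x Ox; rewrite (test_outside tphi Ox) mulr0.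
- by move=> x Ox; rewrite (test_outside tphi' Ox) mulr0.
have mc (H : 'rV[R]_n -> 'rV[R]_n) : measurable_fun setT H -> measurable_fun setT (fun x => H x 0 i).
  by move=> mH; exact: measurable_rV_coordP.
have Nc H : measurable_fun setT H -> (Np mu p (fun x => H x 0 i)%R <= Np mu p (fun x => enorm (H x)))%E.
  move=> mH; apply: le_Np => //; [exact: mc|exact: measurable_enorm|].
  by move=> x; rewrite [leRHS]ger0_norm ?enorm_ge0// coord_le_enorm.
set k1 := fine (Np mu (p / (p - 1)) phi); set k2 := fine (Np mu (p / (p - 1)) (dphi)).
have k10 : 0 <= k1 by rewrite fine_ge0// Np_ge0.
have k20 : 0 <= k2 by rewrite fine_ge0// Np_ge0.
apply/eqP; rewrite -addr_eq0 -normr_le0; apply/ler_addgt0Pr => e e0.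
have d0 : 0 < e / (k1 + k2 + 1) by rewrite divr_gt0// ltr_wpDl// addr_ge0.
have [psi [tpsi psiu psiG]] := WG _ d0; move: d0 psiu psiG.
set dl := e / _ => d0 psiu psiG.
have mpsi := test_measurable tpsi; have mg := test_grad_measurable tpsi.
pose dpsi : 'rV[R]_n -> R := 'D_(delta_mx 0 i) psi.
have ibp : \int[mu]_x (psi x * dphi x) = - \int[mu]_x (dpsi x * phi x) := test_ibp i tpsi tphi.
have int1 g : measurable_fun setT g -> (Np mu p g < +oo)%E ->
    mu.-integrable setT (EFin \o (fun x => dphi x * g x)).
  by move=> mg' Ng; exact: (@hoelder_integrable _ _ _ mu p dphi g p1 mphi' mg' N2 Ng).
have int2 g : measurable_fun setT g -> (Np mu p g < +oo)%E ->
    mu.-integrable setT (EFin \o (fun x => phi x * g x)).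
  by move=> mg' Ng; exact: (@hoelder_integrable _ _ _ mu p phi g p1 mphi mg' N1 Ng).
have Npsi : (Np mu p psi < +oo)%E by apply: Np_lty => //; exact: test_powint_lty tpsi.
have mdpsi := test_measurable (test_partial i tpsi).
have Ndpsi : (Np mu p (dpsi) < +oo)%E.
  by apply: Np_lty => //; exact: test_powint_lty (test_partial i tpsi).
have NGi : (Np mu p (fun x => G x 0 i)%R < +oo)%E by apply: le_lt_trans (Nc _ mG) NG.
have E1 : \int[mu]_x (u x * dphi x) =
    \int[mu]_x (dphi x * psi x) - \int[mu]_x (dphi x * (psi x - u x)).
  rewrite (_ : \int[mu]_x (u x * _) = \int[mu]_x (dphi x * u x)); last first.
    by apply: eq_Rintegral => x _; rewrite mulrC.
  rewrite (_ : \int[mu]_x (_ * (psi x - u x)) = \int[mu]_x (dphi x * psi x) -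
    \int[mu]_x (dphi x * u x)); first by rewrite opprB addrC subrK.
  rewrite -RintegralB//; [|exact: int1..].
  by apply: eq_Rintegral => x _; rewrite mulrBr.
have E2 : \int[mu]_x (G x 0 i * phi x) =
    \int[mu]_x (phi x * dpsi x) - \int[mu]_x (phi x * (grad psi x - G x) 0 i).
  rewrite (_ : \int[mu]_x (G x 0 i * _) = \int[mu]_x (phi x * G x 0 i)); last first.
    by apply: eq_Rintegral => x _; rewrite mulrC.
  rewrite (_ : \int[mu]_x (_ * (grad psi x - G x) 0 i) = \int[mu]_x (phi x * dpsi x) -
    \int[mu]_x (phi x * G x 0 i)); first by rewrite opprB addrC subrK.
  rewrite -RintegralB//; [|exact: (int2 _ mdpsi Ndpsi)|exact: (int2 _ (mc _ mG) NGi)].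
  by apply: eq_Rintegral => x _; rewrite !mxE mulrBr.
have E3 : \int[mu]_x (dphi x * psi x) = - \int[mu]_x (phi x * dpsi x).
  rewrite (_ : \int[mu]_x (_ * psi x) = \int[mu]_x (psi x * dphi x)); last first.
    by apply: eq_Rintegral => x _; rewrite mulrC.
  rewrite ibp; congr (- _); by apply: eq_Rintegral => x _; rewrite mulrC.
have mpu : measurable_fun setT (fun x => psi x - u x) by exact: measurable_funB.
have mpG : measurable_fun setT (fun x => grad psi x - G x) by exact: measurable_subrV.
have Npu : (Np mu p (fun x => psi x - u x)%R < +oo)%E by apply: lt_trans psiu _; rewrite ltry.
have NpG : (Np mu p (fun x => (grad psi x - G x) 0 i)%R < dl%:E)%E by apply: le_lt_trans (Nc _ mpG) psiG.
have B1 : `|\int[mu]_x (dphi x * (psi x - u x))| <= k2 * dl.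
  apply: (le_trans (hoelder_Rintegral p1 mphi' mpu N2 Npu)).
  by rewrite ler_wpM2l// -lee_fin fineK ?ge0_fin_numE ?Np_ge0// ltW.
have B2 : `|\int[mu]_x (phi x * (grad psi x - G x) 0 i)| <= k1 * dl.
  have NpG' : (Np mu p (fun x => (grad psi x - G x) 0 i)%R < +oo)%E by apply: lt_trans NpG _; rewrite ltry.
  apply: (le_trans (hoelder_Rintegral p1 mphi (mc _ mpG) N1 NpG')).
  by rewrite ler_wpM2l// -lee_fin fineK ?ge0_fin_numE ?Np_ge0// ltW.
have shuffle (P a b : R) : - P - a + (P - b) = - (a + b) by ring.
rewrite E1 E2 E3 add0r shuffle normrN.
apply: (le_trans (ler_normD _ _)); apply: (le_trans (lerD B1 B2)).
rewrite -mulrDl /dl mulrA ler_pdivrMr ?ltr_wpDl ?addr_ge0// mulrC ler_wpM2l ?(ltW e0)//.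
by rewrite addrC lerDl.
Qed.

Lemma sobolev_of_W0 u G : W0 Omega p u G -> sobolev_W01p Omega p u G.
Proof.
move=> W; have [Nu NG] := W0_lty p1 W; have [mu_ mG WG] := W.
split.
  split; [exact: measurable_funS mu_| |exact: measurable_funS mG| |exact: W0_weak_gradient W].
    apply: (integrableS measurableT mO) => //.
    exact: powint_integrable (powint_lty p0 Nu).
  apply: (integrableS measurableT mO) => //.
  have := powint_integrable (measurable_enorm mG) (powint_lty p0 NG).
  by apply: eq_integrable => // x _; rewrite ger0_norm ?enorm_ge0.
have [phi Hphi] := @choice nat ('rV[R]_n -> R) _ (fun k => WG k.+1%:R^-1 (ltac:(by rewrite invr_gt0))).
have ck : ((k.+1%:R^-1 `^ p)%:E : \bar R) @[k --> \oo] --> 0%E.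
  apply: cvg_EFin; first exact: nearW.
  rewrite -(powR0 (lt0r_neq0 p0)); apply: powR_nneg_cvg => //.
  exact: cvg_harmonic.
have sq (h : nat -> 'rV[R]_n -> R) : (forall k, measurable_fun setT (h k)) ->
    (forall k, (Np mu p (h k) < (k.+1%:R^-1)%:E)%E) ->
    (\int[mu]_(x in Omega) (`|h k x| `^ p)%:E)%E @[k --> \oo] --> 0%E.
  move=> mh hk; apply: (squeeze_cvge (f := fun=> 0%E) (h := fun k => (k.+1%:R^-1 `^ p)%:E)) => //; last exact: cvg_cst.
  apply: nearW => k; rewrite integral_ge0/=; last by move=> x _; rewrite lee_fin powR_ge0.
  apply: (@le_trans _ _ (powint mu p (h k))).
    apply: ge0_subset_integral => //.
    by apply: measurable_powint.
  rewrite powint_Np// -poweR_EFin; apply: gt0_ler_poweR; rewrite ?(ltW p0)//.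
  - by rewrite in_itv/= leey andbT Np_ge0.
  - by rewrite in_itv/= leey andbT lee_fin invr_ge0.
  - exact: ltW.
exists phi; split.
- by move=> k; have [] := Hphi k.
- apply: sq => k; last by have [] := Hphi k.
  by apply: measurable_funB => //; have [tf _ _] := Hphi k; exact: test_measurable tf.
- rewrite (_ : (fun k => _) = fun k => (\int[mu]_(x in Omega) (`|enorm (grad (phi k) x - G x)| `^ p)%:E)%E); last first.
    by apply/funext => k; apply: eq_integral => x _; rewrite ger0_norm ?enorm_ge0.
  apply: (sq (fun k x => enorm (grad (phi k) x - G x))) => k; last by have [] := Hphi k.
  apply: measurable_enorm; apply: measurable_subrV => //.
  by have [tf _ _] := Hphi k; exact: test_grad_measurable tf.
Qed.

(** Test functions and their gradients vanish outside Omega, so distances over Omega to the given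
    pair are distances over the whole space to its zero extension. *)
Lemma W0_of_sobolev u G : sobolev_W01p Omega p u G ->
  W0 Omega p (u \_ Omega) (fun x => \1_Omega x *: G x).
Proof.
move=> [[mu_ iu mG iG _] [phi [tphi cu cG]]].
have mu' : measurable_fun setT (u \_ Omega) := (iffLR (measurable_restrictT _ mO)) mu_.
have mG' : measurable_fun setT (fun x => \1_Omega x *: G x).
  apply: measurable_funrV => i.
  rewrite (_ : (fun x => _) = (fun x => G x 0 i) \_ Omega); last first.
    apply/funext => x; rewrite mxE patchE indicE; case: ifP => _; first by rewrite mul1r.
    by rewrite mul0r.
  by apply: (iffLR (measurable_restrictT _ mO)); exact: measurable_rV_coordP.
split => // e e0.
have Eu k : powint mu p (fun x => phi k x - (u \_ Omega) x) = (\int[mu]_(x in Omega) (`|phi k x - u x| `^ p)%:E)%E.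
  rewrite [RHS]integral_mkcond; apply: eq_integral => x _; rewrite !patchE.
  case: ifPn => // /negP; rewrite inE => Ox.
  by rewrite (test_outside (tphi k) Ox) subr0 normr0 powR0// gt_eqF.
have EG k : powint mu p (fun x => enorm (grad (phi k) x - \1_Omega x *: G x)) =
    (\int[mu]_(x in Omega) (enorm (grad (phi k) x - G x) `^ p)%:E)%E.
  rewrite [RHS]integral_mkcond; apply: eq_integral => x _; rewrite !patchE ger0_norm ?enorm_ge0// indicE.
  case: ifPn => [|/negP]; first by rewrite scale1r.
  rewrite inE => Ox; rewrite (grad_outside (tphi k) Ox) scale0r subr0 enorm0 powR0//.
  by rewrite gt_eqF.
have [k|k|k Hu HG] := cvge0_ex2 _ _ cu cG (powR_gt0 p e0).
- by apply: integral_ge0 => x _; rewrite lee_fin powR_ge0.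
- by apply: integral_ge0 => x _; rewrite lee_fin powR_ge0.
exists (phi k); split; first exact: tphi.
  by rewrite -Eu in Hu; exact: powint_lt_Np p0 (ltW e0) Hu.
by rewrite -EG in HG; exact: powint_lt_Np p0 (ltW e0) HG.
Qed.

Lemma powint_eq0 u : measurable_fun setT u -> powint mu p u = 0%E ->
  {ae mu, forall x, u x = 0}.
Proof.
move=> mu_ u0; have mpu := measurable_powint p mu_.
have : (\int[mu]_x `|(`|u x| `^ p)%:E| = 0)%E.
  rewrite -[RHS]u0; apply: eq_integral => x _.
  by rewrite abse_EFin ger0_norm// powR_ge0.
move=> /(iffLR (ae_eq_integral_abs mu measurableT mpu)).
apply: filterS => x /(_ I) [] /eqP.
by rewrite powR_eq0 normr_eq0 => /andP[/eqP].
Qed.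

(** Testing the eigenfunction with itself shows that its Rayleigh quotient is exactly lam;
    nontriviality permits the division. *)
Lemma eigenvalue_ge lam : p_laplace_eigenvalue Omega p lam -> rayleigh_inf Omega p <= lam.
Proof.
move=> [u [[G [S eqn]] un0]].
have W := W0_of_sobolev S; move: W.
set v := u \_ Omega; set H := (fun x => _) => W.
have [Nv NH] := W0_lty p1 W; have [mv mH _] := W.
have q0 : 0 < p / (p - 1) by rewrite divr_gt0// subr_gt0.
pose b x := lam * (`|v x| `^ (p - 2) * v x).
have mb : measurable_fun setT b by apply: measurable_funM => //; exact: measurable_powR_pred.
have mA : measurable_fun setT (fun x => pvec p (H x)) by exact: measurable_pvec.
have NA : (Np mu (p / (p - 1)) (fun x => enorm (pvec p (H x))) < +oo)%E.
  apply: (Np_conj_lty p1 (f := fun x => enorm (H x))) => // x.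
  by rewrite !ger0_norm ?enorm_ge0// enorm_pvec.
have Nb0 : (Np mu (p / (p - 1)) (fun x => `|v x| `^ (p - 2) * v x)%R < +oo)%E.
  by apply: (Np_conj_lty p1 (f := v)) => // x; exact: normr_powR_pred.
have Nb : (Np mu (p / (p - 1)) b < +oo)%E.
  apply: (@le_lt_trans _ _ (`|lam|%:E * Np mu (p / (p - 1)) (fun x => `|v x| `^ (p - 2) * v x)%R)%E).
    by apply: NpZ_le => // [|x]; [exact: measurable_powR_pred|rewrite normrM].
  by rewrite lte_mul_pinfty ?lee_fin// ge0_fin_numE ?Np_ge0.
have eqT phi : test_function Omega phi ->
    \int[mu]_x dotrV (pvec p (H x)) (grad phi x) = \int[mu]_x (b x * phi x).
  move=> tphi; transitivity (\int[mu]_(x in Omega) dotrV (pvec p (H x)) (grad phi x)).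
    by apply/esym/Rintegral_outside0 => x Ox; rewrite (grad_outside tphi Ox) dotrV0r.
  transitivity (\int[mu]_(x in Omega) (b x * phi x)); last first.
    by apply: Rintegral_outside0 => x Ox; rewrite (test_outside tphi Ox) mulr0.
  transitivity (\int[mu]_(x in Omega) dotrV (pvec p (G x)) (grad phi x)).
    by apply: eq_Rintegral => x xO; rewrite /H indicE xO scale1r.
  rewrite [LHS](eqn phi tphi); apply: eq_Rintegral => x xO.
  by rewrite /b /v patchE xO.
have key := weak_ext p1 mA mb NA Nb eqT W.
have iH := powint_integrable (measurable_enorm mH) (powint_lty p0 NH).
have iv := powint_integrable mv (powint_lty p0 Nv).
have E1 : powint mu p (fun x => enorm (H x)) = (\int[mu]_x dotrV (pvec p (H x)) (H x))%:E.
  have -> : \int[mu]_x dotrV (pvec p (H x)) (H x) = \int[mu]_x (`|enorm (H x)| `^ p).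
    by apply: eq_Rintegral => x _; rewrite dotrV_pvec// ger0_norm ?enorm_ge0.
  by rewrite /Rintegral fineK//; exact: integrable_fin_num.
have E2 : powint mu p v = (\int[mu]_x (`|v x| `^ p))%:E.
  by rewrite /Rintegral fineK//; exact: integrable_fin_num.
have E3 : \int[mu]_x (b x * v x) = lam * \int[mu]_x (`|v x| `^ p).
  rewrite -RintegralZl//; apply: eq_Rintegral => x _; rewrite /b -mulrA; congr (_ * _).
  have [->|vx] := eqVneq (v x) 0; first by rewrite mulr0 normr0 powR0// gt_eqF.
  have nv : 0 < `|v x| by rewrite normr_gt0.
  have -> : p = (p - 2) + 2 by ring.
  rewrite [in RHS]powRD ?normr_eq0 ?vx ?implybT// -mulrA; congr (_ `^ _ * _); first by ring.
  by rewrite (powR_mulrn 2)// -normrX ger0_norm ?sqr_ge0// expr2.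
have := W0_rayleigh p1 W; rewrite E1 E2 key E3 -EFinM lee_fin ler_pM2r//.
rewrite lt_neqAle eq_sym; apply/andP; split; last first.
  by apply: Rintegral_ge0 => x _; exact: powR_ge0.
apply/eqP => v0; apply: un0.
have : powint mu p v = 0%E by rewrite E2 v0.
move=> /(powint_eq0 mv); apply: filterS => x vx Ox.
by move: vx; rewrite /v patchE mem_set.
Qed.

(** Faber-Krahn for supports of measure at most |Omega| + 1 bounds all quotients below by one
    constant. A nonzero test function is asked for because the infimum of the empty set is 0. *)
Lemma rayleigh_inf_gt0 : (0 < n)%N -> bounded_set Omega ->
  (exists2 phi, test_function Omega phi & (0 < powint mu p phi)%E) ->
  0 < rayleigh_inf Omega p.
Proof.
move=> n0 bO ex; have Ofin := bounded_rV_lty bO mO.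
pose s := fine (mu Omega) + 1.
have s0 : 0 < s by rewrite ltr_wpDl// fine_ge0.
have Os : (mu Omega <= s%:E)%E.
  by rewrite -[mu Omega]fineK ?ge0_fin_numE// lee_fin lerDl.
pose r := (2 * s) `^ n%:R^-1.
have r0 : 0 < r by rewrite powR_gt0// mulr_gt0.
have rn : r ^+ n = 2 * s.
  rewrite -powR_mulrn ?(ltW r0)// -powRrM mulVf ?powRr1 ?mulr_ge0 ?(ltW s0)//.
  by rewrite pnatr_eq0 -lt0n.
pose C := 2 * (n%:R * r) `^ p.
have C0 : 0 < C by rewrite mulr_gt0// powR_gt0// mulr_gt0// ltr0n.
have [phi [tf phi1 Dphi]] := rayleigh_min_seq p1 ex.
apply: (@lt_le_trans _ _ C^-1); first by rewrite invr_gt0.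
apply: lb_le_inf.
  by exists (fine (powint mu p (fun x => enorm (grad (phi 0%N) x)))); exists (phi 0%N); split => //; exact: test_grad_powintE.
move=> t [psi [tpsi psi1 psit]].
have := faber_krahn p1 (W0_test p1 tpsi) s0 (ltW r0) rn.
rewrite psi1 psit -EFinM lee_fin => H.
rewrite -(ler_pM2l C0) divff ?gt_eqF//; apply: H.
apply: le_trans Os; apply: le_measure; rewrite ?inE//.
  have := test_measurable tpsi measurableT (measurableC (measurable_set1 (0 : R))).
  rewrite setTI; congr measurable; apply/seteqP; split => x /= => [x0|/eqP//].
  by apply/eqP.
move=> x /= x0; have [//|Ox] := pselect (Omega x).
by move/eqP: x0 => []; exact: test_outside tpsi Ox.
Qed.

(** The minimizer solves the eigenvalue equation, so the Rayleigh infimum is itself an eigenvalue,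
    and [eigenvalue_ge] makes it the least one. *)
Lemma lambda_pE : (0 < n)%N -> bounded_set Omega ->
  (exists2 phi, test_function Omega phi & (0 < powint mu p phi)%E) ->
  lambda_p Omega p = rayleigh_inf Omega p.
Proof.
move=> n0 bO ex; have [u [G [W uG0 u1 G1]]] := minimizer p1 n0 mO bO ex.
have mem : p_laplace_eigenvalue Omega p (rayleigh_inf Omega p).
  exists u; split.
    exists G; split; first exact: sobolev_of_W0.
    move=> phi tphi.
    rewrite [RHS]Rintegral_outside0; last by move=> x Ox; rewrite (test_outside tphi Ox) mulr0.
    rewrite [LHS]Rintegral_outside0; last by move=> x Ox; rewrite (grad_outside tphi Ox) dotrV0r.
    exact: euler_lagrange.
  move=> u0; have [mu_ _ _] := W.
  suff : powint mu p u = 0%E by rewrite u1 => /eqP; rewrite onee_eq0.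
  rewrite /powint (ae_eq_integral (cst 0%E)) ?integral0//; first exact: measurable_powint.
  apply: filterS u0 => x u0 _; have [/u0 ->|/uG0[-> _]] := pselect (Omega x).
    by rewrite normr0 powR0 ?gt_eqF.
  by rewrite normr0 powR0 ?gt_eqF.
apply/eqP; rewrite eq_le; apply/andP; split.
  apply: ge_inf => //; exists (rayleigh_inf Omega p) => t; exact: eigenvalue_ge.
apply: lb_le_inf; first by exists (rayleigh_inf Omega p).
by move=> t; exact: eigenvalue_ge.
Qed.

End sobolev.

(** * Bounds for solutions *)

Section structure.
Context {R : realType} {n : nat}.
Implicit Types (F : 'rV[R]_n -> 'rV[R]_n) (z e : 'rV[R]_n).

Lemma is_derive_line F z (t : R) : differentiable F (t *: z) ->
  is_derive t (1 : R) (fun s : R => F (s *: z)) ('D_z F (t *: z)).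
Proof.
move=> df; pose l := fun s : R => s *: z.
have dz : is_diff t ( *:%R^~ z : R -> 'rV[R]_n) ( *:%R^~ z) by exact: is_diff_scalel.
have dl' : differentiable l t by exact: ex_diff.
have dl : 'D_(1 : R) l t = 1 *: z.
  by rewrite /l (deriveE (1 : R) (ex_diff (is_diff_def := dz))) diff_val.
have dc : differentiable (F \o l) t by exact: differentiable_comp.
apply: DeriveDef; first exact/derivable1_diffP.
by rewrite (deriveE _ dc) diff_comp//= -(deriveE _ dl') dl scale1r -deriveE.
Qed.

Lemma is_derive_dotrV (g : R -> 'rV[R]_n) (dg : 'rV[R]_n) e (t : R) :
  is_derive t (1 : R) g dg ->
  is_derive t (1 : R) (fun s => dotrV (g s) e) (dotrV dg e).
Proof.
move=> [Dg <-]; have Di := (derivable_mxP g t 1).1 Dg.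
rewrite (_ : (fun s => dotrV (g s) e) = \sum_(i < n) (e 0 i \*: (fun s => g s 0 i))); last first.
  by apply/funext => s; rewrite fct_sumE; apply: eq_bigr => i _; rewrite mulrC.
rewrite (_ : dotrV _ e = \sum_(i < n) e 0 i *: 'D_1 (fun s => g s 0 i) t).
  by apply: is_derive_sum => i; apply: is_deriveZ; exact: derivableP (Di 0 i).
by apply: eq_bigr => i _; rewrite derive_mx// mxE mulrC.
Qed.

Lemma continuous_dotrVl e : continuous (fun z => dotrV z e).
Proof.
move=> z; apply/(@cvgrPdist_lt _ _ _ (nbhs z) _) => r r0; near=> y.
rewrite (_ : dotrV z e - dotrV y e = dotrV (z - y) e); last by rewrite dotrVDl dotrVNl.
apply: (le_lt_trans (CauchySchwarz_dotrV _ _)).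
apply: (@le_lt_trans _ _ (n%:R * `|z - y| * enorm e)).
  by rewrite ler_wpM2r ?enorm_ge0//; exact: enorm_le_norm.
apply: (@le_lt_trans _ _ ((n%:R * enorm e + 1) * `|z - y|)).
  by rewrite mulrAC ler_wpM2r// lerDl.
rewrite mulrC -ltr_pdivlMr; last by rewrite ltr_wpDl// mulr_ge0 ?enorm_ge0.
near: y; apply: cvgr_dist_lt; last by rewrite divr_gt0// ltr_wpDl// mulr_ge0 ?enorm_ge0.
exact: cvg_id.
Unshelve. all: by end_near. Qed.

(* [t -> <F (t z), e>] is compared along the ray with [t^(p-1)], the derivative
   of [F] being possibly singular at the origin. *)
Lemma ray_lower F z e (p K : R) : 1 < p -> continuous F -> F 0 = 0 ->
  (forall t, 0 < t -> differentiable F (t *: z)) ->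
  (forall t, 0 < t -> K * t `^ (p - 2) <= dotrV ('D_z F (t *: z)) e) ->
  K / (p - 1) <= dotrV (F z) e.
Proof.
move=> p1 cF F0 dF KF; have q0 : 0 < p - 1 by rewrite subr_gt0.
pose g (t : R) := dotrV (F (t *: z)) e - K / (p - 1) * `|t| `^ (p - 1).
pose dg (t : R) := dotrV ('D_z F (t *: z)) e - K / (p - 1) * ((p - 1) * t `^ (p - 1 - 1)).
have gd (t : R) : t \in `]0, 1[%R -> is_derive t (1 : R) g (dg t).
  rewrite in_itv/= => /andP[t0 t1].
  have d1 := is_derive_dotrV e (is_derive_line (dF t t0)).
  have d2 : is_derive t (1 : R) (fun s : R => `|s| `^ (p - 1)) ((p - 1) * t `^ (p - 1 - 1)).
    apply: (@near_eq_is_derive _ _ _ (fun s => s `^ (p - 1))) => //.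
    - near=> s; rewrite ger0_norm// ltW//; near: s.
      by apply: (@cvgr_gt _ _ (nbhs t) _ id t); [exact: cvg_id|exact: t0].
    - exact: is_derive1_powR.
  apply: is_deriveB; exact: is_deriveZ.
have cg : continuous g.
  move=> t; apply: cvgB.
    apply: (@cvg_comp _ _ _ (fun s : R => F (s *: z)) (fun w => dotrV w e) (nbhs t) (nbhs (F (t *: z)))).
      apply: (@cvg_comp _ _ _ (fun s : R => s *: z) F (nbhs t) (nbhs (t *: z))); last exact: cF.
      by apply: cvgZr_tmp; exact: cvg_id.
    exact: continuous_dotrVl.
  by apply: cvgMl_tmp; exact: powR_norm_continuous.
have [c c01] := MVT ltr01 gd (continuous_subspaceT cg).
rewrite /g scale1r scale0r F0 dotrV0l normr1 powR1 normr0 powR0 ?gt_eqF// mulr0 mulr1 !subr0 mulr1.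
move=> E; rewrite -subr_ge0 E /dg.
move: c01; rewrite in_itv/= => /andP[c0 _].
have := KF c c0; rewrite (_ : p - 1 - 1 = p - 2); last by ring.
by rewrite mulrA divfK ?gt_eqF// subr_ge0.
Unshelve. all: by end_near. Qed.

(** [ray_lower] in the direction e = z, where ellipticity along the ray gives the constant K = (p -
    1) |z|^p. *)
Lemma ray_coercive F (p : R) : 1 < p -> continuous F -> F 0 = 0 ->
  (forall z, z != 0 -> differentiable F z) ->
  (forall z xi, z != 0 -> (p - 1) * enorm z `^ (p - 2) * enorm xi ^+ 2 <= dotrV ('D_xi F z) xi) ->
  forall z, enorm z `^ p <= dotrV (F z) z.
Proof.
move=> p1 cF F0 dF H z; have [->|z0] := eqVneq z 0.
  by rewrite F0 dotrV0l enorm0 powR0// gt_eqF// (lt_trans ltr01).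
have q0 : 0 < p - 1 by rewrite subr_gt0.
have tz (t : R) : 0 < t -> t *: z != 0 by move=> t0; rewrite scaler_eq0 negb_or gt_eqF.
have := @ray_lower F z z p ((p - 1) * enorm z `^ p) p1 cF F0 (fun t t0 => dF _ (tz t t0)).
rewrite mulrAC divff ?gt_eqF// mul1r; apply => t t0.
apply: le_trans (H _ z (tz t t0)); rewrite enormZ (gtr0_norm t0) powRM ?(ltW t0) ?enorm_ge0//.
have e0 := enorm_gt0 z0.
rewrite le_eqVlt; apply/orP; left; apply/eqP.
have -> : enorm z `^ p = enorm z `^ (p - 2) * enorm z ^+ 2.
  rewrite -(powR_mulrn 2) ?(ltW e0)// -powRD; last by rewrite (gt_eqF e0) implybT.
  by congr (_ `^ _); ring.
ring.
Qed.

(** [ray_lower] in the direction e = - F z turns the upper bound on the derivative into a lower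
    bound with negative K, and one factor |F z| cancels. *)
Lemma ray_growth F (p C : R) : 1 < p -> 0 < C -> continuous F -> F 0 = 0 ->
  (forall z, z != 0 -> differentiable F z) ->
  (forall z xi, z != 0 -> enorm ('D_xi F z) <= C * enorm z `^ (p - 2) * enorm xi) ->
  forall z, enorm (F z) <= C / (p - 1) * enorm z `^ (p - 1).
Proof.
move=> p1 C0 cF F0 dF H z; have q0 : 0 < p - 1 by rewrite subr_gt0.
have [->|z0] := eqVneq z 0.
  by rewrite F0 enorm0 powR0 ?gt_eqF// mulr0.
have [->|Fz0] := eqVneq (F z) 0; first by rewrite enorm0 mulr_ge0 ?powR_ge0// divr_ge0 ?ltW.
have tz (t : R) : 0 < t -> t *: z != 0 by move=> t0; rewrite scaler_eq0 negb_or gt_eqF.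
have e0 := enorm_gt0 z0.
have := @ray_lower F z (- F z) p (- (C * enorm z `^ (p - 1) * enorm (F z))) p1 cF F0 (fun t t0 => dF _ (tz t t0)).
rewrite dotrVNr mulNr lerN2 => H1.
have {H1}: dotrV (F z) (F z) <= C * enorm z `^ (p - 1) * enorm (F z) / (p - 1).
  apply: H1 => t t0; rewrite dotrVNr mulNr lerN2.
  apply: (le_trans (ler_norm _)); apply: (le_trans (CauchySchwarz_dotrV _ _)).
  apply: (@le_trans _ _ (C * enorm (t *: z) `^ (p - 2) * enorm z * enorm (F z))).
    by rewrite ler_wpM2r ?enorm_ge0//; apply: H; exact: tz.
  rewrite enormZ (gtr0_norm t0) powRM ?(ltW t0) ?enorm_ge0//.
  have -> : enorm z `^ (p - 1) = enorm z `^ (p - 2) * enorm z.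
    rewrite -[X in _ = _ * X](powRr1 (ltW e0)) -powRD; last by rewrite (gt_eqF e0) implybT.
    by congr (_ `^ _); ring.
  by rewrite le_eqVlt; apply/orP; left; apply/eqP; ring.
rewrite -sqr_enorm expr2 mulrAC ler_pM2r; last exact: enorm_gt0.
by rewrite mulrAC.
Qed.

End structure.

(** * Continuity and measurability of the coefficient field *)

Section coefficient.
Context {R : realType} {n : nat} (Omega : set 'rV[R]_n) (oO : open Omega)
  (a : 'rV[R]_n -> 'rV[R]_n -> 'rV[R]_n).
Context (ca : {within closure Omega `*` [set: 'rV[R]_n],
    continuous (fun xz : 'rV[R]_n * 'rV[R]_n => a xz.1 xz.2)}).

Lemma open_cylinder : open (Omega `*` [set: 'rV[R]_n]).
Proof.
rewrite (_ : _ `*` _ = fst @^-1` Omega); last by apply/seteqP; split => -[x z] //= [].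
by apply: open_comp => // xz _; exact: cvg_fst.
Qed.

Lemma coef_continuous2 (xz : 'rV[R]_n * 'rV[R]_n) : Omega xz.1 ->
  {for xz, continuous (fun xz : 'rV[R]_n * 'rV[R]_n => a xz.1 xz.2)}.
Proof.
move=> Ox.
have : {within Omega `*` [set: 'rV[R]_n], continuous (fun xz : 'rV[R]_n * 'rV[R]_n => a xz.1 xz.2)}.
  by apply: continuous_subspaceW ca => -[x z] [/= /subset_closure].
rewrite (continuous_open_subspace _ open_cylinder); apply.
by rewrite inE; split.
Qed.

Lemma coef_continuous x : Omega x -> continuous (a x).
Proof.
move=> Ox z; have H := coef_continuous2 (xz := (x, z)) Ox.
apply: (@cvg_comp _ _ _ (fun z => (x, z)) (fun xz : 'rV[R]_n * 'rV[R]_n => a xz.1 xz.2) (nbhs z) (nbhs (x, z))) => //.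
exact: (@cvg_pair _ _ _ (nbhs z) (nbhs x) (nbhs z) _ _ _ (fun=> x) id (cvg_cst _) cvg_id).
Qed.

Lemma measurable_coef (G : 'rV[R]_n -> 'rV[R]_n) : measurable_fun Omega G ->
  measurable_fun Omega (fun x => a x (G x)).
Proof.
move=> mG; apply: measurable_funrV => i.
apply: (open_comp_measurable (f := fun xz => a xz.1 xz.2 0 i) (g := id) open_cylinder) => //.
move=> xz; rewrite inE => -[Ox _].
apply: (@cvg_comp _ _ _ (fun xz : 'rV[R]_n * 'rV[R]_n => a xz.1 xz.2) (fun w : 'rV[R]_n => w 0 i) (nbhs xz) (nbhs (a xz.1 xz.2))).
  exact: coef_continuous2.
exact: coord_continuous.
Qed.

Lemma coef_differentiable x z :
  C1_upto (Omega `*` [set z | z != 0]) (closure Omega `*` [set z | z != 0])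
    (fun xz : 'rV[R]_n * 'rV[R]_n => a xz.1 xz.2) ->
  Omega x -> z != 0 -> differentiable (a x) z.
Proof.
move=> [D _] Ox z0; have := D (x, z) (conj Ox z0) => d2.
apply: (@differentiable_comp _ _ _ _ (fun z => (x, z)) (fun xz : 'rV[R]_n * 'rV[R]_n => a xz.1 xz.2)) => //.
Qed.

End coefficient.

(** * Energy inequalities *)

Section energy.
Context {R : realType} {n : nat} (Omega : set 'rV[R]_n) (p : R) (p1 : 1 < p).
Local Notation mu := (rV_lebesgue_measure R n).
Context (A : 'rV[R]_n -> 'rV[R]_n) (b : 'rV[R]_n -> R).
Context (mA : measurable_fun setT A) (mb : measurable_fun setT b)
  (NA : (Np mu (p / (p - 1)) (fun x => enorm (A x)) < +oo)%E)
  (Nb : (Np mu (p / (p - 1)) b < +oo)%E)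
  (weak : forall T K, W0 Omega p T K ->
     \int[mu]_x dotrV (A x) (K x) = \int[mu]_x (b x * T x)).

Let p0 : 0 < p. Proof. exact: lt_trans ltr01 p1. Qed.

Lemma energy_le T K (f g : 'rV[R]_n -> R) : W0 Omega p T K ->
  measurable_fun setT f -> measurable_fun setT g ->
  (forall x, `|f x| `^ p <= dotrV (A x) (K x)) -> (forall x, `|b x * T x| <= g x) ->
  (powint mu p f <= \int[mu]_x (g x)%:E)%E.
Proof.
move=> W mf mg fA bg; have [NT NK] := W0_lty p1 W; have [mT mK _] := W.
have iAK : mu.-integrable setT (EFin \o (fun x => dotrV (A x) (K x))).
  have iE : mu.-integrable setT (EFin \o (fun x => enorm (A x) * enorm (K x))).
    by apply: (hoelder_integrable p1) => //; exact: measurable_enorm.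
  apply: le_integrable iE => //; first by apply/measurable_EFinP; exact: measurable_dotrV.
  move=> x _; rewrite lee_fin [leRHS]ger0_norm ?mulr_ge0 ?enorm_ge0//.
  exact: CauchySchwarz_dotrV.
have ibT : mu.-integrable setT (EFin \o (fun x => b x * T x)) by exact: (hoelder_integrable p1).
apply: (@le_trans _ _ (\int[mu]_x (dotrV (A x) (K x))%:E)%E).
  apply: ge0_le_integral => //; first exact: measurable_powint.
    by apply/measurable_EFinP; exact: measurable_dotrV.
  by move=> x _; rewrite lee_fin.
have -> : (\int[mu]_x (dotrV (A x) (K x))%:E = (\int[mu]_x (b x * T x))%:E)%E.
  by rewrite -(weak W) /Rintegral fineK//; exact: integrable_fin_num.
apply: (@le_trans _ _ (`|\int[mu]_x (b x * T x)|)%:E); first by rewrite lee_fin ler_norm.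
apply: (@le_trans _ _ (\int[mu]_x `|b x * T x|)%:E).
  by rewrite lee_fin; exact: le_normr_Rintegral.
rewrite /Rintegral fineK; last by apply: integrable_fin_num => //; exact: integrable_norm ibT.
apply: ge0_le_integral => //.
- by apply/measurable_EFinP; apply: measurableT_comp => //; exact: measurable_funM.
- exact/measurable_EFinP.
- by move=> x _; rewrite lee_fin.
Qed.

Context (v : 'rV[R]_n -> R) (H : 'rV[R]_n -> 'rV[R]_n) (c d q M : R).
Context (W : W0 Omega p v H) (AH : forall x, enorm (H x) `^ p <= dotrV (A x) (H x))
  (c0 : 0 <= c) (d0 : 0 <= d) (q0 : 0 < q)
  (bv : forall x, v x != 0 -> `|b x| <= c * `|v x| `^ (q - 1) + d).

(** Test with the truncation at level k. It vanishes unless |v| > k >= M/2, and there the source is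
    at most 2 c M^(q-1) + d. *)
Lemma energy_trunc k : 0 < M -> (forall x, `|v x| <= M) -> M / 2 <= k ->
  (powint mu p (fun x => enorm (indic_gt k (v x) *: H x)) <=
   (2 * c * M `^ (q - 1) + d)%:E * powint mu 1 (fun x => trunc k (v x)))%E.
Proof.
move=> M0 vM kM; have k0 : 0 < k by apply: lt_le_trans kM; rewrite divr_gt0.
have [mv mH _] := W.
set L := 2 * c * M `^ (q - 1) + d.
have L0 : 0 <= L by rewrite addr_ge0// !mulr_ge0// powR_ge0.
have mt : measurable_fun setT (fun x => trunc k (v x)).
  exact: (measurableT_comp (measurable_trunc k) mv).
have -> : (L%:E * powint mu 1 (fun x => trunc k (v x)) = \int[mu]_x (L * `|trunc k (v x)|)%:E)%E.
  rewrite /powint -ge0_integralZl_EFin//; last exact: measurable_powint.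
  by apply: eq_integral => x _; rewrite EFinM powRr1.
apply: (energy_le (W0_trunc p1 k0 W)).
- apply: measurable_enorm; apply: measurable_scalerV => //.
  exact: (measurableT_comp (measurable_indic_gt k) mv).
- by apply: measurable_funM => //; exact: measurableT_comp.
- move=> x; rewrite dotrVZr ger0_norm ?enorm_ge0//.
  have /andP[i0 i1] := indic_gt_bounds (v x) k0.
  (* i^p <= i for i in [0, 1], which takes care of the value 1/2 on {|v| = k}. *)
  rewrite enormZ_powR//; apply: (@le_trans _ _ (indic_gt k (v x) * enorm (H x) `^ p)).
    rewrite ler_wpM2r ?powR_ge0//; have [->|in0] := eqVneq (indic_gt k (v x)) 0.
      by rewrite powR0// gt_eqF.
    rewrite -[leRHS](powRr1 i0); apply: ger_powR; last exact: ltW.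
    by rewrite lt_neqAle eq_sym in0 i0.
  by rewrite ler_wpM2l.
move=> x; rewrite normrM.
have [tk|tk] := leP `|v x| k.
  have -> : `|trunc k (v x)| = 0.
    by rewrite trunc_norm ?(ltW k0)//; apply/max_idPr; rewrite subr_le0.
  by rewrite !mulr0.
rewrite ler_wpM2r//.
have v0 : 0 < `|v x| by exact: lt_trans tk.
apply: (le_trans (bv _)); first by rewrite -normr_gt0.
rewrite /L lerD2r -mulrA mulrCA ler_wpM2l//.
have [q1|q1] := leP 1 q.
  apply: (@le_trans _ _ (M `^ (q - 1))); last by rewrite ler_peMl ?powR_ge0// ler1n.
  by apply: ge0_ler_powR; rewrite ?nnegrE ?subr_ge0 ?(ltW M0).
(* For q < 1 the power t^(q-1) decreases, and |v x| > M/2 gives at most (M/2)^(q-1) = 2^(1-q)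
   M^(q-1) <= 2 M^(q-1). This is the origin of the factor 2. *)
have q1' : 0 <= 1 - q by rewrite subr_ge0 ltW.
have -> : q - 1 = - (1 - q) by rewrite opprB.
rewrite !powRN -[2]invrK -invfM lef_pV2 ?posrE ?mulr_gt0 ?powR_gt0//.
apply: (@le_trans _ _ ((M / 2) `^ (1 - q))); last first.
  by apply: ge0_ler_powR; rewrite ?nnegrE ?(ltW M0) ?divr_ge0 ?(ltW M0) ?(le_trans kM) ?(ltW tk).
rewrite powRM ?(ltW M0) ?invr_ge0// mulrC ler_wpM2l ?powR_ge0//.
rewrite -[leLHS](@powRr1 R); last by rewrite invr_ge0.
apply: ger_powR; last by rewrite gerBl ltW.
by rewrite invr_gt0 ltr0n invf_le1// ler1n.
Qed.

Lemma energy_self :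
  (powint mu p (fun x => enorm (H x)) <= c%:E * powint mu q v + d%:E * powint mu 1 v)%E.
Proof.
have [mv mH _] := W.
have m1 r : measurable_fun setT (fun x => (`|v x| `^ r)%:E) by exact: measurable_powint.
have -> : (c%:E * powint mu q v + d%:E * powint mu 1 v =
   \int[mu]_x (c * `|v x| `^ q + d * `|v x| `^ 1)%:E)%E.
  rewrite /powint -!ge0_integralZl_EFin// -ge0_integralD//; do ?by apply: measurable_funeM.
  - by move=> x _; rewrite mule_ge0// lee_fin powR_ge0.
  - by move=> x _; rewrite mule_ge0// lee_fin powR_ge0.
apply: (energy_le W).
- exact: measurable_enorm.
- by apply: measurable_funD; apply: measurable_funM => //; exact: measurable_norm_powR.
- by move=> x; rewrite ger0_norm ?enorm_ge0.
move=> x; have [->|v0] := eqVneq (v x) 0.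
  by rewrite mulr0 normr0 addr_ge0// mulr_ge0// powR_ge0.
rewrite normrM powRr1//; apply: (@le_trans _ _ ((c * `|v x| `^ (q - 1) + d) * `|v x|)).
  by rewrite ler_wpM2r// bv.
rewrite mulrDl lerD2r -mulrA ler_wpM2l// -[X in _ * X](powRr1 (normr_ge0 (v x))) -powRD.
  by rewrite subrK.
by rewrite normr_eq0 v0 implybT.
Qed.

End energy.

Section holder.
Context {R : realType} {n : nat} (Omega : set 'rV[R]_n) (p : R) (p0 : 0 < p).
Local Notation mu := (rV_lebesgue_measure R n).

(** [jensen_indic] on Omega with exponent p / s, applied to |v|^s; as that exponent must exceed 1, s
    = p is treated apart. *)
Lemma powint_le_volume (v : 'rV[R]_n -> R) (s V X : R) : measurable Omega ->
  measurable_fun setT v -> (forall x, ~ Omega x -> v x = 0) -> 0 < V -> mu Omega = V%:E ->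
  0 <= X -> powint mu p v = (X `^ p)%:E -> 0 < s -> s <= p ->
  (powint mu s v <= (V `^ (1 - s / p) * X `^ s)%:E)%E.
Proof.
move=> mO mv v0 V0 VE X0 vX s0; rewrite le_eqVlt => /predU1P[->|sp].
  by rewrite divff ?gt_eqF// subrr powRr0 mul1r vX.
have P1 : 1 < p / s by rewrite ltr_pdivlMr// mul1r.
have mh : measurable_fun setT (fun x => `|v x| `^ s) by exact: measurable_norm_powR.
have := jensen_indic P1 mO V0 VE mh.
have h1 x : \1_Omega x * `|v x| `^ s = `|v x| `^ s.
  rewrite indicE; case: (boolP (x \in Omega)) => [|/negP]; first by rewrite mul1r.
  by rewrite inE mul0r => /v0 ->; rewrite normr0 powR0// gt_eqF.
rewrite (eq_integral (fun x => (`|v x| `^ s)%:E)); last first.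
  by move=> x _; rewrite h1 ger0_norm// powR_ge0.
rewrite -/(powint mu s v).
have -> : powint mu (p / s) (fun y => \1_Omega y * `|v y| `^ s) = (X `^ p)%:E.
  rewrite -vX; apply: eq_integral => x _; rewrite h1 ger0_norm ?powR_ge0// -powRrM.
  by rewrite mulrC divfK// gt_eqF.
move=> J; have Y0 := powint_ge0 mu s v.
have -> : powint mu s v = ((powint mu s v `^ (p / s)) `^ (s / p))%E.
  rewrite -poweRrM mulrA divfK ?gt_eqF// divff ?gt_eqF// poweRe1//.
have -> : (V `^ (1 - s / p) * X `^ s)%:E = (((V `^ (p / s - 1))%:E * (X `^ p)%:E) `^ (s / p))%E.
  rewrite -EFinM poweR_EFin powRM ?powR_ge0// -!powRrM; congr (_ `^ _ * _ `^ _)%:E.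
    by field; rewrite !gt_eqF.
  by field; rewrite gt_eqF.
apply: gt0_ler_poweR => //; first by rewrite divr_ge0// ltW.
- by rewrite in_itv/= leey andbT poweR_ge0.
- by rewrite in_itv/= leey andbT -EFinM lee_fin mulr_ge0 ?powR_ge0.
Qed.

End holder.

Section arithmetic.
Context {R : realType}.

(** The part of the threshold in [de_giorgi_bound] that depends on n and p alone: for A = B M^(s-1)
    the quotient under the root there equals this factor times M^(p-s) / B. *)
Definition dg_factor (n : nat) (p : R) : R :=
  (2 `^ (- ((p - 1) / (p / n%:R))) / 8) `^ (p - 1) /
  (2 * n%:R `^ p * 2 `^ (p / n%:R)).

(** Solving kap M^(E/p) <= X^p for M, with E = n (p - s) + p^2 and kap the base of the outer power,
    leaves kap^(-p/E) in front of X^(p^2/E). *)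
Definition dg_const (n : nat) (p s B : R) : R :=
  (2 `^ (- p) * (dg_factor n p / B) `^ (p / n%:R)^-1) `^ (- (p / (n%:R * (p - s) + p * p))).

Lemma dg_factor_gt0 n p : (0 < n)%N -> 0 < dg_factor n p.
Proof.
move=> n0; have nR : 0 < n%:R :> R by rewrite ltr0n.
by rewrite divr_gt0 ?powR_gt0 ?mulr_gt0 ?powR_gt0// divr_gt0 ?powR_gt0.
Qed.

Lemma dg_const_gt0 n p s B : (0 < n)%N -> 0 < B -> 0 < dg_const n p s B.
Proof.
by move=> n0 B0; rewrite powR_gt0// mulr_gt0// powR_gt0// divr_gt0// dg_factor_gt0.
Qed.

Lemma dg_solve n (p s B M X : R) : (0 < n)%N -> 1 < p -> s <= p -> 0 < B -> 0 < M -> 0 <= X ->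
  (M / 2) `^ p * ((2 `^ (- ((p - 1) / (p / n%:R))) * (M / 8)) `^ (p - 1) /
    (2 * n%:R `^ p * 2 `^ (p / n%:R) * (B * M `^ (s - 1)))) `^ (p / n%:R)^-1 <= X `^ p ->
  M <= dg_const n p s B * X `^ (p * p / (n%:R * (p - s) + p * p)).
Proof.
move=> n0 p1 sp B0 M0 X0 H.
have p0 : 0 < p by exact: lt_trans p1.
have nR : 0 < n%:R :> R by rewrite ltr0n.
set E := n%:R * (p - s) + p * p.
have E0 : 0 < E by rewrite ltr_wpDl ?mulr_gt0// mulr_ge0 ?subr_ge0// ltW.
have k0 := dg_factor_gt0 p n0.
set kap := 2 `^ (- p) * (dg_factor n p / B) `^ (p / n%:R)^-1.
have kap0 : 0 < kap by rewrite mulr_gt0 ?powR_gt0// divr_gt0.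
have MX : kap * M `^ (E / p) <= X `^ p.
  apply: le_trans H; rewrite le_eqVlt; apply/orP; left; apply/eqP.
  have -> : (2 `^ (- ((p - 1) / (p / n%:R))) * (M / 8)) `^ (p - 1) =
      (2 `^ (- ((p - 1) / (p / n%:R))) / 8) `^ (p - 1) * M `^ (p - 1).
    rewrite -powRM ?(ltW M0) ?divr_ge0 ?powR_ge0//; congr (_ `^ _); ring.
  set u := (_ / 8) `^ (p - 1); set w := 2 * n%:R `^ p * 2 `^ (p / n%:R).
  have w0 : 0 < w by rewrite !mulr_gt0 ?powR_gt0.
  have -> : u * M `^ (p - 1) / (w * (B * M `^ (s - 1))) = dg_factor n p / B * M `^ (p - s).
    rewrite (_ : p - 1 = (p - s) + (s - 1)); last by ring.
    rewrite powRD; last by rewrite (gt_eqF M0) implybT.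
    rewrite /dg_factor -/u -/w; field.
    by rewrite !gt_eqF ?powR_gt0.
  rewrite (powRM _ _ (powR_ge0 _ _)); last by rewrite divr_ge0 ?ltW.
  rewrite powRM ?(ltW M0) ?invr_ge0// -(powR_inv1 (ler0n R 2)) -!powRrM mulN1r.
  (* Total power of M: p from Chebyshev at level M/2, and (p - s) n / p from the threshold. *)
  rewrite (_ : E / p = p + (p - s) * (p / n%:R)^-1); last first.
    by rewrite /E; field; rewrite !gt_eqF.
  rewrite powRD; last by rewrite (gt_eqF M0) implybT.
  by rewrite /kap; ring.
have MX2 : M `^ (E / p) <= kap^-1 * X `^ p by rewrite ler_pdivlMl.
have pE : 0 < p / E by rewrite divr_gt0.
have -> : M = (M `^ (E / p)) `^ (p / E).
  rewrite -powRrM (_ : E / p * (p / E) = 1) ?powRr1 ?(ltW M0)//.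
  by field; rewrite !gt_eqF.
apply: (@le_trans _ _ ((kap^-1 * X `^ p) `^ (p / E))).
  apply: ge0_ler_powR; [exact: ltW|by rewrite nnegrE powR_ge0| |exact: MX2].
  by rewrite nnegrE mulr_ge0 ?powR_ge0 ?invr_ge0 ?(ltW kap0).
rewrite powRM ?powR_ge0 ?invr_ge0 ?(ltW kap0)// -powRrM mulrA.
by rewrite -(powR_inv1 (ltW kap0)) -powRrM mulN1r.
Qed.

(** Divide by X^s and take the root of order p - s. Used with s = 1 and with s = q. *)
Lemma power_bound (p s L a V X : R) : 0 < p -> s < p -> 0 < L -> 0 <= a -> 0 < V -> 0 < X ->
  L * X `^ p <= a * (V `^ (1 - s / p) * X `^ s) ->
  X <= (a / L) `^ (1 / (p - s)) * V `^ (1 / p).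
Proof.
move=> p0 sp L0 a0 V0 X0 H; have m0 : 0 < p - s by rewrite subr_gt0.
have H1 : X `^ (p - s) <= a / L * V `^ ((p - s) / p).
  have XE : X `^ p = X `^ (p - s) * X `^ s.
    by rewrite -powRD ?subrK// (gt_eqF X0) implybT.
  move: H; rewrite XE mulrA mulrA ler_pM2r ?powR_gt0// (_ : 1 - s / p = (p - s) / p); last first.
    by field; rewrite gt_eqF.
  by move=> H; rewrite mulrAC ler_pdivlMr// mulrC.
have -> : X = (X `^ (p - s)) `^ (1 / (p - s)).
  by rewrite -powRrM mul1r divff ?gt_eqF// powRr1 ?ltW.
apply: (@le_trans _ _ ((a / L * V `^ ((p - s) / p)) `^ (1 / (p - s)))).
  apply: ge0_ler_powR; rewrite ?nnegrE ?powR_ge0 ?divr_ge0 ?(ltW m0)//.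
  by rewrite mulr_ge0 ?powR_ge0// divr_ge0// ltW.
rewrite powRM ?powR_ge0 ?divr_ge0 ?(ltW L0)// -powRrM.
rewrite (_ : (p - s) / p * (1 / (p - s)) = 1 / p)//.
by field; rewrite !gt_eqF.
Qed.

End arithmetic.

Section clamp.
Context {R : realType}.

(** Changes a function with essential bound M on a null set only, so that the bound holds at every
    point. *)
Definition clamp (M t : R) : R := Num.max (- M) (Num.min t M).

Lemma clamp_norm (M t : R) : 0 <= M -> `|clamp M t| <= M.
Proof.
by move=> M0; rewrite ler_norml /clamp le_max lexx/= ge_max ge_min lexx orbT andbT; lra.
Qed.

Lemma clamp_id (M t : R) : `|t| <= M -> clamp M t = t.
Proof.
rewrite ler_norml => /andP[tM Mt]; rewrite /clamp.
by rewrite (min_idPl Mt); exact/max_idPr.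
Qed.

Lemma measurable_clamp (M : R) : measurable_fun setT (clamp M).
Proof. by apply: measurable_maxr => //; exact: measurable_minr. Qed.

End clamp.

Section almost_everywhere.
Context {R : realType} {n : nat} (Omega : set 'rV[R]_n) (p : R) (p1 : 1 < p).
Local Notation mu := (rV_lebesgue_measure R n).

Let p0 : 0 < p. Proof. exact: lt_trans ltr01 p1. Qed.

Lemma powint_ae r (f g : 'rV[R]_n -> R) : measurable_fun setT f -> measurable_fun setT g ->
  {ae mu, forall x, f x = g x} -> powint mu r f = powint mu r g.
Proof.
move=> mf mg fg; apply: ae_eq_integral => //; do ?exact: measurable_powint.
by apply: filterS fg => x -> _.
Qed.

Lemma W0_ae u v G : W0 Omega p u G -> measurable_fun setT v ->
  {ae mu, forall x, u x = v x} -> W0 Omega p v G.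
Proof.
move=> [mu_ mG WG] mv uv; split => // e /WG[phi [tf pu pG]]; exists phi; split => //.
have mphi := test_measurable tf.
rewrite Np_powint (@powint_ae _ _ (fun x => phi x - u x)) -?Np_powint//; do ?exact: measurable_funB.
by apply: filterS uv => x ->.
Qed.

(** A test function closer to u than the norm of u cannot have norm 0. *)
Lemma W0_test_ex u G : W0 Omega p u G -> (0 < powint mu p u)%E ->
  exists2 phi, test_function Omega phi & (0 < powint mu p phi)%E.
Proof.
move=> W u0; have [Nu _] := W0_lty p1 W; have [mu_ mG WG] := W.
have X0 : 0 < fine (Np mu p u).
  rewrite -lte_fin fineK ?ge0_fin_numE ?Np_ge0// lt_neqAle Np_ge0 andbT.
  apply/eqP => N0; move: u0; rewrite powint_Np// -N0 poweR0r ?ltxx//.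
  by rewrite gt_eqF.
have [phi [tf pu _]] := WG _ X0; exists phi; first exact: tf.
rewrite lt_neqAle powint_ge0 andbT; apply/eqP => P0.
have mphi := test_measurable tf.
have : (Np mu p u <= Np mu p phi + Np mu p (fun x => phi x - u x)%R)%E.
  apply: NpD => //; [exact: ltW|exact: measurable_funB|].
  move=> x; have := ler_normB (phi x) (phi x - u x).
  by rewrite (_ : phi x - (phi x - u x) = u x)// opprB addrC subrK.
rewrite (Np_powint mu p phi) -P0 poweR0r ?invr_neq0 ?gt_eqF// add0e => /le_lt_trans/(_ pu).
by rewrite fineK ?ltxx// ge0_fin_numE ?Np_ge0.
Qed.

Lemma bounded_powint_lty r (f : 'rV[R]_n -> R) K : measurable Omega -> (mu Omega < +oo)%E ->
  0 < r -> measurable_fun setT f -> (forall x, `|f x| <= K) ->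
  (forall x, ~ Omega x -> f x = 0) -> (powint mu r f < +oo)%E.
Proof.
move=> mO Ofin r0 mf fK f0; have K0 : 0 <= K by exact: le_trans (fK 0).
apply: (@le_lt_trans _ _ (\int[mu]_x ((K `^ r)%:E * (\1_Omega x)%:E))%E).
  apply: ge0_le_integral => //; first exact: measurable_powint.
    by apply: measurable_funeM; apply/measurable_EFinP; exact: measurable_indic.
  move=> x _; rewrite -EFinM lee_fin indicE; case: (boolP (x \in Omega)) => [_|/negP].
    by rewrite mulr1; apply: ge0_ler_powR; rewrite ?nnegrE ?(ltW r0).
  by rewrite inE => /f0 ->; rewrite normr0 powR0 ?gt_eqF// mulr0.
rewrite ge0_integralZl_EFin ?powR_ge0//; last first.
  by apply/measurable_EFinP; exact: measurable_indic.
by rewrite integral_indic// setIT lte_mul_pinfty ?lee_fin ?powR_ge0.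
Qed.

Lemma Lnorm_oo_bounds u M : 0 < M -> Lnorm_on Omega +oo%E u = M%:E ->
  {ae mu, forall x, `|(u \_ Omega) x| <= M} /\
  forall t, t < M -> ~ {ae mu, forall x, `|(u \_ Omega) x| <= t}.
Proof.
(* In the other branch of the definition the norm is 0, contrary to 0 < M. *)
move=> M0; rewrite /Lnorm_on unlock; case: ifP => [_ E|_ [E]]; last by rewrite -E ltxx in M0.
split.
  have /ess_supP : (ess_sup mu (abse \o (EFin \o u \_ Omega)) <= M%:E)%E by rewrite E.
  by apply: filterS => x /=; rewrite lee_fin.
move=> t tM H; move: tM; rewrite ltNge => /negP; apply.
rewrite -lee_fin -E; apply/ess_supP; apply: filterS H => x /=.
by rewrite lee_fin.
Qed.

End almost_everywhere.

(** * A priori estimates for a bounded solution *)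

Section bounded_solution.
Context {R : realType} {n : nat} (n0 : (0 < n)%N) (p q c d : R) (p1 : 1 < p)
  (q0 : 0 < q) (qp : q <= p) (c0 : 0 <= c) (d0 : 0 <= d)
  (Omega : set 'rV[R]_n) (a : 'rV[R]_n -> 'rV[R]_n -> 'rV[R]_n)
  (f : R -> R) (w : 'rV[R]_n -> R) (oO : open Omega) (bO : bounded_set Omega).
Local Notation mu := (rV_lebesgue_measure R n).
Context (ca : {within closure Omega `*` [set: 'rV[R]_n],
    continuous (fun xz : 'rV[R]_n * 'rV[R]_n => a xz.1 xz.2)})
  (da : C1_upto (Omega `*` [set z | z != 0]) (closure Omega `*` [set z | z != 0])
    (fun xz : 'rV[R]_n * 'rV[R]_n => a xz.1 xz.2))
  (a0 : forall x, Omega x -> a x 0 = 0)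
  (ell : forall x z xi, Omega x -> z != 0 ->
    (p - 1) * enorm z `^ (p - 2) * enorm xi ^+ 2 <= dotrV ('D_xi (a x) z) xi)
  (grow : exists2 C : R, 0 < C & forall x z xi, Omega x -> z != 0 ->
    enorm ('D_xi (a x) z) <= C * enorm z `^ (p - 2) * enorm xi)
  (df : forall t, derivable f t 1)
  (fb : forall t, t != 0 -> `|f t| <= c * `|t| `^ (q - 1) + d)
  (sol : weak_solution Omega p a f w).

Let p0 : 0 < p. Proof. exact: lt_trans ltr01 p1. Qed.
Let mO : measurable Omega. Proof. exact: open_rV_measurable. Qed.
Let cf : continuous f.
Proof. by move=> t; apply: differentiable_continuous; apply/derivable1_diffP; exact: df. Qed.

(* The solution is replaced by an everywhere bounded representative [v], and the
   equation is extended from test functions to all of [W0]. *)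
Lemma solution_representative M : 0 < M -> Lnorm_on Omega +oo%E w = M%:E ->
  exists (v : 'rV[R]_n -> R) (H A : 'rV[R]_n -> 'rV[R]_n) (b : 'rV[R]_n -> R), [/\ W0 Omega p v H,
    [/\ measurable_fun setT A, measurable_fun setT b,
      (Np mu (p / (p - 1)) (fun x => enorm (A x)) < +oo)%E &
      (Np mu (p / (p - 1)) b < +oo)%E],
    forall T K, W0 Omega p T K -> \int[mu]_x dotrV (A x) (K x) = \int[mu]_x (b x * T x),
    (forall x, enorm (H x) `^ p <= dotrV (A x) (H x)) /\
    (forall x, v x != 0 -> `|b x| <= c * `|v x| `^ (q - 1) + d) &
    [/\ forall x, `|v x| <= M, forall x, ~ Omega x -> v x = 0,
      Np mu p v = Lnorm_on Omega p%:E w &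
      forall t, t < M -> ~ {ae mu, forall x, `|v x| <= t}]].
Proof.
move=> M0 Mw; have [G [S eqn]] := sol.
have W := W0_of_sobolev p1 mO S.
set v0 := w \_ Omega in W; set H := (fun x => \1_Omega x *: G x) in W.
have [[mw _ mG _ _] _] := S.
have [mv0 mH _] := W.
have [vM vM'] := Lnorm_oo_bounds M0 Mw.
have Ofin := bounded_rV_lty bO mO.
pose v x := clamp M (v0 x).
have mv : measurable_fun setT v by exact: (measurableT_comp (measurable_clamp M) mv0).
have vv0 : {ae mu, forall x, v0 x = v x} by apply: filterS vM => x vx; rewrite /v clamp_id.
have vb x : `|v x| <= M by apply: clamp_norm; exact: ltW.
have v_out x : ~ Omega x -> v x = 0.
  by move=> Ox; rewrite /v /v0 patchE memNset// clamp_id// normr0 ltW.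
have H_out x : ~ Omega x -> H x = 0 by move=> Ox; rewrite /H indicE memNset ?scale0r.
have H_in x : Omega x -> H x = G x by move=> Ox; rewrite /H indicE mem_set ?scale1r.
have m1 : measurable_fun setT (\1_Omega : 'rV[R]_n -> R) by exact: measurable_indic.
have mf : measurable_fun setT f by exact: continuous_measurable_fun.
pose b x := \1_Omega x * f (v x).
have mb : measurable_fun setT b by apply: measurable_funM => //; exact: (measurableT_comp mf mv).
have MM : - M <= M by lra.
have cfn : continuous (fun s => `|f s|) by move=> s; apply: cvg_norm; exact: cf.
(* f is bounded on [-M, M], where v takes its values; the source is thus bounded and vanishes
   outside Omega, so it lies in the conjugate space. *)
have [t _ Ht] := EVT_max MM (continuous_subspaceT cfn).
have bK x : `|b x| <= `|f t|.
  rewrite /b indicE normrM; case: (x \in Omega); last by rewrite normr0 mul0r.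
  by rewrite normr1 mul1r; apply: Ht; rewrite in_itv/= -ler_norml.
have b_out x : ~ Omega x -> b x = 0 by move=> Ox; rewrite /b indicE memNset ?mul0r.
have q0' : 0 < p / (p - 1) by rewrite divr_gt0// subr_gt0.
have Nb : (Np mu (p / (p - 1)) b < +oo)%E.
  by apply: Np_lty => //; exact: bounded_powint_lty bK b_out.
pose A x := \1_Omega x *: a x (G x).
have mA : measurable_fun setT A.
  apply: measurable_funrV => i.
  rewrite (_ : (fun x => _) = (fun x => a x (G x) 0 i) \_ Omega); last first.
    apply/funext => x; rewrite mxE patchE indicE; case: ifP => _; first by rewrite mul1r.
    by rewrite mul0r.
  apply: (iffLR (measurable_restrictT _ mO)); apply: measurable_rV_coordP.
  exact: measurable_coef.
have [C C0 growC] := grow.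
have AC x : enorm (A x) <= C / (p - 1) * enorm (H x) `^ (p - 1).
  have [Ox|Ox] := pselect (Omega x); last first.
    by rewrite /A indicE memNset// scale0r enorm0 mulr_ge0 ?powR_ge0// divr_ge0 ?ltW// subr_gt0.
  rewrite /A indicE mem_set// scale1r H_in//.
  apply: ray_growth => //; [exact: (coef_continuous oO ca Ox)|exact: a0| |].
    by move=> z z0; exact: coef_differentiable da Ox z0.
  by move=> z xi z0; exact: growC.
have [_ NH] := W0_lty p1 W.
have NA : (Np mu (p / (p - 1)) (fun x => enorm (A x)) < +oo)%E.
  have C1 : 0 <= C / (p - 1) by rewrite divr_ge0 ?ltW// subr_gt0.
  have NHp : (Np mu (p / (p - 1)) (fun x => enorm (H x) `^ (p - 1))%R < +oo)%E.
    apply: (Np_conj_lty p1 (f := fun x => enorm (H x))) => // x.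
    by rewrite ger0_norm ?powR_ge0// ger0_norm ?enorm_ge0.
  apply: (@le_lt_trans _ _ ((C / (p - 1))%:E * Np mu (p / (p - 1)) (fun x => enorm (H x) `^ (p - 1))%R)%E).
    apply: NpZ_le => //; [exact: measurable_enorm_powR|exact: measurable_enorm|].
    by move=> x; rewrite !ger0_norm ?enorm_ge0 ?powR_ge0.
  by rewrite lte_mul_pinfty ?lee_fin// ge0_fin_numE ?Np_ge0.
have weak0 phi : test_function Omega phi ->
    \int[mu]_x dotrV (A x) (grad phi x) = \int[mu]_x (b x * phi x).
  move=> tphi; have mphi := test_measurable tphi.
  transitivity (\int[mu]_(x in Omega) dotrV (a x (G x)) (grad phi x)).
    rewrite -(@Rintegral_outside0 _ _ Omega); last first.
      by move=> x Ox; rewrite (grad_outside tphi Ox) dotrV0r.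
    by apply: eq_Rintegral => x xO; rewrite /A indicE xO scale1r.
  rewrite eqn//; transitivity (\int[mu]_x (\1_Omega x * f (v0 x) * phi x)).
    rewrite -[RHS](@Rintegral_outside0 _ _ Omega); last first.
      by move=> x Ox; rewrite (test_outside tphi Ox) mulr0.
    by apply: eq_Rintegral => x xO; rewrite indicE xO mul1r /v0 patchE xO.
  congr fine; apply: ae_eq_integral => //.
  - apply/measurable_EFinP; apply: measurable_funM => //; apply: measurable_funM => //.
    exact: (measurableT_comp mf mv0).
  - by apply/measurable_EFinP; apply: measurable_funM.
  - by apply: filterS vv0 => x vx _; rewrite /b -vx.
exists v, H, A, b; split; first exact: W0_ae W mv vv0.
- by split.
- exact: weak_ext.
- split=> x.
    have [Ox|Ox] := pselect (Omega x); last first.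
      by rewrite (H_out _ Ox) dotrV0r enorm0 powR0// gt_eqF.
    rewrite H_in// /A indicE mem_set// scale1r.
    apply: ray_coercive => //; [exact: (coef_continuous oO ca Ox)|exact: a0| |].
      by move=> z z0; exact: coef_differentiable da Ox z0.
    by move=> z xi z0; exact: ell.
  move=> vx; apply: le_trans (fb vx).
  rewrite /b indicE normrM; case: (x \in Omega); last by rewrite normr0 mul0r.
  by rewrite normr1 mul1r.
- split => //.
    rewrite -[RHS]/(Np mu p v0) !Np_powint (powint_ae _ mv mv0)//.
    by apply: filterS vv0 => x ->.
  move=> s sM Hs; apply: (vM' s sM); apply: filterS2 vv0 Hs => x.
  by rewrite -/v0 => ->.
Qed.

(** Gathers the two inequalities between M and X = |w|_p: the Rayleigh bound against the energy of
    w, which limits X, and the De Giorgi bound, which limits M by powers of X. *)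
Lemma solution_estimates M : 0 < M -> Lnorm_on Omega +oo%E w = M%:E ->
  let X := fine (Lnorm_on Omega p%:E w) in
  let V := volume Omega in
  [/\ 0 < X, 0 < V, 0 < lambda_p Omega p,
    lambda_p Omega p * X `^ p <= c * (V `^ (1 - q / p) * X `^ q) + d * (V `^ (1 - 1 / p) * X `^ 1) &
    M <= Num.max (dg_const n p q (4 * (c + 1)) * X `^ (p * p / (n%:R * (p - q) + p * p)))
                 (dg_const n p 1 (2 * (d + 1)) * X `^ (p * p / (n%:R * (p - 1) + p * p)))].
Proof.
move=> M0 Mw X V.
have [v [H [A [b [W [mA mb NA Nb] weak [AH bv] [vM v_out NvE vess]]]]]] :=
  solution_representative M0 Mw.
have [mv mH _] := W; have [Nv NH] := W0_lty p1 W.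
have Ofin := bounded_rV_lty bO mO.
have VE : mu Omega = V%:E by rewrite /V /volume fineK// ge0_fin_numE.
have XE : Np mu p v = X%:E by rewrite /X -NvE fineK// ge0_fin_numE ?Np_ge0.
have X00 : 0 <= X by rewrite -lee_fin -XE Np_ge0.
have PX : powint mu p v = (X `^ p)%:E by rewrite powint_Np// XE poweR_EFin.
(* M is the essential supremum of |v|, so 3M/4 is not an essential bound. *)
have posv : (0 < mu [set x | (3 / 4 * M < `|v x|)%R])%E.
  rewrite lt_neqAle measure_ge0 andbT; apply/eqP => E0.
  have : 3 / 4 * M < M by lra.
  move=> /vess; apply; exists [set x | 3 / 4 * M < `|v x|]; split => //.
    rewrite -[X in measurable X]setTI.
    apply: (measurable_fun_ltr _ _ measurableT (_ : measurable [set true])) => //.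
    exact: measurableT_comp.
  by move=> x /= /negP; rewrite -ltNge.
have V0 : 0 < V.
  rewrite -lte_fin -VE; apply: lt_le_trans posv _; apply: le_measure; rewrite ?inE//.
    rewrite -[X in measurable X]setTI.
    apply: (measurable_fun_ltr _ _ measurableT (_ : measurable [set true])) => //.
    exact: measurableT_comp.
  move=> x /= Hx; have [//|/v_out vx] := pselect (Omega x).
  by move: Hx; rewrite vx normr0; lra.
have X0 : 0 < X.
  rewrite lt_neqAle X00 andbT; apply/eqP => E0.
  have P0 : powint mu p v = 0%E by rewrite PX -E0 powR0// gt_eqF.
  apply: (vess 0 M0); apply: filterS (powint_eq0 mv P0) => x ->.
  by rewrite normr0.
(* The solution itself is nontrivial, so a nonzero test function exists and [lambda_p] is the
   positive Rayleigh infimum. *)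
have ex : exists2 phi, test_function Omega phi & (0 < powint mu p phi)%E.
  by apply: (W0_test_ex p1 W); rewrite PX lte_fin powR_gt0.
have lE := lambda_pE p1 mO n0 bO ex.
have l0 := rayleigh_inf_gt0 p1 mO n0 bO ex.
split => //; first by rewrite lE.
- have p1' : 1 <= p by exact: ltW.
  have B1 := powint_le_volume p0 mO mv v_out V0 VE X00 PX q0 qp.
  have B2 := powint_le_volume p0 mO mv v_out V0 VE X00 PX ltr01 p1'.
  rewrite lE -lee_fin EFinM -PX; apply: (le_trans (W0_rayleigh p1 W)).
  apply: (le_trans (energy_self p1 mA mb NA Nb weak W AH c0 d0 bv)).
  by rewrite EFinD !EFinM leeD// lee_wpmul2l ?lee_fin.
pose L := 2 * c * M `^ (q - 1) + d.
have Mq : 0 < M `^ (q - 1) by rewrite powR_gt0.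
have dg B s : s <= p -> 0 < B -> L <= B * M `^ (s - 1) ->
    M <= dg_const n p s B * X `^ (p * p / (n%:R * (p - s) + p * p)).
  move=> sp B0 LB; apply: dg_solve => //.
  have BM : 0 < B * M `^ (s - 1) by rewrite mulr_gt0// powR_gt0.
  rewrite -lee_fin -PX; apply: (de_giorgi_bound n0 p1 W M0 BM _ posv) => k kM.
  have En := energy_trunc p1 mA mb NA Nb weak W AH c0 d0 q0 bv M0 vM kM.
  apply: le_trans En _.
  by rewrite lee_wpmul2r ?powint_ge0// lee_fin.
(* If the first term dominates, L <= 4 c M^(q-1) and the exponent is s = q; otherwise L <= 2 d and s
   = 1. The constants use c + 1 and d + 1 to stay positive when c or d is 0. *)
rewrite le_max; have [h|h] := leP d (2 * c * M `^ (q - 1)); apply/orP; [left|right].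
  apply: dg => //; first by rewrite mulr_gt0// ltr_wpDl.
  apply: (le_trans (lerD (lexx _) h)).
  have : 0 <= M `^ (q - 1) by exact: ltW.
  by rewrite /L; move: (M `^ (q - 1)) => t t0; lra.
apply: dg; [exact: ltW|by rewrite mulr_gt0// ltr_wpDl|].
by rewrite subrr powRr0 /L; lra.
Qed.

End bounded_solution.

Theorem corollary7p1 (R : realType) :
  exists (C1 : nat -> R -> R -> R -> R -> R) (C2 : nat -> R -> R -> R -> R),
  forall (n : nat) (p q rho c d : R),
  (0 < n)%N -> 1 < p -> 0 < q -> q <= p -> 1 < rho -> 0 <= c -> 0 <= d ->
  let K1 := C1 n p q rho c in
  let K2 := C2 n p rho d in
  [/\ 0 < K1, 0 < K2 &
  forall (Omega : set 'rV[R]_n) (a : 'rV[R]_n -> 'rV[R]_n -> 'rV[R]_n)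
         (f : R -> R) (w : 'rV[R]_n -> R),
  open Omega -> bounded_set Omega ->
  (* regularity and structure of a *)
  {within closure Omega `*` [set: 'rV[R]_n],
    continuous (fun xz : 'rV[R]_n * 'rV[R]_n => a xz.1 xz.2)} ->
  C1_upto (Omega `*` [set z | z != 0]) (closure Omega `*` [set z | z != 0])
    (fun xz : 'rV[R]_n * 'rV[R]_n => a xz.1 xz.2) ->
  (forall x, Omega x -> a x 0 = 0) ->
  (forall x z xi, Omega x -> z != 0 ->
    (p - 1) * enorm z `^ (p - 2) * enorm xi ^+ 2
      <= dotrV ('D_xi (a x) z) xi) ->
  (exists2 C : R, 0 < C & forall x z xi, Omega x -> z != 0 ->
    enorm ('D_xi (a x) z) <= C * enorm z `^ (p - 2) * enorm xi) ->
  (* f is C^1 with the growth bound; t = 0 is left out because |0|^(q-1) is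
     infinite for q < 1 (while powR gives 0); for q >= 1 the bound at 0 follows
     by continuity *)
  (forall t, derivable f t 1) -> continuous (derive1 f) ->
  (forall t, t != 0 -> `|f t| <= c * `|t| `^ (q - 1) + d) ->
  (* w is a bounded solution *)
  weak_solution Omega p a f w -> (Lnorm_on Omega +oo w < +oo)%E ->
  let lam := lambda_p Omega p in
  let vol := volume Omega in
  [/\ (* the estimate defining the constants, with r = p *)
      (let r := p in
       let wr := fine (Lnorm_on Omega r%:E w) in
       (Lnorm_on Omega +oo w <=
         (Num.max (K1 * wr `^ (r * p / (n%:R * (p - q) + r * p)))
                  (K2 * wr `^ (r * p / (n%:R * (p - 1) + r * p))))%:E)%E),
      (* (i) *)
      (p = q -> c < lam ->
       let kappa1 := p ^+ 2 / (n%:R * (p - 1) + p ^+ 2) in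
       (Lnorm_on Omega +oo w <=
         (Num.max (K1 * (d / (lam - c)) `^ (1 / (p - 1)) * vol `^ (1 / p))
                  (K2 * (d / (lam - c)) `^ (kappa1 / (p - 1))
                      * vol `^ (kappa1 / p)))%:E)%E)
    & (* (ii) *)
      (q < p ->
       let r := p in
       let tau := vol `^ (1 / p) *
         Num.max ((2 * c / lam) `^ (1 / (p - q)))
                 ((2 * d / lam) `^ (1 / (p - 1))) in
       (Lnorm_on Omega +oo w <=
         (Num.max (K1 * tau `^ (r * p / (n%:R * (p - q) + r * p)))
                  (K2 * tau `^ (r * p / (n%:R * (p - 1) + r * p))))%:E)%E)]].
Proof.
exists (fun n p q _ c => dg_const n p q (4 * (c + 1))).
exists (fun n p _ d => dg_const n p 1 (2 * (d + 1))).
move=> n p q rho c d n0 p1 q0 qp _ c0 d0 K1 K2.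
have p0 : 0 < p by exact: lt_trans p1.
have nR : 0 < n%:R :> R by rewrite ltr0n.
have K10 : 0 < K1 by rewrite dg_const_gt0// mulr_gt0// ltr_wpDl.
have K20 : 0 < K2 by rewrite dg_const_gt0// mulr_gt0// ltr_wpDl.
split => // Omega a f w oO bO ca da a0 ell grow df _ fb sol wfin lam vol.
have [M wM] : exists M : R, Lnorm_on Omega +oo%E w = M%:E.
  by exists (fine (Lnorm_on Omega +oo%E w)); rewrite fineK// ge0_fin_numE// Lnorm_ge0.
have : 0 <= M by rewrite -lee_fin -wM Lnorm_ge0.
(* For M = 0 all right-hand sides are nonnegative; the estimates below involve division by powers of
   M. *)
rewrite wM le_eqVlt => /predU1P[<-|M0].
  have nn (x y : R) : 0 <= x -> ((0 : R)%:E <= (Num.max x y)%:E)%E.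
    by move=> x0; rewrite lee_fin le_max x0.
  split.
  - by apply: nn; rewrite mulr_ge0 ?powR_ge0// ltW.
  - by move=> _ _; apply: nn; rewrite !mulr_ge0 ?powR_ge0// ltW.
  - by move=> _; apply: nn; rewrite mulr_ge0 ?powR_ge0// ltW.
have [X0 V0 l0 en Xb] :=
  solution_estimates n0 p1 q0 qp c0 d0 oO bO ca da a0 ell grow df fb sol M0 wM.
move: X0 V0 l0 en Xb; rewrite -/lam -/vol -/K1 -/K2.
clearbody K1 K2 lam vol; set X := fine (Lnorm_on Omega p%:E w) => X0 V0 l0 en Xb.
(* The De Giorgi bound increases with X, so (i) and (ii) reduce to upper bounds Y for X. *)
have mono (Y : R) : X <= Y -> M <= Num.max (K1 * Y `^ (p * p / (n%:R * (p - q) + p * p)))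
    (K2 * Y `^ (p * p / (n%:R * (p - 1) + p * p))).
  move=> XY; apply: (le_trans Xb); rewrite ge_max !le_max.
  have Y0 : 0 <= Y by exact: le_trans (ltW X0) XY.
  have E s : s <= p -> X `^ (p * p / (n%:R * (p - s) + p * p)) <= Y `^ (p * p / (n%:R * (p - s) + p * p)).
    move=> sp; apply: ge0_ler_powR; rewrite ?nnegrE ?(ltW X0)//.
    by rewrite divr_ge0 ?addr_ge0 ?mulr_ge0 ?subr_ge0 ?(ltW p0) ?(ltW nR).
  have -> : K1 * X `^ (p * p / (n%:R * (p - q) + p * p)) <=
      K1 * Y `^ (p * p / (n%:R * (p - q) + p * p)).
    by apply: ler_wpM2l; [exact: ltW|exact: E].
  apply/orP; right; apply: ler_wpM2l; [exact: ltW|].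
  by apply: E; exact: ltW.
split.
- by move=> r wr; rewrite lee_fin; exact: mono.
- move=> pq cl; cbv zeta; set kappa1 := p ^+ 2 / _; rewrite lee_fin.
  have L0 : 0 < lam - c by rewrite subr_gt0.
  (* For p = q the c-term is c X^p and is absorbed on the left, leaving (lam - c) X^p at most the
     d-term. *)
  have XY : X <= (d / (lam - c)) `^ (1 / (p - 1)) * vol `^ (1 / p).
    apply: power_bound => //.
    rewrite mulrBl lerBlDl; apply: le_trans en _.
    by rewrite -pq divff ?gt_eqF// subrr powRr0 mul1r.
  (* With p = q the first exponent becomes 1 and the second is [kappa1]. *)
  have := mono _ XY; rewrite -pq subrr mulr0 add0r divff ?gt_eqF ?mulr_gt0//.
  rewrite powRr1 ?mulr_ge0 ?powR_ge0// mulrA.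
  rewrite -expr2 -/kappa1 [(_ * vol `^ _) `^ kappa1]powRM ?powR_ge0// -!powRrM mulrA.
  by rewrite !div1r ![_^-1 * kappa1]mulrC.
- move=> qp'; cbv zeta; rewrite lee_fin; apply: mono; rewrite mulrC.
  have cV : 0 <= c * (vol `^ (1 - q / p) * X `^ q) by rewrite !mulr_ge0 ?powR_ge0.
  have dV : 0 <= d * (vol `^ (1 - 1 / p) * X `^ 1) by rewrite !mulr_ge0 ?powR_ge0.
  (* The sum is at most twice its larger term, whence the factors 2 c and 2 d in [tau]. *)
  have [h|/ltW h] := leP (d * (vol `^ (1 - 1 / p) * X `^ 1)) (c * (vol `^ (1 - q / p) * X `^ q)).
    apply: (@le_trans _ _ ((2 * c / lam) `^ (1 / (p - q)) * vol `^ (1 / p))).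
      apply: power_bound => //; first by rewrite mulr_ge0.
      by apply: (le_trans en); rewrite -mulrA; lra.
    by rewrite ler_wpM2r ?powR_ge0// le_max lexx.
  apply: (@le_trans _ _ ((2 * d / lam) `^ (1 / (p - 1)) * vol `^ (1 / p))).
    apply: power_bound => //; first by rewrite mulr_ge0.
    by apply: (le_trans en); rewrite -mulrA; lra.
  by rewrite ler_wpM2r ?powR_ge0// le_max lexx orbT.
Qed.
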